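(* Let $\mathcal{T}$ be a compact $3$-manifold triangulation built from $n$ tetrahedra. The standard solution set for $\mathcal{T}$ can be computed by the following algorithm. 1. Use direct enumeration to compute the quadrilateral solution set for $\mathcal{T}$. 2. Apply the quadrilateral-to-standard conversion procedure (described in the context) to this quadrilateral solution set; its output is the standard solution set for $\mathcal{T}$.
   Context: Triangulations. A compact $3$-manifold triangulation $\mathcal{T}$ is a finite collection of tetrahedra $\Delta_1,\ldots,\Delta_n$, some or all of whose $4n$ faces are affinely identified in pairs, such that the resulting topological space is a compact $3$-manifold (possibly with boundary). Different vertices (or edges, or faces) of the same tetrahedron may be identified. Vertices, edges and faces of $\mathcal{T}$ are equivalence classes of tetrahedron vertices, edges and faces. A face not identified with another is a boundary face; boundary edges are those lying in the boundary. Normal discs. In each tetrahedron there are seven normal disc types: four triangle types (each surrounding one vertex of the tetrahedron) and three quadrilateral types (each separating one pair of opposite edges). Vectors in $\mathbb{R}^{7n}$ are written $(t_{1,1},t_{1,2},t_{1,3},t_{1,4},q_{1,1},q_{1,2},q_{1,3};\ \ldots,q_{n,3})$, where $t_{i,j}$ corresponds to the $j$th triangle type and $q_{i,k}$ to the $k$th quadrilateral type in $\Delta_i$; positions are numbered $1,\ldots,7n$ in this order and $w_p$ is the coordinate of $\mathbf{w}$ in position $p$. Vectors in $\mathbb{R}^{3n}$ are written $(q_{1,1},q_{1,2},q_{1,3};\ldots,q_{n,3})$. Standard matching equations (on $\mathbb{R}^{7n}$): for each non-boundary face $F$ and each edge $e$ of $F$, let $\Delta_i,\Delta_j$ be the two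 tetrahedra joined along $F$. In each there is exactly one triangle type and one quadrilateral type meeting $F$ in an arc parallel to $e$; if these have coordinates $t_{i,a},q_{i,b}$ and $t_{j,c},q_{j,d}$, the equation is $t_{i,a}+q_{i,b}=t_{j,c}+q_{j,d}$. Quadrilateral matching equations (on $\mathbb{R}^{3n}$): for each non-boundary edge $e$, the tetrahedra containing $e$ are arranged in a cycle $\Delta_{i_1},\ldots,\Delta_{i_k}$ around $e$. Choose a direction around the cycle and label the ends of $e$ upper and lower. In each of these tetrahedra two quadrilateral types meet $e$: the upward one, rising from the lower end to the upper end as we move around the cycle (it cuts off the lower end of $e$ in the face through which we enter the tetrahedron and the upper end in the face through which we leave), and the downward one, falling in the opposite direction. With upward coordinates $q_{i_1,u_1},\ldots,q_{i_k,u_k}$ and downward coordinates $q_{i_1,d_1},\ldots,q_{i_k,d_k}$, the equation is $\sum_s q_{i_s,u_s}=\sum_s q_{i_s,d_s}$. Quadrilateral constraints (on $\mathbb{R}^{7n}$ or $\mathbb{R}^{3n}$): for each $i$, at most one of $q_{i,1},q_{i,2},q_{i,3}$ is non-zero. A vector in $\mathbb{R}^{7n}$ (resp. $\mathbb{R}^{3n}$) is admissible if its entries are non-negative, it satisfies the standard (resp. quadrilateral) matching equations, and it satisfies the quadrilateral constraints. Solution sets. The standard projective solution space $\mathscr{S}(\mathcal{T})\subset\mathbb{R}^{7n}$ (resp. quadrilateral projective solution space $\mathscr{Q}(\mathcal{T})\subset\mathbb{R}^{3n}$) is the polytope of all vectors with non-negative coordinates summing to $1$ that satisfy the standard (resp.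 quadrilateral) matching equations. The standard (resp. quadrilateral) solution set is the finite set of all vertices of $\mathscr{S}(\mathcal{T})$ (resp. $\mathscr{Q}(\mathcal{T})$) that satisfy the quadrilateral constraints. The projective image of $\mathbf{x}\ne\mathbf{0}$ is $\overline{\mathbf{x}}=\mathbf{x}/\sum x_i$, and $\overline{\mathbf{0}}=\mathbf{0}$. Direct enumeration. This is a previously known procedure (a modified double description method for polytope vertex enumeration) which, given $\mathcal{T}$, terminates and outputs the quadrilateral solution set for $\mathcal{T}$; only this input/output behaviour is used. Vertex links and canonical vectors. For a vertex $V$ of $\mathcal{T}$, $\ell(V)\in\mathbb{R}^{7n}$ is the vector with $1$ in each triangular coordinate whose disc type surrounds $V$ and $0$ elsewhere. A vector $\mathbf{w}\in\mathbb{R}^{7n}$ is canonical if for every vertex $V$, all triangular coordinates of $\mathbf{w}$ for disc types surrounding $V$ are $\ge 0$ and at least one of them equals $0$. The quadrilateral projection $\pi:\mathbb{R}^{7n}\to\mathbb{R}^{3n}$ deletes all triangular coordinates. For admissible $\mathbf{w}\in\mathbb{R}^{3n}$, the canonical extension $\varepsilon(\mathbf{w})$ is the unique admissible canonical vector in $\mathbb{R}^{7n}$ with $\pi(\varepsilon(\mathbf{w}))=\mathbf{w}$. Let $V_1,\ldots,V_m$ be the vertices of $\mathcal{T}$. For $\mathbf{w}\in\mathbb{R}^{7n}$, $\kappa_v^{(r)}(\mathbf{w})=\mathbf{w}-\lambda\,\ell(V_r)$, where $\lambda\in\mathbb{R}$ is the largest scalar for which all coordinates of $\mathbf{w}-\lambda\ell(V_r)$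 corresponding to triangular disc types surrounding $V_r$ are non-negative. Quadrilateral-to-standard conversion procedure. Input: $\mathbf{q}_1,\ldots,\mathbf{q}_k\in\mathbb{R}^{3n}$ (the quadrilateral solution set). Let $L_0=\{\varepsilon(\mathbf{q}_1),\ldots,\varepsilon(\mathbf{q}_k)\}$ and initialise $C$ to the set of all quadrilateral coordinate positions $\{5,6,7,12,13,14,\ldots,7n-2,7n-1,7n\}$. For each $r=1,\ldots,m$, fill a list (finite set) $L_r\subset\mathbb{R}^{7n}$ as follows. (a) Insert $\kappa_v^{(r)}(\mathbf{x})$ for each $\mathbf{x}\in L_{r-1}$. (b) Insert $-\ell(V_r)$. (c) Let $T_r=\{p\mid\ell(V_r)_p\ne0\}$. For each $p\in T_r$: partition $L_r$ into $S_0,S_+,S_-$ according to whether $x_p=0$, $x_p>0$, $x_p<0$; set $L'=S_0\cup S_+$; for each pair $\mathbf{u}\in S_+$, $\mathbf{w}\in S_-$ such that (A) for each tetrahedron at least two of its three quadrilateral coordinates are zero in both $\mathbf{u}$ and $\mathbf{w}$ simultaneously, and (B) there is no $\mathbf{z}\in L_r$ other than $\mathbf{u},\mathbf{w}$ with $z_i=0$ whenever $i\in C$ and $u_i=w_i=0$, insert $(u_p\mathbf{w}-w_p\mathbf{u})/(u_p-w_p)$ into $L'$; then replace $L_r$ by $L'$ and insert $p$ into $C$. (d) Insert $\ell(V_r)$ into $L_r$. Output: the projective images $\overline{\mathbf{v}}$ of all $\mathbf{v}\in L_m$. *)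

(* Defs.v *)
From HB Require Import structures.
From Stdlib Require Import Relations.
From mathcomp Require Import all_boot all_order all_fingroup all_algebra.
From mathcomp Require Import all_classical all_reals all_analysis.
Set Implicit Arguments.
Unset Strict Implicit.
Unset Printing Implicit Defensive.
Import Order.TTheory GRing.Theory Num.Theory.
Import numFieldNormedType.Exports.
Local Open Scope ring_scope.
Local Open Scope quotient_scope.

(* The tetrahedra are indexed by ['I_n] and the vertices of each one by ['I_4];
  face [f] is the face opposite vertex [f].  [gluing T i f = Some (j, s)] means
  that face [f] of tetrahedron [i] is identified with face [s f] of tetrahedron
  [j] by the affine map sending vertex [v <> f] to vertex [s v] (so [s] also
  sends the vertex opposite the first face to the one opposite the second).
  [gluing T i f = None] means that the face is a boundary face. *)
Record triangulation (n : nat) := Triangulation {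
  gluing : 'I_n -> 'I_4 -> option ('I_n * 'S_4);
  gluing_sym : forall i f j s,
    gluing i f = Some (j, s) -> gluing j (s f) = Some (i, (s^-1)%g);
  gluing_neq : forall i f j s, gluing i f = Some (j, s) -> (j, s f) <> (i, f) }.

Section Realization.
Variables (R : realType) (n : nat).

Definition simplex3 : set 'rV[R]_4 :=
  [set x | (forall v, 0 <= x ord0 v) /\ \sum_v x ord0 v = 1]%classic.

Definition tetrahedra : topologicalType := {i : 'I_n & set_type simplex3}.

Definition bary (p : tetrahedra) : 'rV[R]_4 := set_val (tagged p).

Variable T : triangulation n.

Definition glued_points (p q : tetrahedra) : Prop :=
  exists f s, [/\ gluing T (tag p) f = Some (tag q, s), bary p ord0 f = 0
                & forall v, bary q ord0 (s v) = bary p ord0 v].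

Definition identified : rel tetrahedra :=
  fun p q => `[< clos_refl_sym_trans _ glued_points p q >].

Lemma identified_is_equiv : equiv_class_of identified.
Proof.
split=> [p|p q|q p r].
- by apply/asboolP; exact: rst_refl.
- by apply/asboolP/asboolP; exact: rst_sym.
- by move=> /asboolP pq /asboolP qr; apply/asboolP; exact: rst_trans pq qr.
Qed.

Canonical identified_equiv := EquivRelPack identified_is_equiv.

Definition realization : topologicalType :=
  quotient_topology {eq_quot identified}.

End Realization.

Section Manifold.
Variable R : realType.
Local Open Scope classical_set_scope.

Definition half_space3 : set 'rV[R]_3 := [set x | 0 <= x ord0 ord0].

(* [f] and [g] are mutually inverse homeomorphisms between an open
   neighbourhood [U] of [p] and an open subset of the closed half-space *)
Definition has_half_space_chart (M : topologicalType) (p : M) : Prop :=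
  exists (U : set M) (W : set 'rV[R]_3) (f : M -> 'rV[R]_3) (g : 'rV[R]_3 -> M),
    [/\ open U /\ U p, open W,
        (forall x, U x -> (W `&` half_space3) (f x) /\ g (f x) = x),
        (forall y, (W `&` half_space3) y -> U (g y) /\ f (g y) = y)
      & {within U, continuous f} /\
        {within W `&` half_space3, continuous g}].

Definition compact_3manifold (M : topologicalType) : Prop :=
  [/\ hausdorff_space M, @second_countable M, compact [set: M]
    & forall p : M, has_half_space_chart p].

End Manifold.

Section NormalCoordinates.
Variables (R : realType) (n : nat).

(* A vector of R^(7n) is an n x (4 + 3) matrix: row [i] holds
  [t_(i,1), ..., t_(i,4), q_(i,1), q_(i,2), q_(i,3)], so that reading the
  matrix row by row gives the usual order of the coordinates.
  A vector of R^(3n) is an n x 3 matrix. *)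
Definition std_vec : Type := 'M[R]_(n, 4 + 3).
Definition quad_vec : Type := 'M[R]_(n, 3).
Definition position : finType := ('I_n * 'I_(4 + 3))%type.

Definition entry (w : std_vec) (p : position) : R := w p.1 p.2.
Definition tri (w : std_vec) (i : 'I_n) (v : 'I_4) : R := w i (lshift 3 v).
Definition quad (w : std_vec) (i : 'I_n) (k : 'I_3) : R := w i (rshift 4 k).

Definition quad_proj (w : std_vec) : quad_vec := rsubmx w.

End NormalCoordinates.

(* Triangle type [v] surrounds vertex [v] of the tetrahedron; quadrilateral
   type [k] separates vertices [0, k+1] from the other two. *)
Definition quad_side (k : 'I_3) : {set 'I_4} := [set ord0; lift ord0 k]%SET.

(* for [a != b], the unique quadrilateral type having [a] and [b] on the same
   side *)
Definition quad_type (a b : 'I_4) : 'I_3 :=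
  odflt ord0 [pick k | (a \in quad_side k) == (b \in quad_side k)].

Section Equations.
Variables (R : realType) (n : nat) (T : triangulation n).

(* The edge of the face [f] is given by the vertex [v <> f] of that face opposite
  to it.  The arcs parallel to the edge cut [v] off from the rest of the face:
  they come from the triangles around [v] and from the quadrilaterals that have
  [v] and [f] on the same side. *)
Definition std_matching (w : std_vec R n) : Prop :=
  forall i f j s v, gluing T i f = Some (j, s) -> v != f ->
    tri w i v + quad w i (quad_type v f) =
    tri w j (s v) + quad w j (quad_type (s v) (s f)).

(* A state [(i, r)] of a walk around an edge [e]: we are in tetrahedron [i],
   [r 0] and [r 1] are the lower and upper ends of [e], and we entered through
   the face spanned by [r 0, r 1, r 2] and leave through the face spanned by
   [r 0, r 1, r 3], that is, through the face opposite [r 2]. *)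
Definition edge_state : finType := ('I_n * 'S_4)%type.

Definition o0 : 'I_4 := inord 0.
Definition o1 : 'I_4 := inord 1.
Definition o2 : 'I_4 := inord 2.
Definition o3 : 'I_4 := inord 3.

(* Permutations compose from left to right: in the new state the roles [2] and
   [3] are played by the images of [r 3] and [r 2]. *)
Definition next_state (x : edge_state) : option edge_state :=
  if gluing T x.1 (x.2 o2) is Some (j, s) then Some (j, (tperm o2 o3 * x.2 * s)%g)
  else None.

(* A complete simple turn around an edge.  The walk stops at boundary faces, so
   that turns exist only around non-boundary edges; every choice of starting
   point, direction and labelling of the ends gives such a turn.  The empty turn
   contributes the trivial equation. *)
Definition edge_turn (c : seq edge_state) : bool :=
  ucycleb (fun x y => next_state x == Some y) c.

(* The upward quadrilateral cuts off [r 0] in the entry face [r 0, r 1, r 2] and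
   [r 1] in the exit face [r 0, r 1, r 3]: it separates [r 0, r 3] from
   [r 1, r 2].  The downward one separates [r 0, r 2] from [r 1, r 3]. *)
Definition up_quad (x : edge_state) : 'I_3 := quad_type (x.2 o0) (x.2 o3).
Definition down_quad (x : edge_state) : 'I_3 := quad_type (x.2 o0) (x.2 o2).

Definition quad_matching (w : quad_vec R n) : Prop :=
  forall c, edge_turn c ->
    \sum_(x <- c) w x.1 (up_quad x) = \sum_(x <- c) w x.1 (down_quad x).

Definition quad_constraints (w : quad_vec R n) : Prop :=
  forall i k l, w i k != 0 -> w i l != 0 -> k = l.

Definition nonneg_mx (m : nat) (w : 'M[R]_(n, m)) : Prop :=
  forall i j, 0 <= w i j.

Definition std_admissible (w : std_vec R n) : Prop :=
  [/\ nonneg_mx w, std_matching w & quad_constraints (quad_proj w)].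

Definition coord_sum (m : nat) (w : 'M[R]_(n, m)) : R := \sum_i \sum_j w i j.

Definition std_solution_space : set (std_vec R n) :=
  [set w | [/\ nonneg_mx w, coord_sum w = 1 & std_matching w]]%classic.

Definition quad_solution_space : set (quad_vec R n) :=
  [set w | [/\ nonneg_mx w, coord_sum w = 1 & quad_matching w]]%classic.

(* vertices (extreme points) of a polytope *)
Definition polytope_vertex (V : lmodType R) (P : set V) (x : V) : Prop :=
  P x /\ forall y z (t : R), P y -> P z -> 0 < t < 1 ->
    x = t *: y + (1 - t) *: z -> y = z.

Definition std_solution_set : set (std_vec R n) :=
  [set w : 'M[R]_(n, 4 + 3) | polytope_vertex std_solution_space w /\
                              quad_constraints (quad_proj w)]%classic.

Definition quad_solution_set : set (quad_vec R n) :=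
  [set w : 'M[R]_(n, 3) | polytope_vertex quad_solution_space w /\
                          quad_constraints w]%classic.

(* the convention [0^-1 = 0] makes the projective image of 0 equal to 0 *)
Definition projective_image (w : std_vec R n) : std_vec R n :=
  (coord_sum w)^-1 *: (w : 'M[R]_(n, 4 + 3)).

(* a vertex [v] of the tetrahedron [i] *)
Definition corner : finType := ('I_n * 'I_4)%type.

Definition glued_corners : rel corner := fun x y =>
  [exists f, (f != x.2) &&
     (if gluing T x.1 f is Some (j, s) then y == (j, s x.2) else false)].

(* [connect glued_corners] is symmetric by [gluing_sym] *)
Definition vertices : {set {set corner}} :=
  equivalence_partition (connect glued_corners) [set: corner]%SET.

Definition link (V : {set corner}) : std_vec R n :=
  row_mx (\matrix_(i < n, v < 4) ((i, v) \in V)%:R) 0.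

Definition canonical (w : std_vec R n) : Prop :=
  forall V : {set corner}, V \in vertices ->
    (forall x, x \in V -> 0 <= tri w x.1 x.2) /\
    (exists2 x, x \in V & tri w x.1 x.2 = 0).

(* the admissible canonical vector with the given quadrilateral projection
   (0 by default if there is none) *)
Definition canonical_ext (q : quad_vec R n) : std_vec R n :=
  xget (0 : 'M[R]_(n, 4 + 3))
    [set w | [/\ std_admissible w, canonical w & quad_proj w = q]]%classic.

(* the supremum is a maximum, as [V] is not empty *)
Definition kappa (V : {set corner}) (w : std_vec R n) : std_vec R n :=
  let lam := sup [set l : R | forall x, x \in V ->
                    0 <= tri (w - l *: link V) x.1 x.2]%classic in
  w - lam *: link V.

(* The lists L_r of the conversion procedure are represented by sequences, of which only the members
  matter. *)
Definition quad_positions : {set position n} :=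
  [set (i, rshift 4 k) | i in 'I_n, k in 'I_3]%SET.

Definition link_positions (V : {set corner}) : {set position n} :=
  [set p | entry (link V) p != 0]%SET.

(* [u] and [w] jointly satisfy the quadrilateral constraints *)
Definition compatible (u w : std_vec R n) : bool :=
  [forall i, (2 <= #|[set k | (quad u i k == 0%R) && (quad w i k == 0%R)]%SET|)%N].

(* no other member of [L] vanishes at all the positions of [C] where both [u]
   and [w] vanish *)
Definition comb_adjacent (C : {set position n}) (L : seq (std_vec R n))
    (u w : std_vec R n) : bool :=
  ~~ has (fun z : 'M[R]_(n, 4 + 3) => [&& z != u, z != w &
       [forall i in C, (entry u i == 0) && (entry w i == 0) ==>
                       (entry z i == 0)]]) L.

Definition combine (p : position n) (u w : std_vec R n) : std_vec R n :=
  (entry u p - entry w p)^-1 *: (entry u p *: w - entry w p *: u).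

Definition process_position (LC : seq (std_vec R n) * {set position n})
    (p : position n) : seq (std_vec R n) * {set position n} :=
  let: (L, C) := LC in
  let S0 := [seq x <- L | entry x p == 0] in
  let Spos := [seq x <- L | 0 < entry x p] in
  let Sneg := [seq x <- L | entry x p < 0] in
  (S0 ++ Spos ++
   [seq combine p uw.1 uw.2 | uw <- [seq (u, w) | u <- Spos, w <- Sneg]
                            & compatible uw.1 uw.2 && comb_adjacent C L uw.1 uw.2],
   p |: C)%SET.

(* the passage from L_(r-1) to L_r; [order V] lists the positions of the disc
   types surrounding [V] in the order in which they are processed *)
Definition process_vertex (order : {set corner} -> seq (position n))
    (LC : seq (std_vec R n) * {set position n}) (V : {set corner}) :
    seq (std_vec R n) * {set position n} :=
  let: (L, C) := LC in
  let: (L', C') := foldl process_position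
                     (rcons [seq kappa V x | x <- L] (- link V), C) (order V) in
  (rcons L' (link V), C').

Definition conversion (order : {set corner} -> seq (position n))
    (Vs : seq {set corner}) (qs : seq (quad_vec R n)) : seq (std_vec R n) :=
  let: (L, _) := foldl (process_vertex order)
                   ([seq canonical_ext q | q <- qs], quad_positions) Vs in
  [seq projective_image v | v <- L].

End Equations.

(* Main.v *)
Require Import Defs.
From Stdlib Require Import Relations.
From mathcomp Require Import all_boot all_order all_fingroup all_algebra.
From mathcomp Require Import all_classical all_reals all_analysis.
From mathcomp Require Import ring lra.
Set Implicit Arguments.
Unset Strict Implicit.
Unset Printing Implicit Defensive.
Import Order.TTheory GRing.Theory Num.Theory.
Import numFieldNormedType.Exports.

(** For a set C of coordinate positions containing the quadrilateral ones, let
    D_C be the cone of the solutions of the standard matching equations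
    that are nonnegative on C, where two solutions that agree on C are
    identified. When C consists of all positions, D_C is the cone over the
    standard projective solution space; when it consists of the
    quadrilateral positions, D_C is the cone over the quadrilateral one,
    because every solution of the quadrilateral matching equations extends
    to a solution of the standard ones ([quad_lift]). The vertices of these
    polytopes are the normalized extreme rays of the cones
    ([polytope_vertexP]), and a ray is extreme when its set of zeros is
    maximal ([extreme]). The procedure adds the positions of one vertex
    after the other to C and keeps, for each admissible extreme ray of D_C,
    exactly one member of its list ([represents]). The admissible rays form
    a union of faces, so that the test between two compatible rays never
    needs the inadmissible ones.

    At a vertex V with link l, which vanishes on the old positions C0, the cone
    D_C fibres over D_C0 in the direction of l. As soon as one position of
    V has been processed, its extreme rays are l itself and the lower ones,
    which have a zero at V. The list does not contain l in the meantime: it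
    contains the canonical rays K above the extreme rays of D_C0, together
    with the lower extreme rays ([lower_hull]), and K does the work of l. A
    pair that has no common zero at V, which l would reveal as not
    adjacent, is revealed by a member of K; the combination of l with a
    lower ray, which takes place above one extreme ray of D_C0, is replaced
    by the combination with the canonical ray above the same extreme ray.
    This gives both directions of the adjacency test ([adjacent_extreme],
    [extreme_found]). When all the positions of V are processed, each
    member of K has a zero at V, hence is itself a lower extreme ray, and
    inserting l completes the list.

    The extension of quadrilateral solutions is where the manifold hypothesis
    is used. Given the quadrilateral coordinates, the standard equations
    prescribe the difference of the triangular coordinates of any two
    adjacent triangles of a vertex link, and the quadrilateral equations
    say that the differences add up to zero around each interior vertex of
    the link. Such differences come from triangular coordinates because the
    first cohomology of the link vanishes. To see this, the differences are
    turned into a system of local primitives on the punctured star of the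
    vertex ([germ]), determined up to constants. The vertex has a
    neighbourhood that is an open part of a half-space, where it is
    surrounded by a cubical shell; the shell is made of at most six boxes,
    successively glued along connected sets, and so the system has a global
    primitive on it ([shell_primitive]). This primitive is pulled back to a
    copy of the link close to the vertex; there it yields a function that
    is locally constant on each triangle of the link, and its values are
    the triangular coordinates ([vertex_potential]). *)

(** * Systems of local primitives *)

Local Open Scope classical_set_scope.
Local Open Scope ring_scope.

Section Primitives.
Variable R : realType.

(** The sets below need not be open: nearness is always relative to a set [Z].
    *)
Definition const_near (X : topologicalType) (Z : set X) (P : X) (h : X -> R) :=
  \forall Q \near P, Z Q -> h Q = h P.

(** [s P] stands for a local primitive around [P], which only matters up to a
    constant and near [P]. A primitive on [Z] has the same germs as the [s P],
    up to constants. This is the triviality of a local system of affine lines,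
    without any choice of an atlas. *)
Definition has_primitive (X : topologicalType) (Z : set X) (s : X -> X -> R) :=
  exists F : X -> R, forall P, Z P -> const_near Z P (fun Q => F Q - s P Q).

(** Connectedness in the only form used here. *)
Definition loc_const_connected (X : topologicalType) (Z : set X) :=
  forall h : X -> R, (forall P, Z P -> const_near Z P h) ->
  forall P Q, Z P -> Z Q -> h P = h Q.

Lemma has_primitive_sub (X : topologicalType) (Z Z' : set X) s :
  Z' `<=` Z -> has_primitive Z s -> has_primitive Z' s.
Proof.
move=> sub [F HF]; exists F => P Z'P; have := HF P (sub _ Z'P).
by apply: filterS => Q H /sub.
Qed.

Lemma const_near_sub (X : topologicalType) (Z Z' : set X) P h :
  Z' `<=` Z -> const_near Z P h -> const_near Z' P h.
Proof. by move=> sub; apply: filterS => Q H /sub. Qed.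

(** The difference of the two primitives is locally constant on [A `&` B],
    hence constant there, and can be subtracted from one of them. As [A] and
    [B] are closed, a point of only one of them has a neighbourhood that avoids
    the other. *)
Lemma has_primitive_glue (X : topologicalType) (A B : set X) s :
  closed A -> closed B -> loc_const_connected (A `&` B) ->
  has_primitive A s -> has_primitive B s -> has_primitive (A `|` B) s.
Proof.
move=> cA cB cAB [F HF] [G HG].
have [k Hk] : exists k, forall P, A P -> B P -> F P = G P + k.
  have [[P0 [A0 B0]]|none] := pselect (exists P, A P /\ B P); last first.
    by exists 0 => P AP BP; case: none; exists P.
  exists (F P0 - G P0) => P AP BP.
  suff: F P - G P = F P0 - G P0 by lra.
  apply: (cAB (fun P => F P - G P)) => // {AP BP}P [AP BP].
  near=> Q => -[AQ BQ].
  have H1 : F Q - s P Q = F P - s P P by move: AQ; near: Q; exact: HF.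
  have H2 : G Q - s P Q = G P - s P P by move: BQ; near: Q; exact: HG.
  lra.
pose H P := if pselect (A P) then F P else G P + k.
have HA P : A P -> H P = F P by rewrite /H; case: pselect.
have HB P : B P -> H P = G P + k.
  by move=> BP; rewrite /H; case: pselect => // AP; rewrite (Hk P).
exists H => P ABP.
have nearA : \forall Q \near P, A Q -> H Q - s P Q = H P - s P P.
  have [AP|nAP] := pselect (A P).
    apply: filterS (HF P AP) => Q HQ AQ.
    by rewrite HA // HQ // HA.
  have : \forall Q \near P, (~` A) Q.
    by apply: open_nbhs_nbhs; split => //; exact: closed_openC.
  by apply: filterS => Q nAQ /nAQ.
have nearB : \forall Q \near P, B Q -> H Q - s P Q = H P - s P P.
  have [BP|nBP] := pselect (B P).
    apply: filterS (HG P BP) => Q HQ BQ.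
    by have := HQ BQ; rewrite !HB //; lra.
  have : \forall Q \near P, (~` B) Q.
    by apply: open_nbhs_nbhs; split => //; exact: closed_openC.
  by apply: filterS => Q nBQ /nBQ.
by apply: filterS2 nearA nearB => Q hA hB [/hA|/hB].
Unshelve. all: by end_near. Qed.

Lemma has_primitive_comap (X X' : topologicalType) (g : X' -> X) (Z : set X')
    (S : set X) (s : X -> X -> R) :
  (forall z, Z z -> S (g z)) ->
  (forall z A, Z z -> nbhs (g z) A -> \forall z' \near z, Z z' -> A (g z')) ->
  has_primitive S s -> has_primitive Z (fun a b => s (g a) (g b)).
Proof.
move=> gS cg [F HF]; exists (F \o g) => z Zz.
have := cg z _ Zz (HF _ (gS _ Zz)).
by apply: filterS => z' H Zz'; apply: H => //; exact: gS.
Qed.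

Lemma loc_const_connectedU (X : topologicalType) (A B : set X) :
  loc_const_connected A -> loc_const_connected B ->
  (exists P, A P /\ B P) -> loc_const_connected (A `|` B).
Proof.
move=> cA cB [P0 [A0 B0]] h Hh.
suff H P : (A `|` B) P -> h P = h P0 by move=> P Q /H-> /H->.
case=> [AP|BP].
- apply: (cA h) => // Q AQ.
  by apply: const_near_sub (Hh Q (or_introl AQ)) => x; left.
- apply: (cB h) => // Q BQ.
  by apply: const_near_sub (Hh Q (or_intror BQ)) => x; right.
Qed.

(** Let [c] be the supremum of the points [x] such that [P a x]: locality at
    [c] allows one to go beyond [c] unless [c = b]. *)
Lemma interval_ind (P : R -> R -> Prop) (a b : R) : a <= b ->
  (forall x y z, x <= y -> y <= z -> P x y -> P y z -> P x z) ->
  (forall t, a <= t <= b -> exists2 e : R, 0 < e &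
     forall x y, a <= x -> y <= b -> t - e <= x -> x <= t -> t <= y -> y <= t + e -> P x y) ->
  P a b.
Proof.
move=> ab Padd Ploc.
pose S := [set x | a <= x <= b /\ P a x].
have Sa : S a.
  split; first by rewrite lexx.
  have [|e e0 H] := Ploc a; first by rewrite lexx.
  by apply: H; lra.
have hS : has_sup S.
  by split; [exists a | exists b => x [/andP[]]].
pose c := sup S.
have ac : a <= c by apply: sup_upper_bound.
have cb : c <= b by apply: ge_sup; [exists a|move=> x [/andP[]]].
have [|e e0 H] := Ploc c; first by rewrite ac cb.
have [x [/andP[ax xb] Pax] cx] := @sup_adherent _ S e e0 hS.
have xc : x <= c by apply: sup_upper_bound => //; split => //; rewrite ax xb.
pose y := Num.min b (c + e).
have Pay : P a y.
  have yb : y <= b by rewrite /y ge_min lexx.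
  have ye : y <= c + e by rewrite /y ge_min lexx orbT.
  have cy : c <= y by rewrite /y le_min cb; lra.
  by apply: (Padd a x y) => //; [lra|apply: H => //; rewrite -/c in cx; lra].
have [bc|bc] := leP b (c + e); first by rewrite /y (min_idPl bc) in Pay.
have yE : y = c + e by rewrite /y (min_idPr (ltW bc)).
have : y <= c.
  by apply: sup_upper_bound => //; split => //; rewrite yE; apply/andP; split; lra.
rewrite yE; lra.
Qed.

End Primitives.

(** * Boxes and shells *)

Section Boxes.
Variables (R : realType) (d : nat).
Implicit Types (x y : 'rV[R]_d) (l h : 'I_d -> R).

Lemma rV_nbhsP x (A : set 'rV[R]_d) :
  nbhs x A <-> exists2 e : R, 0 < e &
     forall y, (forall i, `|y ord0 i - x ord0 i| < e) -> A y.
Proof.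
split=> [/nbhs_ballP[e /= e0 H]|[e e0 H]].
  exists e => // y Hy; apply: H; split=> // i j.
  by rewrite /ball /= (ord1 i) distrC; exact: Hy.
apply/nbhs_ballP; exists e => //= y [_ Hy]; apply: H => i.
by have := Hy ord0 i; rewrite /ball /= distrC.
Qed.

Definition segment_convex (Z : set 'rV[R]_d) := forall x y (t : R),
  Z x -> Z y -> 0 <= t <= 1 -> Z ((1 - t) *: x + t *: y).

Lemma segment_convex_connected (Z : set 'rV[R]_d) :
  segment_convex Z -> loc_const_connected R Z.
Proof.
move=> cZ h Hh x y Zx Zy.
pose g t := (1 - t) *: x + t *: y.
suff : h (g 0) = h (g 1) by rewrite /g subr0 subrr !scale1r !scale0r addr0 add0r.
apply: (interval_ind (P := fun a b => h (g a) = h (g b))) => //.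
  by move=> a b c _ _ -> ->.
move=> t t01.
have Zg u : 0 <= u <= 1 -> Z (g u) by exact: cZ.
have [e e0 He] := (rV_nbhsP _ _).1 (Hh _ (Zg _ t01)).
have [M M0 HM] : exists2 M : R, 0 < M & forall i, `|y ord0 i - x ord0 i| <= M.
  exists (1 + \sum_i `|y ord0 i - x ord0 i|).
    by rewrite ltr_wpDr // sumr_ge0.
  by move=> i; rewrite (bigD1 i) //= addrCA lerDl addr_ge0 // sumr_ge0.
exists (e / (2 * M)); first by rewrite divr_gt0 // mulr_gt0.
move=> u v u0 v1 tu ut tv vt.
have key w : 0 <= w <= 1 -> `|w - t| <= e / (2 * M) -> h (g w) = h (g t).
  move=> w01 wt; apply: He; last exact: Zg.
  move=> i; rewrite !mxE.
  have -> : (1 - w) * x ord0 i + w * y ord0 i - ((1 - t) * x ord0 i + t * y ord0 i)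
    = (w - t) * (y ord0 i - x ord0 i) by lra.
  rewrite normrM; apply: (@le_lt_trans _ _ (e / (2 * M) * M)).
    by apply: ler_pM.
  have -> : e / (2 * M) * M = e / 2 by field; rewrite gt_eqF.
  by rewrite ltr_pdivrMr // ltr_pMr // ltr1n.
case/andP: t01 => t0 t1.
rewrite (key u) ?(key v) //; rewrite ?ler_norml; apply/andP; split; lra.
Qed.

Definition box l h : set 'rV[R]_d := [set y | forall i, l i <= y ord0 i <= h i].

Lemma box_sub l h l' h' : (forall i, l' i <= l i) -> (forall i, h i <= h' i) ->
  box l h `<=` box l' h'.
Proof.
move=> Hl Hh y Hy i; have /andP[a b] := Hy i.
by rewrite (le_trans (Hl i) a) (le_trans b (Hh i)).
Qed.

Lemma box_setI l h l' h' :
  box l h `&` box l' h' =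
  box (fun i => Num.max (l i) (l' i)) (fun i => Num.min (h i) (h' i)).
Proof.
apply/seteqP; split=> [y [H1 H2] i|y H].
  by rewrite ge_max le_min; have /andP[-> ->] := H1 i; have /andP[-> ->] := H2 i.
split=> i; have := H i; rewrite ge_max le_min.
  by case/andP=> /andP[-> _] /andP[->].
by case/andP=> /andP[_ ->] /andP[_ ->].
Qed.

Lemma box_convex l h : segment_convex (box l h).
Proof.
move=> x y t Hx Hy /andP[t0 t1] i; rewrite !mxE.
by have /andP[a b] := Hx i; have /andP[a' b'] := Hy i; apply/andP; split; nra.
Qed.

Lemma box_connected l h : loc_const_connected R (box l h).
Proof. exact/segment_convex_connected/box_convex. Qed.

Lemma box_closed l h : closed (box l h).
Proof.
rewrite -openC openE => y Hy.
have [i Hi] : exists i, ~~ (l i <= y ord0 i <= h i).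
  by apply/existsP; rewrite -negb_forall; apply/negP => /forallP.
apply/rV_nbhsP; move: Hi; rewrite negb_and -!ltNge => /orP[lt|lt].
  exists (l i - y ord0 i); first by rewrite subr_gt0.
  move=> z /(_ i) Hz Bz; have /andP[] := Bz i.
  by move: Hz; rewrite ltr_norml => /andP[]; lra.
exists (y ord0 i - h i); first by rewrite subr_gt0.
move=> z /(_ i) Hz Bz; have /andP[] := Bz i.
by move: Hz; rewrite ltr_norml => /andP[]; lra.
Qed.

(** The coordinates are treated one after the other: for each point [x], there
    is a box that has the full size [[l i, h i]] in the first [k] directions
    and is small around [x] in the others. Going from [k] to [k + 1] is an
    induction along the interval [[l k, h k]]. *)
Lemma box_ind (T : ('I_d -> R) -> ('I_d -> R) -> Prop) l h :
  (forall i, l i <= h i) ->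
  (forall l1 h1 l2 h2, (forall i, l2 i <= l1 i) -> (forall i, h1 i <= h2 i) ->
     T l2 h2 -> T l1 h1) ->
  (forall k (t : R) l1 h1, l1 k <= t -> t <= h1 k ->
     T l1 (fun i => if i == k then t else h1 i) ->
     T (fun i => if i == k then t else l1 i) h1 -> T l1 h1) ->
  (forall x : 'I_d -> R, (forall i, l i <= x i <= h i) ->
     exists2 e : R, 0 < e & T (fun i => x i - e) (fun i => x i + e)) ->
  T l h.
Proof.
move=> lh Tmono Tglue Tloc.
suff H k : (k <= d)%N -> forall x : 'I_d -> R, (forall i, l i <= x i <= h i) ->
   exists2 e : R, 0 < e &
     T (fun i : 'I_d => if (i < k)%N then l i else x i - e)
       (fun i : 'I_d => if (i < k)%N then h i else x i + e).
  have [|e _] := H d (leqnn _) l; first by move=> i; rewrite lexx lh.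
  by apply: Tmono => i; rewrite ltn_ord.
elim: k => [_|k IH kd] x Hx; first by have [e e0 He] := Tloc x Hx; exists e.
pose k0 := Ordinal kd.
pose B (a : R) e (i : 'I_d) := if i == k0 then a else if (i < k)%N then l i else x i - e.
pose C (b : R) e (i : 'I_d) := if i == k0 then b else if (i < k)%N then h i else x i + e.
suff [e e0 He] : exists2 e : R, 0 < e & T (B (l k0) e) (C (h k0) e).
  have sub (i : 'I_d) : (i < k.+1)%N = (i == k0) || (i < k)%N.
    by rewrite ltnS leq_eqVlt.
  exists e => //; apply: Tmono He => i; rewrite sub /B /C;
    by case: eqP => [->|].
apply: (interval_ind (P := fun a b => exists2 e : R, 0 < e & T (B a e) (C b e))) => //.
  move=> a b c ab bc [e1 e10 H1] [e2 e20 H2].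
  have m0 : 0 < Num.min e1 e2 by rewrite lt_min e10.
  have m1 : Num.min e1 e2 <= e1 by rewrite ge_min lexx.
  have m2 : Num.min e1 e2 <= e2 by rewrite ge_min lexx orbT.
  exists (Num.min e1 e2) => //.
  apply: (Tglue k0 b); rewrite ?/B ?/C ?eqxx //.
    by apply: Tmono H1 => i; rewrite /B /C; case: eqP => //;
      case: (i < k)%N => //; lra.
  by apply: Tmono H2 => i; rewrite /B /C; case: eqP => //;
      case: (i < k)%N => //; lra.
move=> t Ht.
pose xt i := if i == k0 then t else x i.
have [|i|e e0 He] := IH _ xt; first exact: ltnW.
  by rewrite /xt; case: eqP => [->|].
exists e => // a b la bh ta at' tb bt.
exists e => //; apply: Tmono He => i; rewrite /B /C /xt; case: eqP => [->|_] //=;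
  rewrite ?ltnn //; lra.
Qed.


(** The two halves of a box overlap in a box, which is connected, so that
    primitives on small boxes glue. *)
Lemma box_primitive l h (s : 'rV[R]_d -> 'rV[R]_d -> R) :
  (forall x, box l h x -> exists2 U, nbhs x U & has_primitive (U `&` box l h) s) ->
  has_primitive (box l h) s.
Proof.
move=> loc.
have [lh|] := pselect (forall i, l i <= h i); last first.
  move=> nlh; exists (fun=> 0) => x Bx; exfalso; apply: nlh => i.
  by have /andP[a b] := Bx i; apply: le_trans a b.
suff : has_primitive (box l h `&` box l h) s by rewrite setIid.
apply: (box_ind (T := fun l1 h1 => has_primitive (box l1 h1 `&` box l h) s)) => //.
- move=> l1 h1 l2 h2 H1 H2; apply: has_primitive_sub => y [Hy ?]; split => //.
  exact: box_sub Hy.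
- move=> k t l1 h1 lt th HA HB.
  apply: has_primitive_sub (has_primitive_glue _ _ _ HA HB).
  + move=> y [Hy Hb]; have [yt|ty] := leP (y ord0 k) t; [left|right]; split => // i;
    have := Hy i; case: eqP => [->|] // /andP[a b]; apply/andP; split => //.
    exact: ltW.
  + by apply: closedI; exact: box_closed.
  + by apply: closedI; exact: box_closed.
  + by rewrite !box_setI; exact: box_connected.
- move=> x Hx.
  have Bx : box l h (\row_i x i) by move=> i; rewrite mxE.
  have [U /rV_nbhsP[e e0 HU] P] := loc _ Bx.
  exists (e / 2); first by rewrite divr_gt0.
  apply: has_primitive_sub P => y [Hy Hb]; split => //; apply: HU => i.
  by rewrite mxE ltr_norml; have /andP[a b] := Hy i; apply/andP; split; lra.
Qed.

End Boxes.

(** Stated so that one of the two sets may be empty, as happens when the shell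
    surrounds a point of the boundary of the half-space. *)
Lemma loc_const_connectedUI (R : realType) (X : topologicalType) (A B : set X) :
  loc_const_connected R A -> loc_const_connected R B ->
  (forall x y, A x -> B y -> exists P, A P /\ B P) -> loc_const_connected R (A `|` B).
Proof.
move=> cA cB meet.
have [[x Ax]|nA] := pselect (exists x, A x); last first.
  have -> : A `|` B = B by apply/seteqP; split=> [y [Ay|//]|y By]; [case: nA; exists y|right].
  exact: cB.
have [[y By]|nB] := pselect (exists x, B x); last first.
  have -> : A `|` B = A by apply/seteqP; split=> [y [//|By]|y Ay]; [case: nB; exists y|left].
  exact: cA.
exact: loc_const_connectedU (meet _ _ Ax By).
Qed.

Section Shell.
Variables (R : realType) (l h a b : 'I_3 -> R).

(** The part of the box [l, h] beyond the inner box [a, b] in direction [k].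
    Only the slab below in direction [0] may be empty. *)
Definition slab (k : 'I_3) (up : bool) : set 'rV[R]_3 :=
  box (fun i => if up && (i == k) then b i else l i)
      (fun i => if ~~ up && (i == k) then a i else h i).

Hypothesis lb : forall i, l i <= b i.
Hypothesis ab : forall i, a i < b i.
Hypothesis bh : forall i, b i <= h i.
Hypothesis la : forall i, i != ord0 -> l i <= a i.

Lemma slabP k up y : slab k up y <->
  box l h y /\ if up then b k <= y ord0 k else y ord0 k <= a k.
Proof.
split=> [H|[H1 H2] i].
  split=> [i|]; last by have := H k; rewrite eqxx; case: up {H} => /= /andP[].
  have := H i; have := ltW (ab i); have := lb i; have := bh i.
  case: up {H} => /=; case: eqP => // _ H1 H2 H3 /andP[H4 H5]; apply/andP; split; lra.
have := H1 i; case: up H2 => /=; case: eqP => // -> H2 /andP[H4 H5]; exact/andP.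
Qed.

Let corner (t : 'I_3 -> bool) : 'rV[R]_3 := \row_i if t i then h i else l i.

Let corner_slab t k : t k || (k != ord0) || (l k <= a k) -> slab k (t k) (corner t).
Proof.
have lh i : l i <= h i by apply: le_trans (lb i) (bh i).
move=> H; apply/slabP; split=> [i|]; first by rewrite mxE; case: (t i); rewrite ?lexx ?lh.
rewrite mxE; case: (t k) H => //= /orP[/la|] //.
Qed.

Let slab_opp k : slab k true `&` slab k false = set0.
Proof.
apply/seteqP; split=> // y [/slabP[_ H1] /slabP[_ H2]].
by have := ab k; rewrite ltNge (le_trans H1 H2).
Qed.

Let slabI_connected k up k' up' : loc_const_connected R (slab k up `&` slab k' up').
Proof. by rewrite box_setI; exact: box_connected. Qed.

Let slab_closed k up : closed (slab k up).
Proof. exact: box_closed. Qed.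

Let k0 : 'I_3 := ord0.
Let k1 : 'I_3 := @Ordinal 3 1 isT.
Let k2 : 'I_3 := @Ordinal 3 2 isT.
Let c b0 b1 b2 := corner (fun i => nth false [:: b0; b1; b2] i).

Definition shell : set 'rV[R]_3 :=
  slab k0 true `|` slab k1 true `|` slab k2 true `|` slab k1 false `|`
  slab k2 false `|` slab k0 false.

Lemma shellP y : shell y <->
  box l h y /\ exists i, y ord0 i <= a i \/ b i <= y ord0 i.
Proof.
split; first by case=> [[[[[]|]|]|]|] /slabP[? ?]; split=> //;
  [exists k0|exists k1|exists k2|exists k1|exists k2|exists k0]; auto.
case=> By [i]; have : [\/ i = k0, i = k1 | i = k2].
  by case: i => -[|[|[|//]]] H; [apply: Or31|apply: Or32|apply: Or33]; apply: val_inj.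
rewrite /shell => -[] -> [H|H].
- by right; apply/slabP.
- by do 5 left; apply/slabP.
- by do 2 left; right; apply/slabP.
- by do 4 left; right; apply/slabP.
- by left; right; apply/slabP.
- by do 3 left; right; apply/slabP.
Qed.

(** The slabs are glued one at a time, in the order of the definition of
    [shell]. Each one meets the union of the previous ones in a connected set:
    a union of boxes chained by common corners of the outer box. The two
    opposite slabs of direction [1] or [2] come after the upper slab of
    direction [0], which connects them. *)
Lemma shell_primitive (s : 'rV[R]_3 -> 'rV[R]_3 -> R) :
  (forall x, shell x -> exists2 U, nbhs x U & has_primitive (U `&` shell) s) ->
  has_primitive shell s.
Proof.
move=> loc.
have prim k u : slab k u `<=` shell -> has_primitive (slab k u) s.
  move=> sub; apply: box_primitive => x Sx.
  have [U nU P] := loc _ (sub _ Sx); exists U => //.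
  by apply: has_primitive_sub P => y [Uy Sy]; split => //; exact: sub.
have low x A : (A `&` slab k0 false) x -> l k0 <= a k0.
  case=> _ /slabP[/(_ k0)/andP[H _] /=]; exact: le_trans.
rewrite /shell.
apply: has_primitive_glue; [by repeat apply: closedU| exact: slab_closed | | | by apply: prim => y; right].
  rewrite !setIUl slab_opp set0U.
  apply: loc_const_connectedUI => //; first apply: loc_const_connectedUI => //; first apply: loc_const_connectedUI => //.
  - move=> x y /low la0 _; exists (c false true true).
    by split; split; apply: corner_slab; rewrite ?la0.
  - move=> x y H _; have la0 : l k0 <= a k0 by case: H => /low.
    exists (c false false true); split; last by split; apply: corner_slab; rewrite ?la0.
    by right; split; apply: corner_slab; rewrite ?la0.
  - move=> x y _ /low la0.
    exists (c false false false); split; last by split; apply: corner_slab; rewrite ?la0.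
    by right; split; apply: corner_slab; rewrite ?la0.
apply: has_primitive_glue; [by repeat apply: closedU| exact: slab_closed | | | by apply: prim => y; left; right].
  rewrite !setIUl slab_opp setU0.
  apply: loc_const_connectedUI => //; first apply: loc_const_connectedUI => //.
  - move=> x y _ _; exists (c true true false).
    by split; split; apply: corner_slab.
  - move=> x y _ _; exists (c true false false); split; last by split; apply: corner_slab.
    by left; split; apply: corner_slab.
apply: has_primitive_glue; [by repeat apply: closedU| exact: slab_closed | | | by apply: prim => y; do 2 left; right].
  rewrite !setIUl slab_opp setU0.
  apply: loc_const_connectedUI => //.
  by move=> x y _ _; exists (c true false true); split; split; apply: corner_slab.
apply: has_primitive_glue; [by repeat apply: closedU| exact: slab_closed | | | by apply: prim => y; do 3 left; right].
  rewrite !setIUl.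
  apply: loc_const_connectedUI => //.
  by move=> x y _ _; exists (c true true true); split; split; apply: corner_slab.
apply: has_primitive_glue; [by repeat apply: closedU| exact: slab_closed | | | by apply: prim => y; do 4 left; right].
  exact: slabI_connected.
by apply: prim => y; do 5 left.
Qed.

End Shell.

(** * The realization as a quotient of tetrahedra *)

Local Open Scope quotient_scope.

Section Realization.
Variables (R : realType) (n : nat) (T : triangulation n).
Implicit Types (p q : tetrahedra R n).

Definition proj q : realization R T := \pi_(realization R T) q.

Lemma proj_eqP p q :
  proj p = proj q <-> clos_refl_sym_trans _ (@glued_points R n T) p q.
Proof.
have E : (\pi_{eq_quot (@identified R n T)} p == \pi_{eq_quot (@identified R n T)} q) =
  identified T p q by rewrite eqmodE.
split=> [H|H]; first by apply/asboolP; rewrite -[X in is_true X]E; exact/eqP.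
have /eqP : identified T p q by exact/asboolP.
by rewrite -E => /eqP/eqP.
Qed.

Lemma glued_points_sym p q : @glued_points R n T p q -> glued_points T q p.
Proof.
move=> [f [s [g pf pv]]]; exists (s f), (s^-1)%g; split.
- exact: gluing_sym g.
- by rewrite pv.
- by move=> v; rewrite -pv permKV.
Qed.

Definition near_in (e : R) p q :=
  tag p = tag q /\ forall a, `|bary q ord0 a - bary p ord0 a| < e.

(** Together with [proj_nbhs] and [proj_open], this reduces the quotient
    topology to estimates on barycentric coordinates. *)
Lemma tetrahedra_nbhsP q (A : set (tetrahedra R n)) :
  nbhs q A <-> exists2 e : R, 0 < e & forall p, near_in e q p -> A p.
Proof.
case: q => i x; rewrite /nbhs /= sigT_nbhsE; split=> [|[e e0 H]].
  rewrite /= nbhs_simpl /= nbhsE => -[B [[W oW <-] Wx] BA].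
  have /rV_nbhsP[e e0 He] : nbhs (set_val x) W by apply: open_nbhs_nbhs.
  exists e => // -[j y] [/= ji Hy]; subst j.
  by apply: BA; apply: He => a; have := Hy a.
rewrite /= nbhs_simpl /= nbhsE.
exists (set_val @^-1` [set y : 'rV[R]_4 | forall a, `|y ord0 a - set_val x ord0 a| < e]°).
  split.
    by exists [set y : 'rV[R]_4 | forall a, `|y ord0 a - set_val x ord0 a| < e]°;
      [exact: open_interior|].
  by apply/rV_nbhsP; exists e.
by move=> y /= /nbhs_singleton Hy; apply: H.
Qed.

Lemma proj_nbhs q (A : set (realization R T)) : nbhs (proj q) A ->
  exists2 e : R, 0 < e & forall p, near_in e q p -> A (proj p).
Proof. by move=> /(@pi_continuous _ {eq_quot (@identified R n T)} q) /tetrahedra_nbhsP. Qed.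

Lemma proj_open (A : set (realization R T)) :
  (forall q, A (proj q) ->
     exists2 e : R, 0 < e & forall p, near_in e q p -> A (proj p)) -> open A.
Proof.
move=> H; rewrite /open /= /quotient_open openE => q Aq.
exact/tetrahedra_nbhsP/H.
Qed.

End Realization.

(** * Potentials on the flags of a triangulation *)

Local Close Scope quotient_scope.

(** [g i v f] is a number attached to the passage through the face [f] of the
    tetrahedron [i], near its vertex [v]: a 1-cochain on the dual graphs of the
    vertex links. By [g_turn], its sum around each interior vertex of a link is
    zero. *)
Section FlagPotential.
Variables (R : realType) (n : nat) (T : triangulation n).
Variable g : 'I_n -> 'I_4 -> 'I_4 -> R.
Hypothesis g_anti : forall i f j s v, gluing T i f = Some (j, s) -> v != f ->
  g j (s v) (s f) = - g i v f.
Hypothesis g_turn : forall c, edge_turn T c ->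
  \sum_(x <- c) g x.1 (x.2 o0) (x.2 o2) = 0.
Implicit Types x y z : edge_state n.

(** The same edge, traversed in the opposite direction. *)
Let rev_state x : edge_state n := (x.1, (tperm o2 o3 * x.2)%g).

Let rev_stateK : involutive rev_state.
Proof. by case=> i r; rewrite /rev_state /= mulgA tperm2 mul1g. Qed.

(** At a boundary face the walk around an edge turns back, so that it becomes a
    permutation of the states even for boundary edges. *)
Let walk x := if next_state T x is Some y then y else rev_state x.
Let step x := if next_state T x is Some _ then g x.1 (x.2 o0) (x.2 o2) else 0.

Let next_rev x y : next_state T x = Some y ->
  next_state T (rev_state y) = Some (rev_state x).
Proof.
case: x => i r; rewrite /next_state /=.
case E: (gluing T i (r o2)) => [[j s]|//] [<-] /=.
rewrite !permM tpermL tpermR (gluing_sym E); congr (Some (_, _)).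
by rewrite /= !mulgA tperm2 mul1g mulgK.
Qed.

Let walk_rev x : walk (rev_state (walk x)) = rev_state x.
Proof.
rewrite {2}/walk; case E: (next_state T x) => [y|].
  by rewrite /walk (next_rev E).
by rewrite rev_stateK /walk E.
Qed.

Let walk_inj : injective walk.
Proof.
by move=> x y E; have := walk_rev x; rewrite E walk_rev => /(inv_inj rev_stateK).
Qed.

Lemma o0_neq2 : o0 != o2. Proof. by rewrite -val_eqE /= !inordK. Qed.
Lemma o0_neq3 : o0 != o3. Proof. by rewrite -val_eqE /= !inordK. Qed.
Lemma o2_neq3 : o2 != o3. Proof. by rewrite -val_eqE /= !inordK. Qed.

Lemma ord4_cases (a : 'I_4) : [\/ a = o0, a = o1, a = o2 | a = o3].
Proof.
by case: a => -[|[|[|[|//]]]] H; [apply: Or41|apply: Or42|apply: Or43|apply: Or44];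
  apply: val_inj; rewrite /= inordK.
Qed.

Let step_rev x : step (rev_state (walk x)) = - step x.
Proof.
rewrite /walk /step; case E: (next_state T x) => [y|]; last first.
  by rewrite rev_stateK E oppr0.
rewrite (next_rev E); move: E; case: x => i r; rewrite /next_state /=.
case E: (gluing T i (r o2)) => [[j s]|//] [<-] /=.
rewrite !permM tpermL tpermR (tpermD (z := o0)) 1?eq_sym ?o0_neq2 ?o0_neq3 //.
rewrite (tpermD (z := o0)) 1?eq_sym ?o0_neq2 ?o0_neq3 //.
by apply: (g_anti E); rewrite (inj_eq perm_inj) o0_neq2.
Qed.

(** An orbit that never turns back is a complete turn around an edge, where the
    sum vanishes by hypothesis. Otherwise the orbit is invariant under
    reversal, and the steps of an orbit and of its reverse are opposite. *)
Let sum_orbit x : \sum_(y <- fingraph.orbit walk x) step y = 0.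
Proof.
have [|noend] := boolP [exists z in fingraph.orbit walk x, next_state T z == None]; last first.
  have total y : y \in fingraph.orbit walk x -> next_state T y == Some (walk y).
    move=> yO; rewrite /walk; case E: next_state => //.
    by case/exists_inP: noend; exists y => //; rewrite E.
  rewrite -[RHS](g_turn (c := fingraph.orbit walk x)).
    rewrite big_seq [RHS]big_seq; apply: eq_bigr => y /total /eqP E.
    by rewrite /step E.
  rewrite /edge_turn /ucycleb orbit_uniq andbT.
  have /(sub_in_cycle (P := mem (fingraph.orbit walk x))) := cycle_orbit walk_inj x; apply.
    by move=> y z yO _ /= /eqP <-; exact: total.
  exact/allP.
case/exists_inP=> z zO /eqP zN.
have conn w : (w \in fingraph.orbit walk x) = fconnect walk z w.
  rewrite -fconnect_orbit; rewrite -fconnect_orbit in zO.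
  exact: same_connect (fconnect_sym walk_inj) _ _ zO _.
have revO w : fconnect walk z w -> fconnect walk z (rev_state w).
  move=> zw; rewrite -(iter_findex zw); elim: (findex _ _ _) => [|k IH] /=.
    by apply: (@connect_trans _ _ (walk z)) (fconnect1 _ _) _; rewrite /walk zN.
  apply: connect_trans IH _; rewrite (fconnect_sym walk_inj) -[X in fconnect _ _ X]walk_rev /=.
  exact: fconnect1.
have revE w : fconnect walk z (rev_state (walk w)) = fconnect walk z w.
  have H u : fconnect walk z u -> fconnect walk z (walk u).
    by move=> zu; apply: connect_trans zu (fconnect1 _ _).
  apply/idP/idP => [|/H/revO//].
  by move/H; rewrite walk_rev => /revO; rewrite rev_stateK.
rewrite big_uniq ?orbit_uniq //=.
rewrite (eq_bigl (fconnect walk z)) //.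
set S := (LHS); suff : S = - S by lra.
rewrite {1}/S (reindex_inj (h := fun w => rev_state (walk w))) /=; last first.
  by apply: inj_comp => //; exact: inv_inj rev_stateK.
rewrite /S -sumrN; apply: eq_big => w; first exact: revE.
by rewrite step_rev.
Qed.

(** With [N] the length of the orbit, the average of [k * step] over [k < N]: a
    primitive of [step] along the orbit, obtained without choosing a base
    point, since the steps sum to zero. *)
Let avg x : R :=
  (\sum_(k < fingraph.order walk x) k%:R * step (iter k walk x)) / (fingraph.order walk x)%:R.

Let avg_walk x : avg (walk x) - avg x = step x.
Proof.
have -> : avg (walk x) = (\sum_(k < fingraph.order walk x) k%:R * step (iter k.+1 walk x))
   / (fingraph.order walk x)%:R.
  rewrite /avg (_ : fingraph.order walk (walk x) = fingraph.order walk x).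
    by congr (_ / _); apply: eq_bigr => k _; rewrite -iterSr.
  apply: eq_card => y; rewrite !inE; apply: same_connect.
    exact: fconnect_sym.
  by rewrite (fconnect_sym walk_inj) fconnect1.
set N := fingraph.order walk x; pose w k := step (iter k walk x).
have w0 : \sum_(k < N) w k = 0.
  have E M y : traject walk y M = [seq iter k walk y | k <- iota 0 M].
    elim: M y => //= M IH y; rewrite IH; congr (_ :: _).
    by rewrite -[1%N]/(1 + 0)%N iotaDl -map_comp; apply: eq_map => k /=; rewrite -iterSr.
  have := sum_orbit x; rewrite /fingraph.orbit -/N E big_map; apply: etrans.
  by rewrite -(big_mkord xpredT w) /index_iota subn0.
have wN : w N = w 0%N by rewrite /w /N iter_order.
have N0 : (0 < N)%N by exact: fingraph.order_gt0.
have S1 : \sum_(k < N) w k.+1 = 0.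
  have : \sum_(k < N.+1) w k = \sum_(k < N.+1) w k by [].
  rewrite {1}big_ord_recl big_ord_recr /= w0 wN.
  under eq_bigr do rewrite /bump /= add1n.
  lra.
have S2 : \sum_(k < N) (k.+1)%:R * w k.+1 = \sum_(k < N) k%:R * w k + N%:R * w 0%N.
  have : \sum_(k < N.+1) k%:R * w k = \sum_(k < N.+1) k%:R * w k by [].
  rewrite {1}big_ord_recl big_ord_recr /= wN.
  under eq_bigr do rewrite /bump /= add1n.
  lra.
rewrite -mulrBl.
have -> : \sum_(k < N) k%:R * step (iter k.+1 walk x) =
   \sum_(k < N) (k.+1)%:R * w k.+1 - \sum_(k < N) w k.+1.
  by rewrite -sumrB; apply: eq_bigr => k _; rewrite -natr1 mulrDl mul1r addrK.
rewrite S1 S2 subr0 addrAC /w subrr add0r /= mulrC mulKf //.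
by rewrite pnatr_eq0 -lt0n.
Qed.

(** Averaging over both directions makes the potential depend on the edge only.
    *)
Let psi x : R := (avg x + avg (rev_state x)) / 2.

Let psi_rev x : psi (rev_state x) = psi x.
Proof. by rewrite /psi rev_stateK addrC. Qed.

Let psi_next x y : next_state T x = Some y -> psi y - psi x = g x.1 (x.2 o0) (x.2 o2).
Proof.
move=> E; have Ey : walk x = y by rewrite /walk E.
have := avg_walk x; have := avg_walk (rev_state y); have := walk_rev x; have := step_rev x.
rewrite Ey => -> ->; rewrite /psi [step x]/step E; lra.
Qed.

Let state_for (v : 'I_4) (Z : {set 'I_4}) (r : 'S_4) :=
  [&& r o0 == v, r o2 \in Z & r o3 \in Z].

(** [Z] is the set of the barycentric coordinates that vanish at a point of the
    tetrahedron [i] close to its vertex [v]. For a point inside a face, the two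
    sides get opposite halves of [g]; for a point of an edge, the set [Z] and
    the vertex [v] determine the state up to reversal. *)
Definition flag_potential (i : 'I_n) (v : 'I_4) (Z : {set 'I_4}) : R :=
  match #|Z| with
  | 1 => - g i v (odflt ord0 [pick f in Z]) / 2
  | 2 => if [pick r | state_for v Z r] is Some r then psi (i, r) else 0
  | _ => 0
  end.

Let flag_potential2 i v (Z : {set 'I_4}) r : #|Z| = 2 -> state_for v Z r ->
  flag_potential i v Z = psi (i, r).
Proof.
move=> Z2 Hr; rewrite /flag_potential Z2 /=; case: pickP => [r' Hr'|/(_ r)]; last by rewrite Hr.
case/and3P: Hr => /eqP r0 r2 r3; case/and3P: Hr' => /eqP r'0 r'2 r'3.
have ZE : Z = [set r o2; r o3]%SET.
  apply/esym/eqP; rewrite eqEcard Z2 cards2 (inj_eq perm_inj) o2_neq3 leqnn andbT.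
  by apply/fintype.subsetP => a /set2P[] ->.
have r23 : r' o2 != r' o3 by rewrite (inj_eq perm_inj) o2_neq3.
have r1 (u w : 'S_4) : u o0 = w o0 -> u o2 = w o2 -> u o3 = w o3 -> u = w.
  move=> E0 E2 E3; apply/permP => a.
  case: (ord4_cases a) => -> //.
  have [b Eb] : exists b, w b = u o1 by exists ((w^-1)%g (u o1)); rewrite permKV.
  have o1P c : o1 = c -> c \notin [:: o0; o2; o3].
    by move=> <-; rewrite !inE -!val_eqE /= !inordK.
  case: (ord4_cases b) Eb => -> Eb //; move: Eb;
    by rewrite -?E0 -?E2 -?E3 => /perm_inj/esym/o1P; rewrite !inE eqxx ?orbT.
move: r'2 r'3; rewrite ZE => /set2P[] E2 /set2P[] E3.
- by move: r23; rewrite E2 E3 eqxx.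
- by congr (psi (_, _)); apply: r1 => //; rewrite r0.
- rewrite -psi_rev; congr (psi (_, _)); apply: r1; rewrite /= permM ?tpermL ?tpermR //.
  by rewrite (tpermD (z := o0)) 1?eq_sym ?o0_neq2 ?o0_neq3 // r0.
- by move: r23; rewrite E2 E3 eqxx.
Qed.

Lemma exists_fourth (v a b : 'I_4) : exists w, w \notin [:: v; a; b].
Proof.
apply/existsP; apply: contraT; rewrite negb_exists => /forallP H.
have : (#|'I_4| <= #|[:: v; a; b]|)%N.
  by apply/subset_leq_card/fintype.subsetP => x _; have := H x; rewrite negbK.
by rewrite card_ord => /leq_trans/(_ (card_size _)).
Qed.

(** A state for the edge with lower end [v] whose tetrahedron has [a] and [b]
    as its vertices outside the edge. *)
Lemma perm_with (v a b : 'I_4) : v != a -> v != b -> a != b ->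
  exists r : 'S_4, [/\ r o0 = v, r o2 = a & r o3 = b].
Proof.
move=> va vb ab.
have [w Hw] := exists_fourth v a b.
pose t := [:: v; w; a; b].
have tu : uniq t.
  move: Hw; rewrite /t /= !inE !negb_or va vb ab !andbT => /and3P[H1 H2 H3].
  by rewrite eq_sym H1 H2 H3.
have tinj : injective (fun i : 'I_4 => nth v t i).
  move=> i j /eqP; rewrite nth_uniq //; first by move/eqP/val_inj.
exists (perm tinj); split; rewrite permE /= inordK //.
Qed.

Lemma flag_potentialP i f j s v (Z : {set 'I_4}) : gluing T i f = Some (j, s) ->
  v \notin Z -> f \in Z -> (#|Z| <= 2)%N ->
  flag_potential j (s v) (s @: Z)%SET - flag_potential i v Z = g i v f.
Proof.
move=> E vZ fZ Z2.
have vf : v != f by apply: contraNneq vZ => ->.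
have cs : #|(s @: Z)%SET| = #|Z| by apply: card_imset; exact: perm_inj.
have : (0 < #|Z|)%N by apply/card_gt0P; exists f.
case EZ: #|Z| Z2 => [|[|[|//]]] // _ _.
  have /eqP/cards1P[f' Ef] := EZ.
  have ff : f' = f by move: fZ; rewrite Ef => /set1P.
  rewrite /flag_potential cs EZ Ef ff imset_set1.
  case: pickP => [a /set1P ->|/(_ (s f))]; last by rewrite inE eqxx.
  case: pickP => [b /set1P ->|/(_ f)]; last by rewrite inE eqxx.
  by rewrite /= (g_anti E vf); lra.
have [f' f'Z f'f] : exists2 f', f' \in Z & f' != f.
  have : (0 < #|Z :\ f|%SET)%N by move: EZ; rewrite (cardsD1 f) fZ add1n => -[->].
  by case/card_gt0P=> f' /setD1P[]; exists f'.
have vf' : v != f' by apply: contraNneq vZ => ->.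
have [r [r0 r2 r3]] : exists r : 'S_4, [/\ r o0 = v, r o2 = f & r o3 = f'].
  by apply: perm_with => //; rewrite eq_sym.
rewrite (@flag_potential2 i v Z r) //; last by rewrite /state_for r0 r2 r3 eqxx fZ.
have N : next_state T (i, r) = Some (j, (tperm o2 o3 * r * s)%g).
  by rewrite /next_state /= r2 E.
rewrite (@flag_potential2 j (s v) _ (tperm o2 o3 * r * s)%g) ?cs //.
  by rewrite (psi_next N) /= r0 r2.
rewrite /state_for !permM tpermL tpermR r2 r3 (tpermD (z := o0)) 1?eq_sym ?o0_neq2 ?o0_neq3 //.
by rewrite r0 eqxx !imset_f.
Qed.

End FlagPotential.

(** * The local system on the punctured vertex stars *)

Section LocalSystem.
Variables (R : realType) (n : nat) (T : triangulation n).
Variable g : 'I_n -> 'I_4 -> 'I_4 -> R.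
Hypothesis g_anti : forall i f j s v, gluing T i f = Some (j, s) -> v != f ->
  g j (s v) (s f) = - g i v f.
Hypothesis g_turn : forall c, edge_turn T c ->
  \sum_(x <- c) g x.1 (x.2 o0) (x.2 o2) = 0.
Implicit Types p q : tetrahedra R n.

Notation co q a := (bary q ord0 a).

Lemma bary_ge0 q a : 0 <= co q a.
Proof. by case: q => i [x Hx]; have /set_mem[] := Hx; rewrite /bary /= set_valE /=. Qed.

Lemma bary_sum q : \sum_a co q a = 1.
Proof. by case: q => i [x Hx]; have /set_mem[] := Hx; rewrite /bary /= set_valE /=. Qed.

Lemma exists_point i (x : 'rV[R]_4) : simplex3 x ->
  exists q : tetrahedra R n, tag q = i /\ bary q = x.
Proof. by move=> Hx; exists (existT _ i (SigSub (mem_set Hx))). Qed.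

Lemma bary_inj p q : tag p = tag q -> bary p = bary q -> p = q.
Proof.
case: p q => i x [j y] /= ij; subst j; rewrite /bary /= => H.
by congr existT; exact: val_inj.
Qed.

Definition zeros q : {set 'I_4} := [set a | co q a == 0]%SET.

Definition punctured v q := 1/2 < co q v /\ co q v < 1.

(** The sum has a single term when [q] is close to a vertex. *)
Definition phi q : R :=
  \sum_(v | 1/2 < co q v) flag_potential T g (tag q) v (zeros q).

Lemma apex_uniq q v w : 1/2 < co q v -> 1/2 < co q w -> v = w.
Proof.
move=> Hv Hw; apply/eqP; apply: contraT => vw.
have := bary_sum q; rewrite (bigD1 v) //= (bigD1 w) 1?eq_sym //=.
have : 0 <= \sum_(i < 4 | (i != v) && (i != w)) co q i by apply: sumr_ge0 => *; exact: bary_ge0.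
lra.
Qed.

Lemma phiE q v : 1/2 < co q v -> phi q = flag_potential T g (tag q) v (zeros q).
Proof.
move=> Hv; rewrite /phi (bigD1 v) //= big1 ?addr0 // => w /andP[Hw].
by rewrite (apex_uniq Hw Hv) eqxx.
Qed.

Lemma card_zeros q v : punctured v q -> (v \notin zeros q) /\ (#|zeros q| <= 2)%N.
Proof.
move=> [v2 v1]; have vZ : v \notin zeros q by rewrite inE gt_eqF //; lra.
split => //; rewrite leqNgt; apply/negP => Z3.
have EZ : zeros q = ~: [set v]%SET.
  apply/eqP; rewrite eqEcard cardsC1 card_ord Z3 andbT.
  by apply/fintype.subsetP => a aZ; rewrite !inE; apply: contraNneq vZ => <-.
move: (bary_sum q); rewrite (bigD1 v) //= big1 ?addr0; first lra.
by move=> a av; apply/eqP; have : a \in zeros q; [rewrite EZ !inE|rewrite inE].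
Qed.

Lemma glued_punctured p q f s v : punctured v p ->
  gluing T (tag p) f = Some (tag q, s) -> co p f = 0 ->
  (forall a, co q (s a) = co p a) ->
  [/\ v != f, punctured (s v) q & phi q - phi p = g (tag p) v f].
Proof.
move=> Hv E pf pq; have [v2 v1] := Hv; have [vZ Z2] := card_zeros Hv.
have vf : v != f by apply: contraTneq v2 => ->; rewrite pf; lra.
split => //; first by rewrite /punctured pq.
rewrite (phiE v2) (phiE (q := q) (v := s v)) ?pq //.
have -> : zeros q = (s @: zeros p)%SET.
  apply/setP => a; rewrite -[a](permKV s) mem_imset; last exact: perm_inj.
  by rewrite !inE pq.
by apply: flag_potentialP => //; rewrite inE pf.
Qed.

(** [e] separates each coordinate of [q] from the other coordinates, from [0]
    and from [1/2]. Points at distance [e] then have no new zeros and the same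
    closest vertex, and two points of the same class cannot be close to a
    common point. *)
Definition good (e : R) q := 0 < e /\
  forall a y, y \in [:: 0, 1/2 & [seq co q b | b <- enum 'I_4]] ->
     co q a != y -> 2 * e <= `|co q a - y|.

Lemma exists_good q : exists e, good e q.
Proof.
pose ys := [:: 0, 1/2 & [seq co q b | b <- enum 'I_4]].
pose l := [seq `|u - y| | u <- ys, y <- ys].
have [e e0 He] : exists2 e : R, 0 < e & forall x, x \in l -> 0 < x -> 2 * e <= x.
  elim: l => [|x l [e e0 IH]]; first by exists 1.
  have [x0|x0] := ltP 0 x; last first.
    by exists e => // y; rewrite inE => /orP[/eqP ->|/IH//]; rewrite ltNge x0.
  exists (Num.min e (x / 2)); first by rewrite lt_min e0 divr_gt0.
  have H1 : Num.min e (x / 2) <= e by rewrite ge_min lexx.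
  have H2 : Num.min e (x / 2) <= x / 2 by rewrite ge_min lexx orbT.
  by move=> y; rewrite inE => /orP[/eqP ->|/IH H /H]; lra.
exists e; split => // a y yl ne; apply: He; last by rewrite normr_gt0 subr_eq0.
apply/allpairsP; exists (co q a, y); split => //=.
by rewrite !inE map_f ?orbT // mem_enum.
Qed.

Lemma good_le e e' q : good e q -> 0 < e' -> e' <= e -> good e' q.
Proof. by move=> [_ H] e0 le; split => // a y /H {}H /H; lra. Qed.

Lemma good_glued e p q : good e p -> glued_points T p q -> good e q.
Proof.
move=> [e0 H] [f [s [E pf pq]]]; split => // a y.
rewrite -[a](permKV s) pq => yin; apply: H.
move: yin; rewrite !inE => /or3P[->|->|/mapP[b _ ->]]; rewrite ?orbT //.
by rewrite -[b](permKV s) pq map_f ?orbT // mem_enum.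
Qed.

Lemma near_zero e p q a : good e p -> near_in e p q -> co q a = 0 -> co p a = 0.
Proof.
move=> [e0 H] [_ /(_ a) Ha] qa; apply/eqP; apply: contraT => pa.
have := H a 0; rewrite inE eqxx => /(_ isT pa).
by move: Ha; rewrite qa sub0r normrN subr0; lra.
Qed.

Lemma near_punctured e p q v : good e p -> near_in e p q -> punctured v p -> punctured v q.
Proof.
move=> ge npq [v2 v1]; split.
  have [e0 H] := ge; have [_ /(_ v) Hv] := npq.
  have := H v (1/2); rewrite !inE eqxx orbT => /(_ isT).
  rewrite gt_eqF // => /(_ isT); rewrite ger0_norm; last by lra.
  by move: Hv; rewrite ltr_norml => /andP[]; lra.
rewrite ltNge; apply/negP => qv.
suff : co p v = 1 by lra.
rewrite -(bary_sum p) (bigD1 v) //= big1 ?addr0 // => a av.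
apply: near_zero ge npq _; apply/eqP; rewrite eq_le bary_ge0 andbT.
have := bary_sum q; rewrite (bigD1 v) //= (bigD1 a) //=.
have : 0 <= \sum_(i < 4 | (i != v) && (i != a)) co q i by apply: sumr_ge0 => *; exact: bary_ge0.
lra.
Qed.

(** A point close to [p] lies in a face only if [p] does, so that gluings of
    nearby points lift to [p]; [phi] changes by the same amount along both. *)
Lemma lift_glued e p q q' v : good e p -> near_in e p q -> punctured v p ->
  glued_points T q q' ->
  exists p' v', [/\ glued_points T p p', near_in e p' q', punctured v' p' &
    phi p' - phi p = phi q' - phi q].
Proof.
move=> ge npq pv [f [s [E qf qq']]].
have pf : co p f = 0 by apply: near_zero ge npq qf.
have [tE Ha] := npq.
have [|p' [tp' bp']] := @exists_point (tag q') (\row_a co p ((s^-1)%g a)).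
  split=> [a|]; first by rewrite mxE bary_ge0.
  rewrite (reindex_inj (@perm_inj _ s)) /= -[RHS](bary_sum p).
  by apply: eq_bigr => a _; rewrite mxE permK.
have pp' a : co p' (s a) = co p a by rewrite bp' mxE permK.
have E' : gluing T (tag p) f = Some (tag p', s) by rewrite tE tp'.
have [vf pv' d] := glued_punctured pv E' pf pp'.
have [_ _ d'] := glued_punctured (near_punctured ge npq pv) E qf qq'.
exists p', (s v); split => //; first by exists f, s.
  by split => // a; rewrite -[a](permKV s) pp' qq'.
by rewrite d d' tE.
Qed.

Lemma lift_class e p q q' v : good e p -> near_in e p q -> punctured v p ->
  proj T q = proj T q' ->
  exists p' v', [/\ proj T p' = proj T p, good e p', near_in e p' q', punctured v' p' &
    phi p' - phi p = phi q' - phi q].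
Proof.
move=> ge npq pv /proj_eqP/clos_rst_rst1n_iff H.
elim: H p v ge npq pv => {q q'} [q|q q1 q' qq1 _ IH] p v ge npq pv.
  by exists p, v; split => //; lra.
have {}qq1 : glued_points T q q1 by case: qq1 => // /glued_points_sym.
have [p1 [v1 [pp1 np1 pv1 d1]]] := lift_glued ge npq pv qq1.
have [p' [v' [pp' gp' np' pv' d']]] := IH p1 v1 (good_glued ge pp1) np1 pv1.
exists p', v'; split => //; last by lra.
by rewrite pp'; apply/proj_eqP/rst_sym/rst_step.
Qed.

Lemma class_perm p q : proj T p = proj T q ->
  exists s : 'S_4, forall a, co q (s a) = co p a.
Proof.
move=> /proj_eqP; elim=> {p q} [p q [f [s [_ _ H]]]|p|p q _ [s H]|p q r _ [s H] _ [t H']].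
- by exists s.
- by exists 1%g => a; rewrite perm1.
- by exists (s^-1)%g => a; rewrite -H permKV.
- by exists (s * t)%g => a; rewrite permM H' H.
Qed.

Lemma class_good e p q : proj T p = proj T q -> good e p -> good e q.
Proof.
move=> /proj_eqP/clos_rst_rst1n_iff; elim=> {p q} // p q r pq _ IH gp; apply: IH.
by apply: good_glued gp _; case: pq => // /glued_points_sym.
Qed.

Lemma class_punctured p q v : proj T p = proj T q -> punctured v p ->
  exists w, punctured w q.
Proof.
have [e ge] := exists_good p; move=> pq pv.
have npp : near_in e p p by split => // a; rewrite subrr normr0; case: ge.
have [p' [v' [_ ge' np' pv' _]]] := lift_class ge npp pv pq.
by exists v'; exact: near_punctured ge' np' pv'.
Qed.

(** Barycentric coordinates are permuted by the gluings, so that the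
    coordinates of [p] and [p'] differ by at least [2 * e] when they are
    distinct. *)
Lemma near_class_uniq e p p' q : good e p -> proj T p = proj T p' ->
  near_in e p q -> near_in e p' q -> p = p'.
Proof.
move=> [e0 ge] pp' [t1 H1] [t2 H2]; apply: bary_inj; first by rewrite t1 t2.
apply/rowP => a; apply/eqP; apply: contraT => ne.
have [s Hs] := class_perm pp'.
have E : co p' a = co p ((s^-1)%g a) by rewrite -Hs permKV.
have := ge a (co p' a); rewrite !inE E map_f ?mem_enum ?orbT // -E => /(_ isT ne).
have := H1 a; have := H2 a; rewrite !ltr_norml => /andP[? ?] /andP[? ?].
by case: (lerP 0 (co p a - co p' a)) => ?; [rewrite ger0_norm//|rewrite ltr0_norm//]; lra.
Qed.

Lemma near_in_slack e p q : near_in e p q -> exists2 e', e' < e & near_in e' p q.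
Proof.
move=> [t H].
have [a _ Ha] := @arg_maxP _ _ _ ord0 xpredT (fun a => `|co q a - co p a|) isT.
exists ((`|co q a - co p a| + e) / 2); first by have := H a; lra.
by split => // b; have /= := Ha b isT; have := H a; lra.
Qed.

Lemma near_in_trans e e' p q r : near_in e p q -> near_in e' q r -> near_in (e + e') p r.
Proof.
move=> [t H] [t' H']; split=> [|a]; first by rewrite t.
rewrite -(subrKA (co q a)); apply: le_lt_trans (ler_normD _ _) _.
by have := H a; have := H' a; lra.
Qed.

Lemma near_in_refl e p : 0 < e -> near_in e p p.
Proof. by move=> e0; split => // a; rewrite subrr normr0. Qed.

Definition pstar : set (realization R T) :=
  [set P | exists q v, proj T q = P /\ punctured v q].

Definition class_ball (e : R) (P : realization R T) : set (realization R T) :=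
  [set Q | exists p q, [/\ proj T p = P, proj T q = Q & near_in e p q]].

Lemma class_ball_nbhs e p v : good e p -> punctured v p ->
  nbhs (proj T p) (class_ball e (proj T p)).
Proof.
move=> ge pv; apply: open_nbhs_nbhs; split; last first.
  by exists p, p; split => //; apply: near_in_refl; case: ge.
apply: proj_open => q [p1 [q1 [pp1 qq1 n1]]].
have [w pw] := class_punctured (esym pp1) pv.
have [p2 [w2 [pp2 _ n2 _ _]]] := lift_class (class_good (esym pp1) ge) n1 pw qq1.
have [e' e'e n2'] := near_in_slack n2.
exists (e - e') => [|r nr]; first by rewrite subr_gt0.
exists p2, r; split => //; first by rewrite pp2.
by have := near_in_trans n2' nr; rewrite addrC subrK.
Qed.

Definition delta (P : realization R T) : R :=
  xget 1 [set e | forall q, proj T q = P -> good e q].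

Lemma deltaP q : good (delta (proj T q)) q.
Proof.
rewrite /delta; case: xgetP => [e _|] /=; first by apply.
have [e ge] := exists_good q.
by move=> /(_ e) H; case: H => q' E; exact: class_good ge.
Qed.

(** Around the class of [p], the function [phi p - phi q] of [q] is what must
    be added to [phi] to make it locally constant. It only depends on the class
    of [q], because [phi] changes in the same way along a chain of gluings and
    along the chain close to it that starts at [p]. *)
Definition germ (P Q : realization R T) : R :=
  xget 0 [set c | exists p q, [/\ proj T p = P, proj T q = Q,
                   near_in (delta P) p q & c = phi p - phi q]].

Lemma germE p q v : punctured v p -> near_in (delta (proj T p)) p q ->
  germ (proj T p) (proj T q) = phi p - phi q.
Proof.
move=> pv npq; rewrite /germ; case: xgetP => [c _|/(_ (phi p - phi q))]; last first.
  by case; exists p, q.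
move=> [p1 [q1 [pp1 qq1 n1 ->]]].
have [w pw] := class_punctured (esym pp1) pv.
have g1 : good (delta (proj T p)) p1 by rewrite -pp1; exact: deltaP.
have [p2 [v2 [pp2 g2 n2 pv2 d]]] := lift_class g1 n1 pw qq1.
have E : p2 = p by apply: near_class_uniq g2 _ n2 npq; rewrite pp2.
by rewrite E in d; lra.
Qed.

(** The germ at [P] itself is a primitive on a ball around [P]: at a nearby
    class, the germs at both classes add the same function to [phi], up to a
    constant. *)
Lemma germ_primitive P : pstar P ->
  exists2 U, nbhs P U & has_primitive U germ.
Proof.
move=> [p [v [<- pv]]]; exists (class_ball (delta (proj T p)) (proj T p)).
  by apply: class_ball_nbhs pv; exact: deltaP.
exists (germ (proj T p)) => _ [p1 [q [pp1 <- npq]]].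
have [v1 pv1] := class_punctured (esym pp1) pv.
rewrite -pp1 in npq *; clear p v pv pp1.
have gp := deltaP p1; set D := delta _ in npq gp.
have [e eD npq'] := near_in_slack npq.
have e0 : 0 < e by have [_ /(_ ord0)] := npq'; apply: le_lt_trans; exact: normr_ge0.
have ge : good e p1 by apply: good_le gp _ _ => //; exact: ltW.
have qw : punctured v1 q by apply: near_punctured ge npq' pv1.
pose d := Num.min (delta (proj T q)) (D - e).
have dD : d <= D - e by rewrite /d ge_min lexx orbT.
have dq : d <= delta (proj T q) by rewrite /d ge_min lexx.
have d0 : 0 < d by rewrite lt_min subr_gt0 eD andbT; case: (deltaP q).
have := class_ball_nbhs (good_le (deltaP q) d0 dq) qw.
apply: filterS => Q' [q1 [q' [qq1 <- n1]]] _.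
have [w1 pw1] := class_punctured (esym qq1) qw.
have [p2 [v2 [pp2 g2 n2 pv2 _]]] := lift_class ge npq' pv1 (esym qq1).
have le e1 e2 x y : e1 <= e2 -> near_in e1 x y -> near_in e2 x y.
  by move=> l [t H]; split => // a; apply: lt_le_trans (H a) l.
rewrite -qq1 in dq *; rewrite -pp2.
have DE : D = delta (proj T p2) by rewrite /D pp2.
have n2q' : near_in (delta (proj T p2)) p2 q'.
  by apply: le (near_in_trans n2 n1); rewrite -DE; lra.
have n2q1 : near_in (delta (proj T p2)) p2 q1 by apply: le n2; rewrite -DE; lra.
have nq1q' : near_in (delta (proj T q1)) q1 q' by apply: le n1.
have nq1q1 : near_in (delta (proj T q1)) q1 q1.
  by apply: near_in_refl; case: (deltaP q1).
rewrite (germE pv2 n2q') (germE pv2 n2q1) (germE pw1 nq1q') (germE pw1 nq1q1).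
lra.
Qed.

Lemma primitive_loc_const (S : set (realization R T)) (F : realization R T -> R) q :
  S (proj T q) -> S `<=` pstar ->
  const_near S (proj T q) (fun Q => F Q - germ (proj T q) Q) ->
  exists2 e : R, 0 < e & forall q', near_in e q q' -> S (proj T q') ->
    phi q' + F (proj T q') = phi q + F (proj T q).
Proof.
move=> Sq Sstar /proj_nbhs[e e0 He].
have [q1 [v1 [E1 pv1]]] := Sstar _ Sq.
have [v pv] := class_punctured E1 pv1.
have [D0 _] := deltaP q.
exists (Num.min e (delta (proj T q))); first by rewrite lt_min e0 D0.
move=> q' [t H] Sq'.
have n1 : near_in e q q'.
  by split => // a; apply: lt_le_trans (H a) _; rewrite ge_min lexx.
have n2 : near_in (delta (proj T q)) q q'.
  by split => // a; apply: lt_le_trans (H a) _; rewrite ge_min lexx orbT.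
have := He q' n1 Sq'.
rewrite (germE pv n2) (germE pv (near_in_refl _ D0)); lra.
Qed.

End LocalSystem.

(** * The potential on a vertex link *)

Lemma within_continuousP (X Y : topologicalType) (A : set X) (f : X -> Y) x B :
  {within A, continuous f} -> A x -> nbhs (f x) B -> \forall y \near x, A y -> B (f y).
Proof.
move=> cf Ax /(cf x); rewrite nbhs_simpl /= /nbhs /=.
by rewrite -nbhs_subspace_in.
Qed.

Lemma finite_radius (R : realType) (I : finType) (Q : I -> R -> Prop) :
  (forall i e e', 0 < e' -> e' <= e -> Q i e -> Q i e') ->
  (forall i, exists2 e, 0 < e & Q i e) -> exists2 e, 0 < e & forall i, Q i e.
Proof.
move=> mono H.
suff [e e0 He] : exists2 e, 0 < e & forall i, i \in enum I -> Q i e.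
  by exists e => // i; apply: He; rewrite mem_enum.
elim: (enum I) => [|i l [e e0 IH]]; first by exists 1.
have [e' e'0 He'] := H i.
have m0 : 0 < Num.min e e' by rewrite lt_min e0.
exists (Num.min e e') => // j; rewrite inE => /predU1P[->|/IH Hj].
  by apply: mono He' => //; rewrite ge_min lexx orbT.
by apply: mono Hj => //; rewrite ge_min lexx.
Qed.

Section VertexPotential.
Variables (R : realType) (n : nat) (T : triangulation n).
Variable g : 'I_n -> 'I_4 -> 'I_4 -> R.
Hypothesis g_anti : forall i f j s v, gluing T i f = Some (j, s) -> v != f ->
  g j (s v) (s f) = - g i v f.
Hypothesis g_turn : forall c, edge_turn T c ->
  \sum_(x <- c) g x.1 (x.2 o0) (x.2 o2) = 0.
Implicit Types (p q : tetrahedra R n) (x : corner n).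

Notation co q a := (bary q ord0 a).

Definition edge_point (v w : 'I_4) (e : R) : 'rV[R]_4 :=
  (1 - e) *: delta_mx ord0 v + e *: delta_mx ord0 w.

Lemma edge_pointE v w e a :
  edge_point v w e ord0 a = (1 - e) * (a == v)%:R + e * (a == w)%:R.
Proof. by rewrite !mxE !eqxx. Qed.

Lemma edge_point_simplex v w e : 0 <= e <= 1 -> simplex3 (edge_point v w e).
Proof.
case/andP=> e0 e1; split=> [a|].
  by rewrite edge_pointE addr_ge0 // mulr_ge0 // subr_ge0.
under eq_bigr do rewrite edge_pointE.
rewrite big_split /= -!mulr_sumr.
have S u : \sum_(i < 4) (i == u)%:R = 1 :> R.
  by rewrite (bigD1 u) //= eqxx big1 ?addr0 // => i /negbTE ->.
by rewrite !S; lra.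
Qed.

Lemma exists_vertex_point x : exists q : tetrahedra R n,
  tag q = x.1 /\ bary q = edge_point x.2 x.2 0.
Proof. by apply: exists_point; apply: edge_point_simplex; rewrite lexx ler01. Qed.

Definition vertex_point x : tetrahedra R n := projT1 (cid (exists_vertex_point x)).

Lemma vertex_pointP x : tag (vertex_point x) = x.1 /\
  forall a, co (vertex_point x) a = (a == x.2)%:R.
Proof.
rewrite /vertex_point; case: cid => q /= [-> bq]; split => // a.
by rewrite bq edge_pointE subr0 mul1r mul0r addr0.
Qed.

Definition of_bary (i : 'I_n) (b : 'rV[R]_4) : tetrahedra R n :=
  xget (vertex_point (i, ord0)) [set q | tag q = i /\ bary q = b].

Lemma of_baryP i b : simplex3 b -> tag (of_bary i b) = i /\ bary (of_bary i b) = b.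
Proof.
move=> /(@exists_point R n i)[q Hq]; rewrite /of_bary; case: xgetP => [q' _ //|].
by move=> /(_ q).
Qed.

Variable k : corner n.

(** The corners of tetrahedra at the vertex of [k]. *)
Definition around : pred (corner n) := connect (glued_corners T) k.

Lemma around_glued i v f j s : around (i, v) -> v != f ->
  gluing T i f = Some (j, s) -> around (j, s v).
Proof.
move=> H vf E; apply: connect_trans H (connect1 _).
by apply/existsP; exists f; rewrite /= E eqxx andbT eq_sym.
Qed.

Lemma proj_vertex_point x : around x -> proj T (vertex_point x) = proj T (vertex_point k).
Proof.
case/connectP=> l; elim/last_ind: l x => [x _ -> //|l y IH x].
rewrite rcons_path last_rcons => /andP[pl e] ->.
rewrite -(IH (last k l)) //; set z := last k l in e *.
case/existsP: e => f /andP[fz]; case E: gluing => [[j s]|//] /eqP Ey.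
apply/proj_eqP/rst_sym/rst_step; exists f, s.
have [tz bz] := vertex_pointP z; have [ty by_] := vertex_pointP y.
rewrite tz ty E Ey /=; split => //; first by rewrite bz (negbTE fz).
by move=> v; rewrite -Ey by_ bz Ey /= (inj_eq perm_inj).
Qed.

Lemma class_corner p q v : proj T p = proj T q -> around (tag p, v) -> 0 < co p v ->
  exists w, around (tag q, w) /\ co q w = co p v.
Proof.
move=> /proj_eqP/clos_rst_rst1n_iff H; elim: H v => {p q} [p|p q r pq _ IH] v pv v0.
  by exists v.
have {pq} [f [s [E pf pq]]] : glued_points T p q by case: pq => // /glued_points_sym.
have vf : v != f by apply: contraTneq v0 => ->; rewrite pf ltxx.
have [||w [H1 H2]] := IH (s v); first exact: around_glued pv vf E.
  by rewrite pq.
by exists w; split => //; rewrite H2 pq.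
Qed.

Definition star (e : R) : set (realization R T) :=
  [set P | exists q v, [/\ proj T q = P, around (tag q, v) & 1 - e < co q v]].

Lemma star_nbhs e : 0 < e -> e <= 1 -> nbhs (proj T (vertex_point k)) (star e).
Proof.
move=> e0 e1; apply: open_nbhs_nbhs; split; last first.
  have [tk bk] := vertex_pointP k.
  exists (vertex_point k), k.2; split => //; last by rewrite bk eqxx /=; lra.
  by rewrite tk /around -surjective_pairing; exact: connect0.
apply: proj_open => q [p [v [pq pv ev]]].
have [|w [qw Ew]] := class_corner pq pv; first by lra.
exists (co q w - (1 - e)); first by rewrite Ew subr_gt0.
move=> r [t /(_ w)]; rewrite ltr_norml => /andP[H _].
by exists r, w; split => //; [rewrite -t|lra].
Qed.

(** A point whose coordinate at [v] is [1] is the vertex itself. *)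
Lemma star_pstar P : star (1/2) P -> P <> proj T (vertex_point k) -> pstar P.
Proof.
move=> [q [v [<- qv v2]]] ne; exists q, v; split => //; split; first lra.
rewrite ltNge; apply/negP => v1; apply: ne.
rewrite -(proj_vertex_point qv); congr proj.
have [t b] := vertex_pointP (tag q, v); apply: bary_inj => //.
apply/rowP => a; rewrite b /=; have := bary_sum q; rewrite (bigD1 v) //=.
case: eqP => [->|/eqP av] /=.
  have : 0 <= \sum_(i < 4 | i != v) co q i by apply: sumr_ge0 => *; exact: bary_ge0.
  lra.
rewrite (bigD1 a) //=; have := bary_ge0 q a.
have : 0 <= \sum_(i < 4 | (i != v) && (i != a)) co q i by apply: sumr_ge0 => *; exact: bary_ge0.
lra.
Qed.

(** The link of the vertex, realized at height [1 - e]. *)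
Definition link_copy (e : R) : set (realization R T) :=
  [set P | exists q v, [/\ proj T q = P, around (tag q, v) & co q v = 1 - e]].

Lemma link_copy_pstar e : 0 < e -> e < 1/2 -> link_copy e `<=` @pstar R n T.
Proof. by move=> e0 e1 P [q [v [Pq _ qv]]]; exists q, v; split => //; split; rewrite qv; lra. Qed.

Lemma link_copy_star e P : 0 < e -> e < 1/2 -> link_copy e P -> ~ star (e / 2) P.
Proof.
move=> e0 e1 [q [v [<- qv Ev]]] [p [w [pq pw lt]]].
have [|u [qu Eu]] := class_corner pq pw; first by lra.
have := @apex_uniq _ _ q u v; rewrite Eu Ev => H.
by have uv := H _ _; rewrite uv in Eu; lra.
Qed.

Lemma link_copy_nbhs (A : set (realization R T)) : nbhs (proj T (vertex_point k)) A ->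
  exists2 e, 0 < e < 1/2 & link_copy e `<=` A.
Proof.
move=> nA.
pose Q x (e : R) := around x -> forall q, near_in e (vertex_point x) q -> A (proj T q).
have [||e e0 He] := @finite_radius R (corner n) Q.
- move=> x e e' e'0 le H ax q [t Hq]; apply: H => //; split => // a.
  exact: lt_le_trans (Hq a) le.
- move=> x; have [ax|nax] := boolP (around x); last by exists 1 => // ax; rewrite ax in nax.
  by move: nA; rewrite -(proj_vertex_point ax) => /proj_nbhs[e e0 H]; exists e => // _; exact: H.
have m0 : 0 < Num.min (e / 2) (1 / 3) by rewrite lt_min; apply/andP; split; lra.
have m1 : Num.min (e / 2) (1 / 3) <= e / 2 by rewrite ge_min lexx.
have m2 : Num.min (e / 2) (1 / 3) <= 1 / 3 by rewrite ge_min lexx orbT.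
exists (Num.min (e / 2) (1 / 3)); first by apply/andP; split => //; lra.
move=> P [q [v [<- qv Ev]]]; apply: (He (tag q, v)) => //.
have [t b] := vertex_pointP (tag q, v); split => // a; rewrite b /=.
have := bary_sum q; rewrite (bigD1 v) //=; case: eqP => [->|/eqP av] /=.
  by rewrite Ev ltr_norml => _; apply/andP; split; lra.
rewrite (bigD1 a) //= subr0 ger0_norm ?bary_ge0 //.
have : 0 <= \sum_(i < 4 | (i != v) && (i != a)) co q i by apply: sumr_ge0 => *; exact: bary_ge0.
lra.
Qed.


Let p0 := proj T (vertex_point k).

Hypothesis hT : compact_3manifold R (realization R T).

(** A chart at the vertex maps a small box of the half-space into the star, and
    a small copy of the link into the shell between this box and a smaller one,
    which is mapped too close to the vertex to meet that copy. The primitive on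
    the shell exists because the chart maps the shell to the punctured star,
    where the system [germ] has local primitives. *)
Lemma link_copy_primitive : exists2 e, 0 < e < 1/2 & has_primitive (link_copy e) (germ g).
Proof.
have [_ _ _ /(_ p0)[U [W [f [h [[oU Up] oW fU hW [cf ch]]]]]]] := hT.
pose c := f p0; have [[Wc c0] hc] := fU _ Up; rewrite -/c /half_space3 /= in Wc c0 hc.
have rad (e e' x : R) : e' <= e -> `|x| < e' -> `|x| < e by move=> le /lt_le_trans; apply.
have half1 : (1/2 : R) <= 1 by lra.
have nstar : nbhs (h c) (star (1/2)) by rewrite hc; apply: star_nbhs => //; lra.
have /rV_nbhsP[r1 r10 Hr1] := within_continuousP ch (conj Wc c0) nstar.
have /rV_nbhsP[r2 r20 Hr2] : nbhs c W by apply: open_nbhs_nbhs.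
(* the box of radius [r] lies in the image of the chart and is mapped into the
   star of the vertex *)
pose r := Num.min r1 r2 / 2.
have m1 : Num.min r1 r2 <= r1 by rewrite ge_min lexx.
have m2 : Num.min r1 r2 <= r2 by rewrite ge_min lexx orbT.
have m0 : 0 < Num.min r1 r2 by rewrite lt_min r10.
have r0 : 0 < r by rewrite divr_gt0.
(* the coordinate [0] is cut at the boundary of the half-space *)
pose l (i : 'I_3) := if i == ord0 then Num.max 0 (c ord0 i - r) else c ord0 i - r.
pose u (i : 'I_3) := c ord0 i + r.
have lc i : l i <= c ord0 i.
  by rewrite /l; case: eqP => [->|_]; [rewrite ge_max c0 /=|]; lra.
have boxP y : box l u y -> W y /\ half_space3 y /\ star (1/2) (h y).
  move=> By.
  have Hy i : `|y ord0 i - c ord0 i| <= r.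
    rewrite ler_norml; have := By i; rewrite /l /u; case: eqP => [->|_].
      by rewrite ge_max => /andP[/andP[_ H1] H2]; apply/andP; split; lra.
    by move=> /andP[H1 H2]; apply/andP; split; lra.
  have Wy : W y by apply: Hr2 => i; apply: le_lt_trans (Hy i) _; rewrite /r; lra.
  have Hy0 : half_space3 y.
    by have := By ord0; rewrite /l eqxx ge_max => /andP[/andP[]].
  do 2 split => //; apply: Hr1 => // i.
  by apply: le_lt_trans (Hy i) _; rewrite /r; lra.
have nA : nbhs p0 [set P | U P /\ box l u (f P)].
  have nb : nbhs (f p0) [set y : 'rV[R]_3 | forall i, `|y ord0 i - c ord0 i| < r].
    by apply/rV_nbhsP; exists r.
  have nU : nbhs p0 U by apply: open_nbhs_nbhs.
  apply: filterS2 nU (within_continuousP cf Up nb) => P UP /(_ UP) HP; split => // i.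
  have [[_ fP0] _] := fU _ UP.
  have := HP i; rewrite ltr_norml /l /u => /andP[H1 H2]; apply/andP; split; last lra.
  case: eqP => [i0|_]; last lra.
  by rewrite ge_max; apply/andP; split; [rewrite i0|lra].
have [e /andP[e0 e2] He] := link_copy_nbhs nA.
exists e; first by rewrite e0.
have nstar' : nbhs (h c) (star (e / 2)) by rewrite hc; apply: star_nbhs; lra.
have /rV_nbhsP[d d0 Hd] := within_continuousP ch (conj Wc c0) nstar'.
(* the inner box is mapped into the star of height [e / 2], which does not meet
   the copy of the link *)
pose d' := Num.min d r.
have d'd : d' <= d by rewrite ge_min lexx.
have d'r : d' <= r by rewrite ge_min lexx orbT.
have d'0 : 0 < d' by rewrite lt_min d0.
pose a (i : 'I_3) := c ord0 i - d'; pose b (i : 'I_3) := c ord0 i + d'.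
have lb i : l i <= b i by have := lc i; rewrite /b; lra.
have ab i : a i < b i by rewrite /a /b; lra.
have bu i : b i <= u i by rewrite /b /u; lra.
have la i : i != ord0 -> l i <= a i by rewrite /l /a => /negbTE ->; lra.
have YP := shellP lb ab bu; set Y := shell l u a b in YP.
have fL P : link_copy e P -> [/\ U P, Y (f P) & h (f P) = P].
  move=> LP; have [UP Bf] := He _ LP; have [[Wf Hf] hf] := fU _ UP; split => //.
  apply/YP; split => //; apply: contra_notP (link_copy_star e0 e2 LP) => nex.
  rewrite -hf; apply: Hd => // i.
  rewrite ltr_norml; apply/andP; split; rewrite ltNge; apply/negP => H; apply: nex;
    exists i; rewrite /a /b; [left|right]; lra.
have hY y : Y y -> pstar (h y).
  move=> /YP[By [i Hi]]; have [Wy [Hy Sy]] := boxP _ By.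
  apply: star_pstar Sy _ => E.
  have [_ fh] := hW y (conj Wy Hy).
  have yc : y = c by rewrite -fh E.
  by move: Hi; rewrite yc /a /b; lra.
have chY y A : Y y -> nbhs (h y) A -> \forall y' \near y, Y y' -> A (h y').
  move=> /YP[By _] nhA; have [Wy [Hy _]] := boxP _ By.
  apply: filterS (within_continuousP ch (conj Wy Hy) nhA) => y' H /YP[By' _].
  by have [Wy' [Hy' _]] := boxP _ By'; apply: H.
have primY : has_primitive Y (fun y y' => germ g (h y) (h y')).
  apply: shell_primitive => // y Yy.
  have [V nV PV] := germ_primitive g_anti g_turn (hY _ Yy).
  exists [set y' | Y y' -> V (h y')]; first exact: chY.
  apply: has_primitive_comap PV; first by move=> z [Vz /Vz].
  by move=> z A [_ Yz] nA'; apply: filterS (chY _ _ Yz nA') => z' H [_ /H].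
have [F HF] : has_primitive (link_copy e) (fun P Q => germ g (h (f P)) (h (f Q))).
  apply: has_primitive_comap primY; first by move=> P /fL[].
  move=> P A LP nA'; have [UP _ _] := fL _ LP.
  by apply: filterS (within_continuousP cf UP nA') => Q H /fL[/H].
exists F => P LP; apply: filterS (HF P LP) => Q H LQ.
have [_ _ EP] := fL _ LP; have [_ _ EQ] := fL _ LQ.
by have := H LQ; rewrite EP EQ.
Qed.

Lemma edge_point_link v w e q : w != v -> bary q = edge_point v w e -> co q v = 1 - e.
Proof. by move=> wv ->; rewrite edge_pointE eqxx eq_sym (negbTE wv) mulr0 mulr1 addr0. Qed.

(** With a primitive [F] on a copy of the link, [phi + F] is locally constant
    on the triangle cut off at each corner, hence constant, and its value is
    the potential of the corner. Two corners glued along a face are compared at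
    a point of the face, where [phi] jumps by [g]. *)
Lemma vertex_potential : exists t : 'I_n -> 'I_4 -> R, forall i v f j s,
  around (i, v) -> v != f -> gluing T i f = Some (j, s) -> t j (s v) - t i v = g i v f.
Proof.
have [e /andP[e0 e2] [F HF]] := link_copy_primitive.
pose psi q := phi T g q + F (proj T q).
have e01 : 0 <= e <= 1 by apply/andP; split; lra.
have cst i v p q : around (i, v) -> tag p = i -> tag q = i ->
    co p v = 1 - e -> co q v = 1 - e -> psi p = psi q.
  move=> iv tp tq pv qv.
  pose Z := [set b : 'rV[R]_4 | simplex3 b /\ b ord0 v = 1 - e].
  have cZ : segment_convex Z.
    move=> x y t [[x0 xs] xv] [[y0 ys] yv] /andP[t0 t1].
    split; last by rewrite !mxE xv yv; lra.
    split=> [a|]; first by rewrite !mxE addr_ge0 // mulr_ge0 // subr_ge0.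
    under eq_bigr do rewrite !mxE.
    by rewrite big_split /= -!mulr_sumr xs ys; lra.
  have ZL b : Z b -> link_copy e (proj T (of_bary i b)).
    move=> [Sb bv]; have [tb bb] := of_baryP i Sb.
    by exists (of_bary i b), v; rewrite tb bb.
  have ofE r : tag r = i -> of_bary i (bary r) = r.
    move=> tr; have [|t1 b1] := @of_baryP i (bary r).
      by split => [a|]; [exact: bary_ge0|exact: bary_sum].
    by apply: bary_inj => //; rewrite t1 tr.
  have Zr r : co r v = 1 - e -> Z (bary r).
    by move=> rv; split => //; split => [a|]; [exact: bary_ge0|exact: bary_sum].
  have H : psi (of_bary i (bary p)) = psi (of_bary i (bary q)).
    apply: (segment_convex_connected cZ (h := fun b => psi (of_bary i b))); try exact: Zr.
    move=> b Zb; have [Sb bv] := Zb; have [tb bb] := of_baryP i Sb.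
    have [r r0 Hr] := primitive_loc_const g_anti g_turn (ZL _ Zb)
      (link_copy_pstar e0 e2) (HF _ (ZL _ Zb)).
    apply/rV_nbhsP; exists r => // b' Hb' Zb'; have [Sb' _] := Zb'.
    have [tb' bb'] := of_baryP i Sb'.
    apply: Hr; last exact: ZL.
    by split; [rewrite tb tb'|move=> a; rewrite bb bb'].
  by move: H; rewrite !ofE.
pose t i v := psi (of_bary i (edge_point v (lift v (ord0 : 'I_3)) e)).
have tE i v q : around (i, v) -> tag q = i -> co q v = 1 - e -> psi q = t i v.
  move=> iv tq qv; have [tb bb] := of_baryP i (edge_point_simplex v (lift v (ord0 : 'I_3)) e01).
  apply: (cst i v) => //; apply: edge_point_link bb => //.
  by rewrite eq_sym neq_lift.
exists t => i v f j s iv vf E.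
have [w] := exists_fourth v f f; rewrite !inE !negb_or => /and3P[wv wf _].
have [p [tp bp]] := @exists_point R n i _ (edge_point_simplex v w e01).
have [q [tq bq]] := @exists_point R n j _ (edge_point_simplex (s v) (s w) e01).
have pf : co p f = 0.
  by rewrite bp edge_pointE !(eq_sym f) (negbTE vf) (negbTE wf) !mulr0 addr0.
have pq a : co q (s a) = co p a.
  by rewrite bp bq !edge_pointE !(inj_eq perm_inj).
have pv : co p v = 1 - e by apply: edge_point_link bp.
have Epq : gluing T (tag p) f = Some (tag q, s) by rewrite tp tq.
have [|_ _ d] := glued_punctured g_anti g_turn (p := p) (q := q) (v := v) _ Epq pf pq.
  by split; rewrite pv; lra.
rewrite -(tE i v p) // -(tE j (s v) q) ?pq //; last exact: around_glued iv vf E.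
have -> : psi q = phi T g q + F (proj T p).
  by congr (_ + F _); apply/proj_eqP/rst_sym/rst_step; exists f, s.
by move: d; rewrite /psi tp; lra.
Qed.

End VertexPotential.

(** * Standard and quadrilateral matching equations *)

Local Close Scope classical_set_scope.
Local Open Scope ring_scope.

Section Matching.
Variables (R : realType) (n : nat) (T : triangulation n).
Implicit Types (w : std_vec R n) (q : quad_vec R n) (V : {set corner n}).

(** Each step of the cycle exchanges a value of [F] for the value of [G] at the
    next element. *)
Lemma cycle_sum (X : eqType) (e : rel X) (F G : X -> R) (c : seq X) :
  (forall x y, e x y -> F x = G y) -> path.cycle e c ->
  \sum_(x <- c) F x = \sum_(x <- c) G x.
Proof.
move=> FG; case: c => [|x p]; first by rewrite !big_nil.
have H l y : path e y l -> \sum_(z <- belast y l) F z = \sum_(z <- l) G z.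
  elim: l y => [|z l IH] y /=; first by rewrite !big_nil.
  by case/andP=> yz pl; rewrite !big_cons IH // (FG _ _ yz).
by rewrite [path.cycle _ _]/= => /H; rewrite belast_rcons => ->; rewrite big_rcons /= big_cons addrC.
Qed.

Lemma next_stateE (x y : edge_state n) : next_state T x = Some y ->
  exists s, [/\ gluing T x.1 (x.2 o2) = Some (y.1, s), y.2 o0 = s (x.2 o0) & y.2 o3 = s (x.2 o2)].
Proof.
case: x => i r; rewrite /next_state /=.
case E: (gluing T i (r o2)) => [[j s]|//] [<-] /=; exists s.
by rewrite !permM tpermR tpermD // eq_sym ?o0_neq2 ?o0_neq3.
Qed.

(** Around an edge, the triangular coordinates cancel from the sum of the
    standard equations. *)
Lemma std_matching_quad w : std_matching T w -> quad_matching T (quad_proj w).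
Proof.
move=> Hw c /andP[cyc _].
pose F (x : edge_state n) := tri w x.1 (x.2 o0) + quad w x.1 (down_quad x).
pose G (x : edge_state n) := tri w x.1 (x.2 o0) + quad w x.1 (up_quad x).
have : \sum_(x <- c) F x = \sum_(x <- c) G x.
  apply: cycle_sum cyc => x y /eqP /next_stateE[s [E E0 E3]].
  rewrite /F /G /down_quad /up_quad E0 E3; apply: Hw E _.
  by rewrite (inj_eq perm_inj) o0_neq2.
rewrite !big_split /= => /addrI E.
under eq_bigr do rewrite /quad_proj mxE.
by under [RHS]eq_bigr do rewrite /quad_proj mxE.
Qed.

Lemma glued_corners_sym : connect_sym (glued_corners T).
Proof.
suff H x y : glued_corners T x y -> glued_corners T y x.
  by apply: sym_connect_sym => x y; apply/idP/idP; exact: H.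
move=> /existsP[f /andP[fx]]; case E: gluing => [[j s]|//] /eqP ->.
apply/existsP; exists (s f); rewrite /= (inj_eq perm_inj) fx (gluing_sym E) permK.
by rewrite -surjective_pairing eqxx.
Qed.

(** The potentials of the different vertices are put together, each corner
    using the one of its canonical representative. *)
Lemma quad_lift q : compact_3manifold R (realization R T) -> quad_matching T q ->
  exists2 w, std_matching T w & quad_proj w = q.
Proof.
move=> hT Hq.
pose g (i : 'I_n) (v f : 'I_4) : R :=
  if gluing T i f is Some (j, s) then
    q i (quad_type v f) - q j (quad_type (s v) (s f)) else 0.
have g_anti i f j s v : gluing T i f = Some (j, s) -> v != f ->
    g j (s v) (s f) = - g i v f.
  by move=> E vf; rewrite /g E (gluing_sym E) !permK opprB.
have g_turn c : edge_turn T c -> \sum_(x <- c) g x.1 (x.2 o0) (x.2 o2) = 0.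
  move=> tc; have cyc : path.cycle (fun x y => next_state T x == Some y) c by case/andP: tc.
  have : \sum_(x <- c) (q x.1 (down_quad x) - g x.1 (x.2 o0) (x.2 o2))
       = \sum_(x <- c) q x.1 (up_quad x).
    apply: cycle_sum cyc => x y /eqP /next_stateE[s [E E0 E3]].
    by rewrite /g E /up_quad /down_quad E0 E3 opprB addrC subrK.
  by rewrite sumrB -(Hq _ tc) => /eqP; rewrite subr_eq addrC -subr_eq subrr eq_sym => /eqP.
have [t Ht] := choice (fun k => vertex_potential g_anti g_turn k hT).
pose rt := fingraph.root (glued_corners T).
exists (row_mx (\matrix_(i < n, v < 4) t (rt (i, v)) i v) q); last by rewrite /quad_proj row_mxKr.
move=> i f j s v E vf; rewrite /tri /quad !row_mxEl !row_mxEr !mxE.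
have vs : glued_corners T (i, v) (j, s v).
  by apply/existsP; exists f; rewrite /= E eqxx eq_sym vf.
have -> : rt (j, s v) = rt (i, v).
  by apply/esym/(fingraph.rootP glued_corners_sym)/connect1.
have := Ht (rt (i, v)) i v f j s _ vf E; rewrite /g E => H.
have {}H := H _.
have -> : t (rt (i, v)) j (s v) = t (rt (i, v)) i v + (q i (quad_type v f) - q j (quad_type (s v) (s f))).
  by rewrite -H; [rewrite addrC subrK|rewrite /around glued_corners_sym connect_root].
by rewrite -addrA subrK.
Qed.

Lemma vertexP V : V \in vertices T ->
  exists k, forall x, (x \in V) = connect (glued_corners T) k x.
Proof.
case/imsetP=> k _ ->; exists k => x.
by rewrite !inE.
Qed.

Lemma vertex_of x : exists2 V, V \in vertices T & x \in V.
Proof.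
exists [set y in [set: corner n]%SET | connect (glued_corners T) x y]%SET.
  by apply/imsetP; exists x; rewrite ?inE.
by rewrite !inE connect0.
Qed.

Lemma vertex_uniq V V' x : V \in vertices T -> V' \in vertices T ->
  x \in V -> x \in V' -> V = V'.
Proof.
move=> /vertexP[k Vk] /vertexP[k' Vk'] xV xV'; apply/setP => y.
move: xV xV'; rewrite !Vk !Vk' => kx k'x.
by rewrite (same_connect glued_corners_sym kx) (same_connect glued_corners_sym k'x).
Qed.

Lemma vertex_neq0 V : V \in vertices T -> exists x, x \in V.
Proof. by case/vertexP=> k Vk; exists k; rewrite Vk connect0. Qed.

Lemma vertex_glued V i v f j s : V \in vertices T -> v != f -> gluing T i f = Some (j, s) ->
  ((j, s v) \in V) = ((i, v) \in V).
Proof.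
case/vertexP=> k Vk vf E; rewrite !Vk; apply/esym.
rewrite !(glued_corners_sym k); apply: same_connect1; first exact: glued_corners_sym.
by apply/existsP; exists f; rewrite /= E eqxx eq_sym vf.
Qed.

Lemma tri_link V i v : tri (link R V) i v = ((i, v) \in V)%:R.
Proof. by rewrite /tri /link row_mxEl mxE. Qed.

Lemma quad_link V i a : quad (link R V) i a = 0.
Proof. by rewrite /quad /link row_mxEr mxE. Qed.

Lemma std_matchingD (w w' : 'M[R]_(n, 4 + 3)) : std_matching T w -> std_matching T w' -> std_matching T (w + w').
Proof.
move=> H H' i f j s v E vf; rewrite /tri /quad !mxE.
by rewrite addrACA -[RHS]addrACA; congr (_ + _); [exact: H E vf|exact: H' E vf].
Qed.

Lemma std_matchingZ (a : R) (w : 'M[R]_(n, 4 + 3)) : std_matching T w -> std_matching T (a *: w).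
Proof.
move=> H i f j s v E vf; rewrite /tri /quad !mxE -!mulrDr; congr (_ * _).
exact: H E vf.
Qed.

Lemma std_matchingB (w w' : 'M[R]_(n, 4 + 3)) : std_matching T w -> std_matching T w' -> std_matching T (w - w').
Proof. by move=> H H'; rewrite -scaleN1r; apply/std_matchingD/std_matchingZ. Qed.

Lemma std_matching_link V : V \in vertices T -> std_matching T (link R V).
Proof.
by move=> VT i f j s v E vf; rewrite !tri_link !quad_link (vertex_glued VT vf E).
Qed.

Lemma tri_const w V : std_matching T w -> (forall i a, quad w i a = 0) -> V \in vertices T ->
  forall x y, x \in V -> y \in V -> tri w x.1 x.2 = tri w y.1 y.2.
Proof.
move=> Hw Q0 VT.
have H x y : connect (glued_corners T) x y -> tri w x.1 x.2 = tri w y.1 y.2.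
  case/connectP=> l; elim: l x => [x _ -> //|z l IH x] /= /andP[/existsP[f /andP[fx]]].
  case E: gluing => [[j s]|//] /eqP Ez pl Ey; rewrite -(IH z) // Ez /=.
  by have := Hw _ _ _ _ x.2 E; rewrite !Q0 !addr0 => -> //; rewrite eq_sym.
case/vertexP: VT => k Vk x y; rewrite !Vk => kx ky; apply: H.
by rewrite -(same_connect glued_corners_sym kx).
Qed.

Lemma finite_min (I : finType) (A : {set I}) (F : I -> R) : (exists x, x \in A) ->
  exists2 x, x \in A & forall y, y \in A -> F x <= F y.
Proof. by case=> x0 x0A; case: (arg_minP F x0A) => x xA H; exists x. Qed.

(** The smallest triangular coordinate at each vertex is subtracted from all
    the coordinates at that vertex. *)
Lemma canonical_extP q : compact_3manifold R (realization R T) ->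
  nonneg_mx q -> quad_matching T q -> quad_constraints q ->
  [/\ std_admissible T (canonical_ext T q), Defs.canonical T (canonical_ext T q) &
      quad_proj (canonical_ext T q) = q].
Proof.
move=> hT q0 Hq qc; rewrite /canonical_ext.
suff [w Hw] : exists w, [/\ std_admissible T w, Defs.canonical T w & quad_proj w = q].
  by case: xgetP => [w' _ //|/(_ w)].
have [u Hu uq] := quad_lift hT Hq.
have con x y := same_connect glued_corners_sym (x := x) (y := y).
have min x : exists y, connect (glued_corners T) x y /\
    forall z, connect (glued_corners T) x z -> tri u y.1 y.2 <= tri u z.1 z.2.
  have [|y yA H] := @finite_min _ [set y | connect (glued_corners T) x y]%SET (fun y => tri u y.1 y.2).
    by exists x; rewrite inE connect0.
  by exists y; rewrite inE in yA; split => // z xz; apply: H; rewrite inE.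
have [lo Hlo] := choice min.
pose m x := tri u (lo x).1 (lo x).2.
have m_const x y : connect (glued_corners T) x y -> m x = m y.
  move=> xy; have [H1 H2] := Hlo x; have [H3 H4] := Hlo y.
  apply/le_anti/andP; split; [apply: H2; rewrite (con _ _ xy)|apply: H4; rewrite -(con _ _ xy)] => //.
have m_le x : m x <= tri u x.1 x.2 by have [_] := Hlo x; apply; exact: connect0.
pose w : std_vec R n := row_mx (\matrix_(i < n, v < 4) (tri u i v - m (i, v))) q.
have wt x : tri w x.1 x.2 = tri u x.1 x.2 - m x.
  by rewrite /tri /w row_mxEl mxE -surjective_pairing.
have wq : quad_proj w = q by rewrite /quad_proj row_mxKr.
exists w; split => //; last first.
  move=> V /vertexP[k Vk]; split=> [x _|]; first by rewrite wt subr_ge0.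
  have [H1 _] := Hlo k; exists (lo k); first by rewrite Vk.
  by rewrite wt -(m_const _ _ H1) subrr.
split; last by rewrite wq.
  move=> i a; case: (split_ordP a) => b ->; last by rewrite row_mxEr.
  by have := m_le (i, b); rewrite row_mxEl mxE subr_ge0.
move=> i f j s v E vf.
have := Hu _ _ _ _ _ E vf; rewrite -!/(tri _ (i, v).1 (i, v).2).
have -> i' a : quad w i' a = quad u i' a.
  by rewrite /quad row_mxEr -uq /quad_proj mxE.
have -> i' a : quad w i' a = quad u i' a.
  by rewrite /quad row_mxEr -uq /quad_proj mxE.
rewrite -[tri w j (s v)]/(tri w (j, s v).1 (j, s v).2) -[tri w i v]/(tri w (i, v).1 (i, v).2) !wt /=.
have -> : m (j, s v) = m (i, v).
  apply/esym/m_const/connect1/existsP; exists f.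
  by rewrite /= E eqxx eq_sym vf.
lra.
Qed.

End Matching.

(** * Extreme rays of a cone *)

Section Cones.
Variables (R : realType) (n m : nat).
Notation vec := 'M[R]_(n, m).
Notation pos := ('I_n * 'I_m)%type.
Notation co w p := (w p.1 p.2).
Implicit Types (u v w : vec) (C : {set pos}) (p : pos).

Variable E : vec -> Prop.
Hypothesis ED : forall u v, E u -> E v -> E (u + v).
Hypothesis EZ : forall a u, E u -> E (a *: u).

Let EB u v : E u -> E v -> E (u - v).
Proof. by move=> Eu Ev; rewrite -scaleN1r; apply/ED/EZ. Qed.

Definition eq_on C u v := forall p, p \in C -> co u p = co v p.
Definition zero_on C u := forall p, p \in C -> co u p = 0.
Definition nonneg_on C u := forall p, p \in C -> 0 <= co u p.
Definition zeros_sub C u v := forall p, p \in C -> co u p = 0 -> co v p = 0.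

(** Extremality with respect to the conditions [co u p >= 0] for [p] in [C],
    for vectors that are identified when they agree on [C]. It says that the
    zeros of [w] in [C] determine it up to a factor among all the solutions
    [u], positive or not, which allows one to test with linear combinations. *)
Definition extreme C w := [/\ E w, nonneg_on C w, ~ zero_on C w &
  forall u, E u -> zeros_sub C w u -> exists a, eq_on C u (a *: w)].

Let suppC C w := [set p in C | co w p != 0]%SET.

Lemma not_zero_on C w : ~ zero_on C w -> exists2 p, p \in C & co w p != 0.
Proof.
move=> nz; have [p|none] := pickP [pred p in C | co w p != 0].
  by case/andP; exists p.
case: nz => p pC; apply/eqP/negbFE.
by have := none p; rewrite /= pC.
Qed.

(** The ratio test: one moves from [w] in the direction [- u] until a
    coordinate vanishes. *)
Lemma min_ratio C w u : nonneg_on C w -> (exists2 p, p \in C & 0 < co u p) ->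
  exists t, [/\ 0 <= t, nonneg_on C (w - t *: u) &
     exists p, [/\ p \in C, 0 < co u p & co (w - t *: u) p = 0]].
Proof.
move=> w0 [p0 p0C up0].
have P0 : [pred p in C | 0 < co u p] p0 by rewrite /= p0C.
case: (arg_minP (fun p : pos => co w p / co u p) P0) => p /andP[pC up] H.
exists (co w p / co u p); split.
- by rewrite divr_ge0 ?w0 // ltW.
- move=> q qC; rewrite !mxE subr_ge0.
  have [uq|uq] := ltP 0 (co u q).
    by rewrite -ler_pdivlMr //; apply: H; apply/andP.
  by apply: le_trans (w0 q qC); rewrite mulr_ge0_le0 // divr_ge0 ?w0 // ltW.
- by exists p; split => //; rewrite !mxE divfK ?subrr // gt_eqF.
Qed.

(** A direction that keeps the zeros of [w] and is not proportional to it
    leads, by the ratio test, to a vector with more zeros. *)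
Lemma not_extreme C w : E w -> nonneg_on C w -> ~ zero_on C w -> ~ extreme C w ->
  exists u, [/\ E u, nonneg_on C u, ~ zero_on C u, zeros_sub C w u &
    exists2 p, p \in C & co w p != 0 /\ co u p = 0].
Proof.
move=> Ew w0 wnz nex.
have [u [Eu wu nu]] : exists u, [/\ E u, zeros_sub C w u & forall a, ~ eq_on C u (a *: w)].
  apply: contra_notP nex => none; split => // u Eu wu.
  by apply: contra_notP none => none; exists u; split => // a H; apply: none; exists a.
wlog [p0 p0C up0] : u Eu wu nu / exists2 p, p \in C & 0 < co u p.
  move=> H; have [pos|npos] := pselect (exists2 p, p \in C & 0 < co u p); first exact: H pos.
  apply: (H (- u)).
  - by rewrite -scaleN1r; exact: EZ.
  - by move=> p pC /wu H'; rewrite mxE H' ?oppr0.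
  - move=> a H'; apply: (nu (- a)) => p pC.
    by have := H' p pC; rewrite !mxE mulNr => <-; rewrite opprK.
  have [|p pC up] := @not_zero_on C u.
    by move=> uz; apply: (nu 0) => p pC; rewrite uz // scale0r mxE.
  exists p => //; rewrite mxE oppr_gt0 lt_neqAle up leNgt.
  by apply/negP => H'; apply: npos; exists p.
have [|t [t0 wt0 [p [pC up wp]]]] := @min_ratio C w u w0; first by exists p0.
exists (w - t *: u); split => //.
- by apply: EB => //; exact: EZ.
- move=> z; have t_neq : t != 0.
    by apply: contra_notN wnz => /eqP t0E q qC; have := z q qC; rewrite t0E scale0r subr0.
  apply: (nu t^-1) => q qC; have := z q qC; rewrite !mxE => /eqP; rewrite subr_eq0 => /eqP ->.
  by rewrite mulKf.
- by move=> q qC wq; rewrite !mxE wq (wu q qC wq) mulr0 subr0.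
- exists p => //; split => //; apply: contraTneq up => /(wu p pC) ->.
  by rewrite ltxx.
Qed.

(** Every vector of the cone is a sum of extreme rays of its minimal face, as
    an induction principle. If [w] is not extreme, it is the sum of two vectors
    of the cone with more zeros. *)
Lemma cone_ind C (Q : vec -> Prop) w : E w -> nonneg_on C w ->
  (forall u v, Q u -> Q v -> Q (u + v)) ->
  (forall u, E u -> zero_on C u -> Q u) ->
  (forall u, extreme C u -> zeros_sub C w u -> Q u) -> Q w.
Proof.
move=> Ew w0 QD Q0 Qex.
have [k] := ubnP #|suppC C w|; elim: k => // k IH in w Ew w0 Qex *.
rewrite ltnS => wk.
have [wz|wnz] := pselect (zero_on C w); first exact: Q0.
have [wex|wnex] := pselect (extreme C w); first by apply: Qex.
have [u [Eu u0 unz wu [p pC [wp up]]]] := not_extreme Ew w0 wnz wnex.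
have small v q : zeros_sub C w v -> q \in C -> co w q != 0 -> co v q = 0 ->
    (#|suppC C v| < k)%N.
  move=> wv qC wq vq; apply: leq_trans wk; apply: proper_card; apply/properP; split.
    apply/fintype.subsetP => r; rewrite !inE => /andP[rC vr]; rewrite rC.
    by apply: contraNneq vr => /(wv r rC) ->.
  by exists q; rewrite !inE qC ?wq // vq eqxx.
have [|t [t0 wt0 [q [qC uq wq]]]] := @min_ratio C w u w0.
  have [r rC ur] := not_zero_on unz.
  by exists r => //; rewrite lt_neqAle eq_sym ur u0.
have sub1 : zeros_sub C w (w - t *: u).
  by move=> r rC wr; rewrite !mxE wr (wu r rC wr) mulr0 subr0.
have sub2 : zeros_sub C w (t *: u).
  by move=> r rC wr; rewrite !mxE (wu r rC wr) mulr0.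
rewrite -[w](subrK (t *: u)); apply: QD; apply: IH.
- by apply: EB => //; exact: EZ.
- exact: wt0.
- by move=> v vex H; apply: Qex => // r rC /(sub1 r rC); exact: H.
- by apply: (small _ q) => //; apply: contraTneq uq => /(wu q qC) ->; rewrite ltxx.
- exact: EZ.
- by move=> r rC; rewrite mxE mulr_ge0 // u0.
- by move=> v vex H; apply: Qex => // r rC /(sub2 r rC); exact: H.
- by apply: (small _ p) => //; rewrite mxE up mulr0.
Qed.

Lemma exists_extreme C w : E w -> nonneg_on C w -> ~ zero_on C w ->
  exists2 u, extreme C u & zeros_sub C w u.
Proof.
move=> Ew w0; apply: contra_notP => none.
apply: (cone_ind (Q := zero_on C) Ew w0) => //.
  by move=> u v Hu Hv p pC; rewrite mxE Hu // Hv // addr0.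
by move=> u uex wu; case: none; exists u.
Qed.

Lemma eq_on_scale_gt0 C u v a : nonneg_on C u -> ~ zero_on C u -> nonneg_on C v ->
  eq_on C u (a *: v) -> 0 < a.
Proof.
move=> u0 unz v0 uv; have [p pC up] := not_zero_on unz.
rewrite ltNge; apply/negP => a0; move: up; rewrite (uv p pC) mxE.
have : 0 <= a * co v p by have := u0 p pC; rewrite (uv p pC) mxE.
by move=> H; rewrite (@le_anti _ _ (a * co v p) 0) ?eqxx // H mulr_le0_ge0 // v0.
Qed.

Lemma eq_on_inv C u v a : 0 < a -> eq_on C u (a *: v) -> eq_on C v (a^-1 *: u).
Proof. by move=> a0 uv p pC; rewrite mxE (uv p pC) mxE mulKf // gt_eqF. Qed.

Lemma extreme_sub C u w : extreme C u -> E w -> nonneg_on C w -> ~ zero_on C w ->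
  zeros_sub C u w -> exists2 a, 0 < a & eq_on C w (a *: u).
Proof.
move=> [_ u0 _ uex] Ew w0 wnz /(uex _ Ew)[a wa]; exists a => //.
exact: eq_on_scale_gt0 wa.
Qed.

Lemma extreme_eq C u w b : extreme C u -> E w -> 0 < b -> eq_on C w (b *: u) -> extreme C w.
Proof.
move=> [Eu u0 unz uex] Ew b0 wu; split => //.
- by move=> p pC; rewrite wu // mxE mulr_ge0 ?u0 // ltW.
- move=> wz; apply: unz => p pC; apply/eqP; have := wz p pC; rewrite wu // mxE => /eqP.
  by rewrite mulf_eq0 gt_eqF.
- move=> v Ev wv; have [|a va] := uex v Ev.
    by move=> p pC up; apply: wv => //; rewrite wu // mxE up mulr0.
  exists (a / b) => p pC; rewrite va // !mxE wu // mxE mulrA divfK //.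
  by rewrite gt_eqF.
Qed.

(** If [w] is not extreme for [C], it is a sum of extreme rays for [C] in its
    minimal face. None of them vanishes at [p], as it would be proportional to
    [w]; since [co w p = 0], both signs occur. *)
Lemma extreme_split C p w : (forall u, E u -> zero_on C u -> co u p = 0) ->
  extreme (p |: C)%SET w -> ~ extreme C w ->
  co w p = 0 /\ exists u v, [/\ extreme C u /\ zeros_sub C w u,
     extreme C v /\ zeros_sub C w v, 0 < co u p & co v p < 0].
Proof.
move=> dep [Ew w0 wnz wex] nex.
have w0C : nonneg_on C w by move=> q qC; apply: w0; rewrite setU1r.
have wnzC : ~ zero_on C w.
  move=> wz; apply: wnz => q /setU1P[->|/wz//]; exact: dep.
have pin : p \in (p |: C)%SET by rewrite setU11.
have prop u : E u -> zeros_sub C w u -> co u p = 0 -> exists a, eq_on (p |: C)%SET u (a *: w).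
  by move=> Eu wu up; apply: wex => // q /setU1P[->|/wu].
have [u [Eu wu nu]] : exists u, [/\ E u, zeros_sub C w u & forall a, ~ eq_on C u (a *: w)].
  apply: contra_notP nex => none; split => // u Eu wu.
  by apply: contra_notP none => none; exists u; split => // a H; apply: none; exists a.
have wp : co w p = 0.
  apply/eqP; apply: contraT => wp.
  have [|||a H] := @prop (u - (co u p / co w p) *: w).
  - by apply: EB => //; exact: EZ.
  - by move=> q qC wq; rewrite !mxE wq (wu q qC wq) mulr0 subr0.
  - by rewrite !mxE divfK ?subrr.
  exfalso; apply: (nu (a + co u p / co w p)) => q qC.
  have := H q (setU1r _ qC); rewrite !mxE mulrDl => /eqP.
  by rewrite subr_eq => /eqP.
have neq v : extreme C v -> zeros_sub C w v -> co v p != 0.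
  move=> vex wv; apply/eqP => vp; apply: nex.
  have [Ev v0 vnz _] := vex; have [a va] := prop v Ev wv vp.
  have {}va : eq_on C v (a *: w) by move=> q qC; apply: va; rewrite setU1r.
  have a0 := eq_on_scale_gt0 v0 vnz w0C va.
  by apply: extreme_eq vex Ew _ (eq_on_inv a0 va); rewrite invr_gt0.
split => //.
have [u1 [H1 H2 H3]] : exists u, [/\ extreme C u, zeros_sub C w u & 0 < co u p].
  apply: contrapT => none.
  have : co w p < 0 \/ (zero_on C w /\ co w p = 0).
    apply: (cone_ind (Q := fun u => co u p < 0 \/ (zero_on C u /\ co u p = 0)) Ew w0C).
    - move=> x y Hx Hy; rewrite !mxE.
      case: Hx => [xp|[xz ->]]; case: Hy => [yp|[yz ->]]; try by left; lra.
      by right; split; rewrite ?addr0 // => q qC; rewrite mxE xz // yz // addr0.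
    - by move=> x Ex xz; right; split => //; exact: dep.
    - move=> x xex wx; left; rewrite lt_neqAle neq // leNgt; apply/negP => xp.
      by apply: none; exists x.
  by rewrite wp ltxx => -[//|[]].
have [v1 [H4 H5 H6]] : exists v, [/\ extreme C v, zeros_sub C w v & co v p < 0].
  apply: contrapT => none.
  have : 0 < co w p \/ (zero_on C w /\ co w p = 0).
    apply: (cone_ind (Q := fun u => 0 < co u p \/ (zero_on C u /\ co u p = 0)) Ew w0C).
    - move=> x y Hx Hy; rewrite !mxE.
      case: Hx => [xp|[xz ->]]; case: Hy => [yp|[yz ->]]; try by left; lra.
      by right; split; rewrite ?addr0 // => q qC; rewrite mxE xz // yz // addr0.
    - by move=> x Ex xz; right; split => //; exact: dep.
    - move=> x xex wx; left; rewrite lt_neqAle eq_sym neq // leNgt; apply/negP => xp.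
      by apply: none; exists x.
  by rewrite wp ltxx => -[//|[]].
by exists u1, v1.
Qed.

(** A direction in the face of a vertex [w], corrected to have sum zero, can be
    followed both ways from [w], so that it is zero. Conversely the ends of a
    segment through [w] have at least the zeros of [w]. *)
Lemma polytope_vertexP w :
  polytope_vertex [set w : vec | [/\ nonneg_mx w, coord_sum w = 1 & E w]]%classic w <->
  coord_sum w = 1 /\ extreme [set: pos]%SET w.
Proof.
have sumD u v : coord_sum (u + v) = coord_sum u + coord_sum v.
  rewrite /coord_sum -big_split; apply: eq_bigr => i _; rewrite -big_split.
  by apply: eq_bigr => j _; rewrite mxE.
have sumZ a u : coord_sum (a *: u) = a * coord_sum u.
  rewrite /coord_sum mulr_sumr; apply: eq_bigr => i _; rewrite mulr_sumr.
  by apply: eq_bigr => j _; rewrite mxE.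
have sum_eq u v : eq_on [set: pos]%SET u v -> u = v.
  by move=> H; apply/matrixP => i j; have := H (i, j); apply; rewrite inE.
split=> [[[w0 w1 Ew] H]|[w1 [Ew w0 wnz wex]]].
  split => //; split => //.
    move=> wz; move: w1; rewrite (_ : w = 0); last first.
      by apply: sum_eq => p pC; rewrite wz // mxE.
    by rewrite -(scale0r 0) sumZ mul0r => /eqP; rewrite eq_sym oner_eq0.
  move=> u Eu wu; exists (coord_sum u).
  pose d := u - coord_sum u *: w.
  have Ed : E d by apply: EB => //; exact: EZ.
  have sd : coord_sum d = 0.
    by rewrite /d -scaleN1r !sumD sumZ sumZ w1 mulr1 mulN1r subrr.
  have wd p : co w p = 0 -> co d p = 0.
    by move=> wp; rewrite !mxE wp (wu p) ?inE // mulr0 subr0.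
  have [t t0 Ht] : exists2 t : R, 0 < t & forall p : pos, `|t * co d p| <= co w p.
    have [||t t0 Ht] := @finite_radius R _ (fun (p : pos) t => `|t * co d p| <= co w p).
    - move=> p e e' e0 le; apply: le_trans; rewrite !normrM ler_wpM2r //.
      by rewrite !gtr0_norm // (lt_le_trans e0).
    - move=> p; have [/wd ->|wp] := eqVneq (co w p) 0.
        by exists 1 => //; rewrite mulr0 normr0; exact: w0.
      exists (co w p / (1 + `|co d p|)).
        by rewrite divr_gt0 ?ltr_pwDl // lt_neqAle eq_sym wp w0.
      have d1 : 0 < 1 + `|co d p| by rewrite ltr_pwDl.
      rewrite normrM ger0_norm; last by rewrite divr_ge0 ?w0 // ltW.
      by rewrite mulrAC ler_pdivrMr // ler_wpM2l ?w0 // lerDr.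
    by exists t.
  have ok s : `|s| = 1 -> [/\ nonneg_mx (w + (s * t) *: d), coord_sum (w + (s * t) *: d) = 1
      & E (w + (s * t) *: d)].
    move=> s1; split.
    - move=> i j; have := Ht (i, j); rewrite !mxE /=.
      rewrite -[`|_|]mul1r -s1 -normrM mulrA ler_norml => /andP[]; lra.
    - by rewrite sumD sumZ sd mulr0 addr0.
    - by apply: ED => //; exact: EZ.
  have E1 := H _ _ (1/2) (ok 1 (normr1 _)) (ok (-1) (normrN1 _)).
  have half : 0 < (1/2 : R) < 1 by apply/andP; split; lra.
  have Ew' : w = (1 / 2) *: (w + (1 * t) *: d) + (1 - 1 / 2) *: (w + (-1 * t) *: d).
    by apply/matrixP => i j; rewrite !mxE; lra.
  have {}E1 := E1 half Ew'.
  move=> p _; have := congr1 (fun M : vec => co M p) E1; rewrite !mxE => E2.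
  have : t * (u p.1 p.2 - coord_sum u * w p.1 p.2) = 0 by lra.
  by move/eqP; rewrite mulf_eq0 gt_eqF //= subr_eq0 => /eqP.
split; first by split => // i j; have := w0 (i, j); apply; rewrite inE.
have key y t z : nonneg_mx y -> nonneg_mx z -> E y -> coord_sum y = 1 -> 0 < t -> t < 1 ->
    w = t *: y + (1 - t) *: z -> y = w.
  move=> y0 z0 Ey y1 t0 t1 Ew'.
  have [|a Ha] := wex y Ey.
    move=> p _; rewrite Ew' !mxE => H; have := y0 p.1 p.2; have := z0 p.1 p.2 => Hz Hy.
    have H1 : 0 <= t * y p.1 p.2 by rewrite mulr_ge0 // ltW.
    have H2 : 0 <= (1 - t) * z p.1 p.2 by rewrite mulr_ge0 // subr_ge0 ltW.
    have /eqP : t * y p.1 p.2 = 0 by lra.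
    by rewrite mulf_eq0 gt_eqF //= => /eqP.
  have {}Ha := sum_eq _ _ Ha; move: y1; rewrite Ha sumZ w1 mulr1 => ->.
  by rewrite scale1r.
move=> y z t [y0 y1 Ey] [z0 z1 Ez] /andP[t0 t1] Ew'.
have yw : y = w by apply: key Ew'.
have zw : z = w.
  apply: (key z (1 - t) y) => //; first by rewrite subr_gt0.
    by rewrite ltrBlDr ltrDl.
  by rewrite Ew' addrC; congr (_ + _); rewrite opprB addrCA subrr addr0.
by rewrite yw zw.
Qed.

End Cones.

(** * The double description steps at one vertex *)

Section Step.
Variables (R : realType) (n : nat).
Notation vec := 'M[R]_(n, 4 + 3).
Notation pos := (position n).
Notation co w p := (w p.1 p.2).
Implicit Types (u v w x y z : vec) (C : {set pos}) (p : pos) (L : seq vec).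

Definition joint_zeros_sub C u w z := forall p, p \in C -> co u p = 0 -> co w p = 0 -> co z p = 0.

Definition quad_adm w := quad_constraints (quad_proj w).

Lemma comb_adjacentP C L u w : reflect
  (forall z, z \in L -> joint_zeros_sub C u w z -> z = u \/ z = w)
  (comb_adjacent C L u w).
Proof.
rewrite /comb_adjacent; apply: (iffP idP) => [/hasPn H z zL zuw|H].
  have := H z zL; rewrite !negb_and !negbK => /or3P[/eqP|/eqP|]; try by auto.
  case/negP; apply/forall_inP => p pC; apply/implyP => /andP[/eqP up /eqP wp].
  by apply/eqP; exact: zuw.
apply/hasPn => z zL; apply/negP => /and3P[zu zw /forall_inP Hz].
have [|/eqP|/eqP] := H z zL; [|by rewrite (negbTE zu)|by rewrite (negbTE zw)].
move=> p pC up wp; apply/eqP; have /implyP := Hz p pC; apply.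
by rewrite /entry up wp eqxx.
Qed.

Lemma compatibleP u w : reflect
  (forall i k l, (quad u i k != 0) || (quad w i k != 0) ->
     (quad u i l != 0) || (quad w i l != 0) -> k = l)
  (compatible u w).
Proof.
have E i : (2 <= #|[set k | (quad u i k == 0%R) && (quad w i k == 0%R)]%SET|)%N =
    (#|[set k | (quad u i k != 0%R) || (quad w i k != 0%R)]%SET| <= 1)%N.
  have -> : [set k | (quad u i k != 0%R) || (quad w i k != 0%R)]%SET =
     ~: [set k | (quad u i k == 0%R) && (quad w i k == 0%R)]%SET.
    by apply/setP => k; rewrite !inE negb_and.
  rewrite [in RHS]cardsCs finset.setCK card_ord.
  have : (#|[set k | (quad u i k == 0%R) && (quad w i k == 0%R)]%SET| <= 3)%N.
    by rewrite -[X in (_ <= X)%N](card_ord 3) max_card.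
  by case: #|_| => [|[|[|[|]]]].
apply: (iffP forallP) => H i.
  move=> k l Hk Hl; move: (H i); rewrite E => /card_le1_eqP; apply; by rewrite inE.
by rewrite E; apply/card_le1_eqP => k l; rewrite !inE => Hk Hl; apply: (H i).
Qed.

Lemma quad_co w i k : quad w i k = co w (i, rshift 4 k).
Proof. by []. Qed.

Lemma quad_positionsP i k : (i, rshift 4 k) \in quad_positions n.
Proof. by apply/imset2P; exists i k. Qed.

Lemma quad_adm_sub C u z : (quad_positions n \subset C)%SET ->
  quad_adm u -> zeros_sub C u z -> quad_adm z.
Proof.
move=> /fintype.subsetP qC ua uz i k l; rewrite !mxE => Hk Hl.
have H a : z i (rshift 4 a) != 0 -> quad_proj u i a != 0.
  apply: contraNneq; rewrite mxE => H; apply/eqP.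
  by apply: (uz (i, rshift 4 a)) => //; apply: qC; exact: quad_positionsP.
by apply: (ua i k l); exact: H.
Qed.

Lemma quad_adm_joint C u w z : (quad_positions n \subset C)%SET ->
  compatible u w -> joint_zeros_sub C u w z -> quad_adm z.
Proof.
move=> /fintype.subsetP qC /compatibleP uw H i k l; rewrite !mxE => Hk Hl.
have H' a : z i (rshift 4 a) != 0 -> (quad u i a != 0) || (quad w i a != 0).
  apply: contraNT; rewrite negb_or !negbK => /andP[/eqP ua /eqP wa]; apply/eqP.
  by apply: (H (i, rshift 4 a)) => //; apply: qC; exact: quad_positionsP.
by apply: (uw i k l); exact: H'.
Qed.

Lemma quad_adm_compatible C w u v : (quad_positions n \subset C)%SET ->
  quad_adm w -> zeros_sub C w u -> zeros_sub C w v -> compatible u v.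
Proof.
move=> /fintype.subsetP qC wa wu wv; apply/compatibleP => i k l Hk Hl.
have H a : (quad u i a != 0) || (quad v i a != 0) -> quad_proj w i a != 0.
  apply: contraTneq; rewrite mxE => H; rewrite negb_or !negbK.
  have qa := qC _ (quad_positionsP i a).
  by rewrite !quad_co (wu _ qa H) (wv _ qa H) eqxx.
by apply: (wa i k l); exact: H.
Qed.

Lemma process_positionP C L p z :
  z \in (process_position (L, C) p).1 <->
  (z \in L /\ 0 <= co z p) \/
  exists u w, [/\ u \in L /\ w \in L, 0 < co u p, co w p < 0,
     compatible u w && comb_adjacent C L u w & z = combine p u w].
Proof.
rewrite /process_position /= !mem_cat !mem_filter /entry; split.
  case/or3P=> [/andP[/eqP zp zL]|/andP[zp zL]|/mapP[[u w]]].
  - by left; rewrite zp.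
  - by left; rewrite ltW.
  - rewrite mem_filter /= => /andP[t /allpairsP[[u' w'] /= []]].
    rewrite !mem_filter => /andP[up uL] /andP[wp wL] [Eu Ew] zE; subst u' w'.
    by right; exists u, w.
case=> [[zL z0]|[u [w [[uL wL] up wp t zE]]]].
  by rewrite zL; case: (ltgtP 0 (co z p)) z0.
apply/orP; right; apply/orP; right; apply/mapP; exists (u, w) => //.
rewrite mem_filter /= t; apply/allpairsP; exists (u, w).
by rewrite !mem_filter /= uL wL up wp.
Qed.

Variable E : vec -> Prop.
Hypothesis ED : forall u v, E u -> E v -> E (u + v).
Hypothesis EZ : forall a u, E u -> E (a *: u).

(** The last clause matters: two members on the same ray would each make the
    other fail the adjacency test. *)
Definition represents C L :=
  [/\ forall x, x \in L -> extreme E C x /\ quad_adm x,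
      forall w, extreme E C w -> quad_adm w ->
        exists2 x, x \in L & exists2 a, 0 < a & eq_on C w (a *: x)
    & forall x y a, x \in L -> y \in L -> eq_on C x (a *: y) -> x = y].

Variables (C0 Tv : {set pos}) (l : vec) (K : seq vec).
Hypothesis qC0 : (quad_positions n \subset C0)%SET.
Hypothesis El : E l.
Hypothesis l0 : zero_on C0 l.
Hypothesis l1 : forall p, p \in Tv -> co l p = 1.
Hypothesis link_only : forall u, E u -> zero_on C0 u ->
  forall p q, p \in Tv -> q \in Tv -> co u p = co u q.
Hypothesis repK : represents C0 K.
Hypothesis K0 : forall x, x \in K -> nonneg_on Tv x.
Hypothesis Kzero : forall x, x \in K -> exists2 p, p \in Tv & co x p = 0.

Let EB u v : E u -> E v -> E (u - v).
Proof. by move=> Eu Ev; rewrite -scaleN1r; apply/ED/EZ. Qed.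

(** [C] is the set of positions that count after some, but at least one, of the
    positions [Tv] of the vertex have been processed. *)
Definition between C := [/\ C0 \subset C, C \subset C0 :|: Tv & exists2 p, p \in C & p \in Tv]%SET.

(** The link [l] is the only extreme ray that vanishes on [C0]. It is not in
    the list; the canonical rays [K] are, whether or not they are extreme for
    [C]. *)
Definition lower_hull C L :=
  [/\ forall x, x \in L -> x \in K \/ [/\ extreme E C x, ~ zero_on C0 x & quad_adm x],
      {subset K <= L},
      forall w, extreme E C w -> ~ zero_on C0 w -> quad_adm w ->
        exists2 x, x \in L & exists2 a, 0 < a & eq_on C w (a *: x)
    & forall x y a, x \in L -> y \in L -> eq_on C x (a *: y) -> x = y].

Let C0_not_Tv p : p \in C0 -> p \in Tv -> False.
Proof. by move=> /l0 H /l1; rewrite H => /eqP; rewrite eq_sym oner_eq0. Qed.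

(** A solution that vanishes on the old positions is a multiple of the link. *)
Lemma eq_on_link u v a : E u -> E v -> eq_on C0 u (a *: v) ->
  exists c, forall p, p \in (C0 :|: Tv)%SET -> co u p = a * co v p + c * co l p.
Proof.
move=> Eu Ev uv.
have Ed : E (u - a *: v) by apply: EB => //; exact: EZ.
have dz : zero_on C0 (u - a *: v).
  by move=> p pC; have := uv p pC; rewrite !mxE => ->; rewrite subrr.
have [p pT|none] := pickP (mem Tv); last first.
  exists 0 => p; rewrite mul0r addr0 => /setUP[/uv ->|]; first by rewrite mxE.
  by have := none p => /= ->.
exists (co (u - a *: v) p) => q /setUP[qC|qT].
  by rewrite (uv q qC) l0 // mulr0 addr0 mxE.
have := link_only Ed dz pT qT; rewrite l1 // !mxE; lra.
Qed.

Lemma between_full C u v : between C -> E u -> E v -> eq_on C u v ->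
  eq_on (C0 :|: Tv)%SET u v.
Proof.
move=> [/fintype.subsetP sub _ [p0 pC pT]] Eu Ev uv.
have [|c Hc] := @eq_on_link u v 1 Eu Ev.
  by move=> p /sub /uv ->; rewrite scale1r.
have c0 : c = 0.
  have := Hc p0; rewrite inE pT orbT uv // l1 // mul1r mulr1 => /(_ isT); lra.
by move=> p /Hc ->; rewrite c0 mul0r addr0 mul1r.
Qed.

Lemma ext_C0_of u C : between C -> nonneg_on C u -> nonneg_on C0 u.
Proof. by move=> [/fintype.subsetP sub _ _] u0 p /sub/u0. Qed.

Lemma eq_on_sub C C' u v : (C' \subset C)%SET -> eq_on C u v -> eq_on C' u v.
Proof. by move=> /fintype.subsetP sub uv p /sub/uv. Qed.

(** Without a zero at the vertex, the link could be subtracted. *)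
Lemma extreme_zero C x : between C -> extreme E C x -> ~ zero_on C0 x ->
  exists p, [/\ p \in C, p \in Tv & co x p = 0].
Proof.
move=> [/fintype.subsetP sub /fintype.subsetP sub' [p0 pC pT]] [Ex x0 xnz xex] nz.
apply: contrapT => none.
have [|a Ha] := xex l El.
  move=> p /[dup] pC' /sub' /setUP[/l0 ->//|pT' xp].
  by case: none; exists p.
apply: nz => p pC0; have := Ha p (sub p pC0); rewrite l0 // mxE => /esym/eqP.
rewrite mulf_eq0 => /orP[/eqP a0|/eqP//].
by have := Ha p0 pC; rewrite a0 scale0r mxE l1 // => /eqP; rewrite oner_eq0.
Qed.

Lemma extreme_of_base C x p : between C -> extreme E C0 x -> nonneg_on C x ->
  p \in C -> p \in Tv -> co x p = 0 -> extreme E C x.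
Proof.
move=> [/fintype.subsetP sub /fintype.subsetP sub' _] [Ex _ xnz xex] x0 pC pT xp; split => //.
  by move=> xz; apply: xnz => q /sub/xz.
move=> u Eu xu; have [|a ua] := xex u Eu; first by move=> q qC; apply: xu; exact: sub.
exists a; have [c Hc] := eq_on_link Eu Ex ua.
have c0 : c = 0.
  by have := Hc p; rewrite inE pT orbT xp (xu p pC xp) l1 // mulr0 add0r mulr1 => /(_ isT).
by move=> q /sub'/Hc ->; rewrite c0 mul0r addr0 mxE.
Qed.

(** There is one lower extreme ray above a ray: two of them differ by a
    multiple of the link, and both have a zero at the vertex. *)
Lemma lower_uniq C x y a : between C -> extreme E C x -> ~ zero_on C0 x ->
  extreme E C y -> ~ zero_on C0 y -> eq_on C0 x (a *: y) -> eq_on C x (a *: y).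
Proof.
move=> bC xex xnz yex ynz xy.
have [p [pC pT xp]] := extreme_zero bC xex xnz.
have [q [qC qT yq]] := extreme_zero bC yex ynz.
have [Ex x0 _ _] := xex; have [Ey y0 _ _] := yex.
have a0 := eq_on_scale_gt0 (ext_C0_of bC x0) xnz (ext_C0_of bC y0) xy.
have [c Hc] := eq_on_link Ex Ey xy.
have Hp := Hc p; rewrite inE pT orbT xp l1 // mulr1 in Hp.
have Hq := Hc q; rewrite inE qT orbT yq l1 // mulr1 mulr0 add0r in Hq.
have c0 : c = 0.
  have H1 := Hp isT; have H2 := Hq isT; have := x0 q qC; have : 0 <= a * co y p.
    by rewrite mulr_ge0 ?y0 // ltW.
  lra.
have [_ /fintype.subsetP sub' _] := bC.
by move=> r /sub'/Hc ->; rewrite c0 mul0r addr0 mxE.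
Qed.

Lemma K_face w : E w -> nonneg_on C0 w -> ~ zero_on C0 w -> quad_adm w ->
  exists2 x, x \in K & zeros_sub C0 w x.
Proof.
move=> Ew w0 wnz wa; have [u uex wu] := exists_extreme ED EZ Ew w0 wnz.
have [_ Hc _] := repK.
have [x xK [a a0 ux]] := Hc u uex (quad_adm_sub qC0 wa wu).
exists x => // p pC wp; have := ux p pC; rewrite (wu p pC wp) mxE => /esym/eqP.
by rewrite mulf_eq0 gt_eqF //= => /eqP.
Qed.

Lemma K_ray w u : E w -> nonneg_on C0 w -> ~ zero_on C0 w -> quad_adm w ->
  (forall x, x \in K -> zeros_sub C0 w x -> x = u) ->
  u \in K /\ exists2 a, 0 < a & eq_on C0 w (a *: u).
Proof.
move=> Ew w0 wnz wa H.
have [x xK wx] := K_face Ew w0 wnz wa.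
have xu := H x xK wx; rewrite xu in xK; split => //; clear x wx xu.
have [Hext Hc _] := repK; have [[Eu u0 _ _] _] := Hext u xK.
have [a Ha] : exists a, eq_on C0 w (a *: u).
  apply: (cone_ind ED EZ (Q := fun w => exists a, eq_on C0 w (a *: u)) Ew w0).
  - move=> y z [a Ha] [b Hb]; exists (a + b) => p pC.
    by rewrite mxE Ha // Hb // !mxE mulrDl.
  - by move=> y _ yz; exists 0 => p pC; rewrite yz // scale0r mxE.
  - move=> y yex wy; have [x xK' [a a0 yx]] := Hc y yex (quad_adm_sub qC0 wa wy).
    exists a; rewrite -(H x) // => p pC wp.
    have := yx p pC; rewrite (wy p pC wp) mxE => /esym/eqP.
    by rewrite mulf_eq0 gt_eqF //= => /eqP.
by exists a => //; apply: eq_on_scale_gt0 Ha.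
Qed.

Lemma coE u v a b p : co (a *: u + b *: v) p = a * co u p + b * co v p.
Proof. by rewrite !mxE. Qed.

Lemma combineE p u w q : co (combine p u w) q =
  (co u p - co w p)^-1 * (co u p * co w q - co w p * co u q).
Proof. by rewrite !mxE. Qed.

Lemma combine_at p u w : co (combine p u w) p = 0.
Proof. by rewrite combineE mulrC [co w p * _]mulrC subrr mul0r. Qed.

Lemma combine_pos p u w : 0 < co u p -> co w p < 0 ->
  exists a b, [/\ 0 < a, 0 < b & forall q, co (combine p u w) q = a * co u q + b * co w q].
Proof.
move=> up wp; have d0 : 0 < co u p - co w p by lra.
exists (- co w p / (co u p - co w p)), (co u p / (co u p - co w p)); split.
- by rewrite divr_gt0 // oppr_gt0.
- by rewrite divr_gt0.
- by move=> q; rewrite combineE; field; rewrite gt_eqF.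
Qed.

Lemma combine_E p u w : E u -> E w -> E (combine p u w).
Proof. by move=> Eu Ew; apply/EZ/EB; exact: EZ. Qed.

Lemma combine_zeros C p u w q : nonneg_on C u -> nonneg_on C w ->
  0 < co u p -> co w p < 0 -> q \in C ->
  co (combine p u w) q = 0 -> co u q = 0 /\ co w q = 0.
Proof.
move=> u0 w0 up wp qC; have [a [b [a0 b0 ->]]] := combine_pos up wp => H.
have Hu : 0 <= a * co u q by rewrite mulr_ge0 ?u0 // ltW.
have Hw : 0 <= b * co w q by rewrite mulr_ge0 ?w0 // ltW.
have /eqP : a * co u q = 0 by lra.
have /eqP : b * co w q = 0 by lra.
by rewrite !mulf_eq0 (gt_eqF a0) (gt_eqF b0) /= => /eqP -> /eqP ->.
Qed.

Section OnePosition.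
Variables (C : {set pos}) (L : seq vec) (p : pos).
Hypothesis bC : between C.
Hypothesis LH : lower_hull C L.
Hypothesis pT : p \in Tv.

Let Cp := (p |: C)%SET.

Let bCp : between Cp.
Proof.
have [s1 s2 [p0 pC pT']] := bC; split.
- by apply: fintype.subset_trans s1 _; exact: finset.subsetUr.
- by rewrite finset.subUset s2 andbT finset.sub1set inE pT orbT.
- by exists p; rewrite ?setU11.
Qed.

Let inC0 q : q \in C0 -> q \in C.
Proof. by have [/fintype.subsetP + _ _] := bC; apply. Qed.

Let inC q : q \in C -> q \in C0 \/ q \in Tv.
Proof. by have [_ /fintype.subsetP H _] := bC; move/H/setUP. Qed.

Let qC : (quad_positions n \subset C)%SET.
Proof. by have [s _ _] := bC; exact: fintype.subset_trans qC0 s. Qed.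

Let L_E x : x \in L -> E x.
Proof.
have [H _ _ _] := LH; move=> /H[xK|[[]]//].
by have [Hext _ _] := repK; have [[]] := Hext x xK.
Qed.

Let K_nonneg x : x \in K -> nonneg_on C x.
Proof.
move=> xK q /inC[qC'|qT]; last exact: K0.
by have [Hext _ _] := repK; have [[_ H _ _] _] := Hext x xK; apply: H.
Qed.

Let L_nonneg x : x \in L -> nonneg_on C x.
Proof. by have [H _ _ _] := LH; move=> /H[/K_nonneg|[[]]//]. Qed.

Let L_nz x : x \in L -> ~ zero_on C0 x.
Proof.
have [H _ _ _] := LH; move=> /H[xK|[[]]//].
by have [Hext _ _] := repK; have [[]] := Hext x xK.
Qed.

Let L_adm x : x \in L -> quad_adm x.
Proof.
have [H _ _ _] := LH; move=> /H[xK|[]//].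
by have [Hext _ _] := repK; have [] := Hext x xK.
Qed.

Let nonneg_C0 x : nonneg_on C x -> nonneg_on C0 x.
Proof. by move=> H q /inC0/H. Qed.

Let at_p u v : E u -> E v -> eq_on C u v -> co u p = co v p.
Proof. by move=> Eu Ev uv; apply: (between_full bC Eu Ev uv); rewrite inE pT orbT. Qed.

Let neg_lower w : w \in L -> co w p < 0 -> extreme E C w.
Proof.
have [H _ _ _] := LH; move=> /H[wK|[]//].
by rewrite ltNge (K0 wK pT).
Qed.

Let not_zero_combine u w : u \in L -> w \in L -> 0 < co u p -> co w p < 0 ->
  ~ zero_on C0 (combine p u w).
Proof.
move=> uL wL up wp z; apply: (L_nz uL) => q qC'.
by have [] := combine_zeros (L_nonneg uL) (L_nonneg wL) up wp (inC0 qC') (z q qC').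
Qed.

Let nonneg_combine u w : u \in L -> w \in L -> 0 < co u p -> co w p < 0 ->
  nonneg_on Cp (combine p u w).
Proof.
move=> uL wL up wp q /setU1P[->|qC']; first by rewrite combine_at.
have [a [b [a0 b0 ->]]] := combine_pos up wp.
by rewrite addr_ge0 // mulr_ge0 ?(ltW a0) ?(ltW b0) // L_nonneg.
Qed.

(** If [u] and [w] have no common zero at the vertex, then any member of [K] in
    the minimal face of [w] for [C0] has the common zeros of [u] and [w], so
    that the test forces it to be [u]: hence [u] is canonical, [w] lies below
    it, and the combination is the point of level [0] on the same vertical
    line. If they have a common zero there, the link is not in their minimal
    face, all the other extreme rays of this face are in the list, and the test
    leaves only [u] and [w]. *)
Lemma adjacent_extreme u w : u \in L -> w \in L -> 0 < co u p -> co w p < 0 ->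
  compatible u w -> comb_adjacent C L u w -> extreme E Cp (combine p u w).
Proof.
move=> uL wL up wp cuw /comb_adjacentP adj.
have wext := neg_lower wL wp.
have Eu := L_E uL; have Ew := L_E wL.
have [common|nocommon] := pselect (exists2 q, q \in C & q \in Tv /\ co u q = 0 /\ co w q = 0); last first.
  have [uK [a a0 wu]] : u \in K /\ exists2 a, 0 < a & eq_on C0 w (a *: u).
    apply: K_ray => //; [exact: nonneg_C0 (L_nonneg wL)|exact: L_nz|exact: L_adm|].
    move=> x xK wx; have xL : x \in L by have [_ H _ _] := LH; apply: H.
    have [|//|xw] := adj x xL; last by have := K0 xK pT; rewrite xw leNgt wp.
    move=> q /[dup] qC' /inC[qC0'|qT] uq wq; first exact: wx.
    by case: nocommon; exists q.
  have [Hext _ _] := repK; have [uext _] := Hext u uK.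
  have [c1 [c2 [c10 c20 cE]]] := combine_pos up wp.
  have [b b0 cu] : exists2 b, 0 < b & eq_on C0 (combine p u w) (b *: u).
    exists (c1 + c2 * a); first by rewrite addr_gt0 // mulr_gt0.
    by move=> q qC'; rewrite cE (wu q qC') !mxE; lra.
  apply: (@extreme_of_base _ _ p bCp) => //.
  - exact: (extreme_eq uext (combine_E _ Eu Ew) b0 cu).
  - exact: nonneg_combine.
  - by rewrite setU11.
  - exact: combine_at.
case: common => p2 p2C [p2T [up2 wp2]].
have uext : extreme E C u.
  have [H _ _ _] := LH; case: (H u uL) => [uK|[]//].
  have [Hext _ _] := repK; have [uext _] := Hext u uK.
  by apply: (extreme_of_base bC uext) up2 => //; exact: L_nonneg.
have span z : extreme E C z -> joint_zeros_sub C u w z ->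
    exists a b, eq_on C z (a *: u + b *: w).
  move=> zext zuw; have [Ez z0 znz _] := zext.
  have za : quad_adm z := quad_adm_joint qC cuw zuw.
  have znz0 : ~ zero_on C0 z.
    move=> z00; apply: znz => q /inC[/z00//|qT].
    by rewrite (link_only Ez z00 qT p2T) zuw.
  have [_ _ H _] := LH; have [x xL [a a0 zx]] := H z zext znz0 za.
  have [|xu|xw] := adj x xL.
  - move=> q qC' uq wq; have := zx q qC'; rewrite zuw // mxE => /esym/eqP.
    by rewrite mulf_eq0 gt_eqF //= => /eqP.
  - by exists a, 0 => q qC'; rewrite zx // xu coE mul0r addr0 mxE.
  - by exists 0, a => q qC'; rewrite zx // xw coE mul0r add0r mxE.
split.
- exact: combine_E.
- exact: nonneg_combine.
- by move=> z; apply: (not_zero_combine uL wL up wp) => q qC'; apply: z; rewrite setU1r ?inC0.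
move=> z Ez cz.
have zp : co z p = 0 by apply: cz; rewrite ?setU11 ?combine_at.
have zuw : joint_zeros_sub C u w z.
  move=> q qC' uq wq; apply: cz; first by rewrite setU1r.
  by rewrite combineE uq wq !mulr0 subr0 mulr0.
(* [u + w] is positive wherever [z] may be nonzero, so that a multiple of it
   brings [z] into the cone, where [cone_ind] applies *)
have [N HN] : exists N, nonneg_on C (z + N *: (u + w)).
  exists (\sum_(q in C) `|co z q| / (co u q + co w q)) => q qC'.
  have uq := L_nonneg uL qC'; have wq := L_nonneg wL qC'.
  rewrite !mxE; have [s0|s0] := eqVneq (co u q + co w q) 0.
    by rewrite s0 mulr0 addr0 zuw //; lra.
  have s_gt0 : 0 < co u q + co w q by rewrite lt_neqAle eq_sym s0 addr_ge0.
  have : `|co z q| <= (\sum_(q in C) `|co z q| / (co u q + co w q)) * (co u q + co w q).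
    rewrite -ler_pdivrMr // (bigD1 q) //= lerDl sumr_ge0 // => r /andP[rC _].
    by rewrite divr_ge0 // addr_ge0 // L_nonneg.
  by have := ler_norm (- co z q); rewrite normrN; lra.
have Ez' : E (z + N *: (u + w)) by apply: ED => //; apply/EZ/ED.
have [a [b zE]] : exists a b, eq_on C (z + N *: (u + w)) (a *: u + b *: w).
  apply: (cone_ind ED EZ (Q := fun y => exists a b, eq_on C y (a *: u + b *: w)) Ez' HN).
  - move=> x y [a1 [b1 H1]] [a2 [b2 H2]]; exists (a1 + a2), (b1 + b2) => q qC'.
    by rewrite mxE H1 // H2 // !coE; lra.
  - by move=> x _ xz; exists 0, 0 => q qC'; rewrite xz // coE !mul0r addr0.
  - move=> x xext zx; apply: span => // q qC' uq wq; apply: zx => //.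
    by rewrite !mxE zuw // uq wq addr0 mulr0 addr0.
have {}zE : eq_on C z ((a - N) *: u + (b - N) *: w).
  by move=> q qC'; have := zE q qC'; rewrite !mxE; lra.
have zpE : co z p = (a - N) * co u p + (b - N) * co w p.
  by rewrite -coE; apply: at_p => //; apply: ED; exact: EZ.
exists ((b - N) * (co u p - co w p) / co u p) => q /setU1P[->|qC'].
  by rewrite mxE combine_at mulr0.
have d0 : co u p - co w p != 0 by rewrite gt_eqF //; lra.
have u0 : co u p != 0 by rewrite gt_eqF.
rewrite zE // coE mxE combineE.
have aN : a - N = - (b - N) * co w p / co u p.
  apply: (mulIf u0); rewrite divfK //; move: zpE; rewrite zp; lra.
by rewrite aN; field; rewrite d0.
Qed.


Let sym_eq x y a : ~ zero_on C0 x -> eq_on C x (a *: y) -> exists b, eq_on C y (b *: x).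
Proof.
move=> xnz xy; have a0 : a != 0.
  apply: contra_notN xnz => /eqP a0 q /inC0 qC'.
  by rewrite (xy q qC') a0 scale0r mxE.
by exists a^-1 => q qC'; rewrite mxE (xy q qC') mxE mulKf.
Qed.

Let Cp_eq u v : eq_on Cp u v -> eq_on C u v.
Proof. by move=> uv q qC'; apply: uv; rewrite setU1r. Qed.

Let passing u w := [/\ u \in L /\ w \in L, 0 < co u p, co w p < 0 &
  forall z, z \in L -> joint_zeros_sub C u w z -> z = u \/ z = w].

Let combine_zeros' u w q : passing u w -> q \in C ->
  co (combine p u w) q = 0 -> co u q = 0 /\ co w q = 0.
Proof. by move=> [[uL wL] up wp _]; apply: combine_zeros (L_nonneg uL) (L_nonneg wL) up wp. Qed.

(** A retained ray proportional to a combination of [u] and [w] would have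
    their common zeros, against the test. *)
Let old_new x u w a : x \in L -> 0 <= co x p -> passing u w ->
  ~ eq_on Cp x (a *: combine p u w).
Proof.
move=> xL xp [[uL wL] up wp adj] xE.
have xp0 : co x p = 0 by rewrite (xE p (setU11 _ _)) mxE combine_at mulr0.
have [|xu|xw] := adj x xL.
- move=> q qC' uq wq; rewrite (Cp_eq xE qC') mxE combineE uq wq; lra.
- by move: up; rewrite -xu xp0 ltxx.
- by move: wp; rewrite -xw xp0 ltxx.
Qed.

Let new_new u w u' w' a : passing u w -> passing u' w' ->
  eq_on C (combine p u w) (a *: combine p u' w') -> u' = u /\ w' = w.
Proof.
move=> P P' cE; have [[uL wL] up wp adj] := P; have [[uL' wL'] up' wp' _] := P'.
have a0 : a != 0.
  apply/eqP => a0; apply: (not_zero_combine uL wL up wp) => q /inC0 qC'.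
  by rewrite (cE q qC') a0 scale0r mxE.
have H q : q \in C -> co u q = 0 -> co w q = 0 -> co u' q = 0 /\ co w' q = 0.
  move=> qC' uq wq; apply: combine_zeros' => //; have := cE q qC'.
  rewrite combineE uq wq !mulr0 subr0 mulr0 mxE => /esym/eqP.
  by rewrite mulf_eq0 (negbTE a0) => /eqP.
split.
  have [|//|E'] := adj u' uL'; first by move=> q qC' uq wq; have [] := H q qC' uq wq.
  by move: up'; rewrite E' ltNge (ltW wp).
have [|E'|//] := adj w' wL'; first by move=> q qC' uq wq; have [] := H q qC' uq wq.
by move: wp'; rewrite E' ltNge (ltW up).
Qed.

(** A new extreme ray [w0] lies between extreme rays [u] and [v] on both sides
    of the hyperplane, and its face is spanned by them. The list contains [v]
    up to a factor, since [v] is negative at [p] and the link is not, and the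
    pair is tested successfully. If [u] is a multiple of the link, the
    canonical ray [x] above the same ray as [v] takes its place. *)
Lemma extreme_found w0 : extreme E Cp w0 -> ~ zero_on C0 w0 -> quad_adm w0 ->
  exists2 x, x \in (process_position (L, C) p).1 & exists2 a, 0 < a & eq_on Cp w0 (a *: x).
Proof.
move=> w0ext w0nz w0a; have [_ KL LHc uniqL] := LH; have [Ew0 w00 w0nz' w0x] := w0ext.
have scale x a : E x -> eq_on C w0 (a *: x) -> eq_on Cp w0 (a *: x).
  move=> Ex xE q /setU1P[->|/xE//]; apply: at_p => //; exact: EZ.
have [w0C|w0nC] := pselect (extreme E C w0).
  have [x xL [a a0 xE]] := LHc w0 w0C w0nz w0a.
  exists x; last by exists a => //; apply: scale => //; exact: L_E.
  apply/process_positionP; left; split => //.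
  have := w00 p (setU11 _ _); rewrite (scale _ _ (L_E xL) xE p (setU11 _ _)) mxE.
  by rewrite pmulr_rge0.
have dep u : E u -> zero_on C u -> co u p = 0.
  move=> Eu uz; have E0 : E (0 *: u) by exact: EZ.
  rewrite (at_p Eu E0); first by rewrite scale0r mxE.
  by move=> q qC'; rewrite uz // scale0r mxE.
have [w0p [u [v [[uext w0u] [vext w0v] up vp]]]] := extreme_split ED EZ dep w0ext w0nC.
have [Eu u0 unz _] := uext; have [Ev v0 vnz _] := vext.
have ua : quad_adm u := quad_adm_sub qC w0a w0u.
have va : quad_adm v := quad_adm_sub qC w0a w0v.
have multiple z : E z -> zeros_sub C w0 z -> co z p = 0 -> exists a, eq_on Cp z (a *: w0).
  by move=> Ez w0z zp; apply: w0x => // q /setU1P[->|/w0z].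
have posmul z : E z -> nonneg_on C z -> ~ zero_on C z -> zeros_sub C w0 z -> co z p = 0 ->
    exists2 a, 0 < a & eq_on Cp w0 (a *: z).
  move=> Ez z0 znz w0z zp; have [a aE] := multiple z Ez w0z zp.
  have a0 : 0 < a.
    apply: (eq_on_scale_gt0 z0 znz _ (Cp_eq aE)).
    by move=> q qC'; apply: w00; rewrite setU1r.
  by exists a^-1; [rewrite invr_gt0|exact: eq_on_inv].
have [p0 p0C p0T] : exists2 p, p \in C & p \in Tv by have [] := bC.
have vnz0 : ~ zero_on C0 v.
  move=> vz; have := v0 p0 p0C; rewrite (link_only Ev vz p0T pT); lra.
have [v' v'L [av av0 vE]] := LHc v vext vnz0 va.
have vE' : co v p = av * co v' p.
  by rewrite (at_p Ev (EZ av (L_E v'L)) vE) mxE.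
have v'p : co v' p < 0 by move: vp; rewrite vE' pmulr_rlt0.
have v'ext := neg_lower v'L v'p.
have w0v' : zeros_sub C w0 v'.
  move=> q qC' /(w0v q qC'); rewrite (vE q qC') mxE => /eqP.
  by rewrite mulf_eq0 gt_eqF //= => /eqP.
have span z : E z -> zeros_sub C w0 z -> exists a b, eq_on C z (a *: u + b *: v).
  move=> Ez w0z.
  have Ez' : E (z - (co z p / co u p) *: u) by apply: EB => //; exact: EZ.
  have [||a aE] := multiple _ Ez'.
  - by move=> q qC' wq; rewrite !mxE (w0z q qC' wq) (w0u q qC' wq) mulr0 subr0.
  - by rewrite !mxE divfK ?subrr // gt_eqF.
  have [c1 [c2 [c10 c20 cE]]] := combine_pos up vp.
  have [|||||b b0 bE] := posmul (combine p u v).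
  - exact: combine_E.
  - by move=> q qC'; rewrite cE addr_ge0 // mulr_ge0 ?u0 ?v0 // ltW.
  - move=> cz; apply: unz => q qC'.
    by have [] := combine_zeros u0 v0 up vp qC' (cz q qC').
  - by move=> q qC' wq; rewrite cE (w0u q qC' wq) (w0v q qC' wq) !mulr0 addr0.
  - exact: combine_at.
  exists (co z p / co u p + a * b * c1), (a * b * c2) => q qC'.
  have H1 : co z q - co z p / co u p * co u q = a * co w0 q.
    by have := Cp_eq aE qC'; rewrite !mxE.
  have H2 : co w0 q = b * (c1 * co u q + c2 * co v q).
    by rewrite (Cp_eq bE qC') mxE cE.
  rewrite coE; move: H1; rewrite H2; set k := co z p / co u p => H1; lra.
have finish x y : x \in L -> y \in L -> 0 < co x p -> co y p < 0 ->
    zeros_sub C w0 x -> zeros_sub C w0 y -> comb_adjacent C L x y ->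
    exists2 z, z \in (process_position (L, C) p).1 & exists2 a, 0 < a & eq_on Cp w0 (a *: z).
  move=> xL yL xp yp w0xs w0ys adj.
  have [a a0 aE] : exists2 a, 0 < a & eq_on Cp w0 (a *: combine p x y).
    apply: posmul.
    - by apply: combine_E; exact: L_E.
    - by move=> q qC'; apply: (nonneg_combine xL yL xp yp); rewrite setU1r.
    - move=> z; apply: (not_zero_combine xL yL xp yp) => q /inC0; exact: z.
    - by move=> q qC' wq; rewrite combineE (w0xs q qC' wq) (w0ys q qC' wq) !mulr0 subr0 mulr0.
    - exact: combine_at.
  exists (combine p x y); last by exists a.
  apply/process_positionP; right; exists x, y; split => //.
  by rewrite adj (quad_adm_compatible qC w0a w0xs w0ys).
(* [u] is a multiple of the link exactly when it vanishes on [C0] *)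
have [uz|unz0] := pselect (zero_on C0 u); last first.
  have [u' u'L [au au0 uE]] := LHc u uext unz0 ua.
  have u'p : 0 < co u' p.
    by move: up; rewrite (at_p Eu (EZ au (L_E u'L)) uE) mxE pmulr_rgt0.
  have w0u' : zeros_sub C w0 u'.
    move=> q qC' /(w0u q qC'); rewrite (uE q qC') mxE => /eqP.
    by rewrite mulf_eq0 gt_eqF //= => /eqP.
  have uvN b : ~ eq_on C u (b *: v).
    move=> uv; suff E' : u' = v' by move: u'p; rewrite E' ltNge (ltW v'p).
    apply: (uniqL _ _ (au^-1 * (b * av))) => // q qC'.
    have := uv q qC'; rewrite (uE q qC') !mxE (vE q qC') mxE => H.
    by rewrite -!mulrA -H mulKf // gt_eqF.
  have vuN b : ~ eq_on C v (b *: u).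
    move=> vu; have [b' ub'] := sym_eq vnz0 vu; exact: uvN ub'.
  apply: (finish u' v') => //; apply/comb_adjacentP => z zL zuv.
  have Ez := L_E zL; have z0 := L_nonneg zL; have znz0 := L_nz zL.
  have [|a [b zE]] := span z Ez.
    by move=> q qC' wq; apply: zuv => //; [exact: w0u'|exact: w0v'].
  have same x y c : x \in L -> eq_on C z (c *: y) -> eq_on C y (au *: x) \/ eq_on C y (av *: x) -> z = x.
    move=> xL zy yx; case: yx => yx.
      apply: (uniqL _ _ (c * au)) => // q qC'; by rewrite zy // !mxE yx // mxE mulrA.
    by apply: (uniqL _ _ (c * av)) => // q qC'; rewrite zy // !mxE yx // mxE mulrA.
  have znzC : ~ zero_on C z by move=> zz; apply: znz0 => q /inC0/zz.
  (* a third member of the list in the face would be a combination of [u] and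
     [v] with coefficients [a] and [b]; each sign pattern is excluded *)
  have [a0|a0|a0] := ltgtP a 0.
  - exfalso.
    have b0 : 0 < b.
      rewrite ltNge; apply/negP => b0; apply: znzC => q qC'; apply/le_anti.
      rewrite z0 // andbT zE // coE.
      have := u0 q qC'; have := v0 q qC' => H1 H2.
      have : 0 <= (- a) * co u q by rewrite mulr_ge0 // oppr_ge0 ltW.
      have : 0 <= (- b) * co v q by rewrite mulr_ge0 // oppr_ge0.
      lra.
    have vu : zeros_sub C v u.
      move=> q qC' vq; have := z0 q qC'; rewrite zE // coE vq mulr0 addr0 => H.
      by apply/le_anti; rewrite u0 // andbT -(nmulr_rge0 _ a0).
    have [_ _ _ vx] := vext; have [c cE] := vx u Eu vu; exact: uvN cE.
  - have [b0|b0|b0] := ltgtP b 0.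
    + exfalso.
      have uv : zeros_sub C u v.
        move=> q qC' uq; have := z0 q qC'; rewrite zE // coE uq mulr0 add0r => H.
        by apply/le_anti; rewrite v0 // andbT -(nmulr_rge0 _ b0).
      have [_ _ _ ux] := uext; have [c cE] := ux v Ev uv; exact: vuN cE.
    + exfalso.
      have zu : zeros_sub C z u /\ zeros_sub C z v.
        suff H q : q \in C -> co z q = 0 -> co u q = 0 /\ co v q = 0.
          by split=> q qC' zq; have [] := H q qC' zq.
        move=> qC'; rewrite zE // coE => /eqP.
        rewrite paddr_eq0 ?mulr_ge0 ?(ltW a0) ?(ltW b0) ?u0 ?v0 //.
        by rewrite !mulf_eq0 (gt_eqF a0) (gt_eqF b0) /= => /andP[/eqP ? /eqP ?].
      have [H _ _ _] := LH; case: (H z zL) => [zK|[zext _ _]].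
        have [Hext _ _] := repK; have [zext0 _] := Hext z zK.
        have [zu0 zv0] : zeros_sub C0 z u /\ zeros_sub C0 z v.
          by case: zu => H1 H2; split=> q /inC0 qC'; [exact: H1|exact: H2].
        have [a1 a10 uz] := extreme_sub zext0 Eu (nonneg_C0 u0) unz0 zu0.
        have [a2 a20 vz] := extreme_sub zext0 Ev (nonneg_C0 v0) vnz0 zv0.
        apply: (@uvN (a1 * a2^-1)); apply: (lower_uniq bC uext unz0 vext vnz0) => q qC'.
        by rewrite (uz q qC') !mxE (vz q qC') mxE -mulrA mulKf // gt_eqF.
      case: zu => zu zv; have [_ _ _ zx] := zext.
      have [c1 c1E] := zx u Eu zu; have [c2 c2E] := zx v Ev zv.
      have c20 : c2 != 0.
        by apply: contra_notN vnz => /eqP c20 q qC'; rewrite c2E // c20 scale0r mxE.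
      apply: (@uvN (c1 / c2)) => q qC'.
      by rewrite c1E // !mxE c2E // mxE -mulrA mulKf.
    + left; apply: (same u' u a) => //; last by left.
      by move=> q qC'; rewrite zE // coE b0 mul0r addr0 mxE.
  - right; apply: (same v' v b) => //; last by right.
    by move=> q qC'; rewrite zE // coE a0 mul0r add0r mxE.
have [x xK vx] := K_face Ev (nonneg_C0 v0) vnz0 va.
have xL := KL x xK; have Ex := L_E xL.
have [Hext _ uniqK] := repK; have [xext xa] := Hext x xK.
have w0xs : zeros_sub C w0 x.
  move=> q /[dup] qC' /inC[qC0'|qT] wq; first by apply: vx => //; exact: w0v.
  have := w0u q qC' wq; rewrite (link_only Eu uz qT pT); lra.
have [a [b xE]] := span x Ex w0xs.
have vx0 : exists2 c, 0 < c & eq_on C0 v (c *: x).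
  have xv : eq_on C0 x (b *: v).
    by move=> q /[dup] qC' /inC0 qC''; rewrite xE // coE uz // mulr0 add0r mxE.
  have b0 := eq_on_scale_gt0 (nonneg_C0 (L_nonneg xL)) (L_nz xL) (nonneg_C0 v0) xv.
  by exists b^-1; [rewrite invr_gt0|exact: eq_on_inv].
have [c c0 vE0] := vx0.
have v'x : exists2 c, 0 < c & eq_on C0 v' (c *: x).
  exists (av^-1 * c); first by rewrite mulr_gt0 // invr_gt0.
  move=> q qC'; rewrite mxE -mulrA.
  have := vE0 q qC'; rewrite mxE => <-; rewrite (vE q (inC0 qC')) mxE mulKf // gt_eqF //.
have [xp|xp|xp] := ltgtP (co x p) 0.
- by have := K0 xK pT; rewrite leNgt xp.
- apply: (finish x v') => //; apply/comb_adjacentP => z zL zxv.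
  have xz : zeros_sub C0 x z.
    move=> q qC' xq; apply: zxv => //; first exact: inC0.
    by have [d d0 dE] := v'x; rewrite dE // mxE xq mulr0.
  have [d d0 zx] := extreme_sub xext (L_E zL) (nonneg_C0 (L_nonneg zL)) (L_nz zL) xz.
  have [H _ _ _] := LH; case: (H z zL) => [zK|[zext znz _]].
    by left; apply: (uniqK _ _ d).
  right; have [d' d'0 v'E] := v'x.
  apply: (uniqL _ _ (d / d')) => //; apply: (lower_uniq bC zext znz v'ext (L_nz v'L)) => q qC'.
  by rewrite zx // !mxE v'E // mxE -mulrA mulKf // gt_eqF.
- exists x; first by apply/process_positionP; left; rewrite xp.
  apply: posmul => //; first exact: L_nonneg.
  by move=> xz; apply: (L_nz xL) => q /inC0/xz.
Qed.

Lemma lower_hull_step :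
  lower_hull (process_position (L, C) p).2 (process_position (L, C) p).1.
Proof.
have [LHm KL LHc uniqL] := LH.
have pass u w : u \in L /\ w \in L -> 0 < co u p -> co w p < 0 ->
    compatible u w && comb_adjacent C L u w -> passing u w.
  by move=> H1 H2 H3 /andP[_ /comb_adjacentP H4].
split.
- move=> x /process_positionP[[xL x0]|[u [w [[uL wL] up wp /andP[cuw adj] ->]]]].
    have [xK|[xext xnz xa]] := LHm x xL; [by left|right; split => //].
    have [Ex xnn xnz' xx] := xext; split => //.
    + by move=> q /setU1P[->|/xnn].
    + by move=> z; apply: xnz' => q qC'; apply: z; rewrite setU1r.
    + move=> u Eu xu; have [|a aE] := xx u Eu; first by move=> q qC'; apply: xu; rewrite setU1r.
      exists a => q /setU1P[->|/aE//]; apply: at_p => //; exact: EZ.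
  right; split; [exact: adjacent_extreme|exact: not_zero_combine|].
  apply: (quad_adm_joint qC cuw) => q qC' uq wq.
  by rewrite combineE uq wq !mulr0 subr0 mulr0.
- by move=> x xK; apply/process_positionP; left; split; [exact: KL|exact: K0].
- exact: extreme_found.
- move=> x y a /process_positionP[[xL x0]|[u [w [uwL up wp t ->]]]]
     /process_positionP[[yL y0]|[u' [w' [uwL' up' wp' t' ->]]]] xy.
  + exact: uniqL (Cp_eq xy).
  + by case: (old_new xL x0 (pass _ _ uwL' up' wp' t') xy).
  + have P := pass _ _ uwL up wp t.
    have a0 : a != 0.
      case: uwL => uL wL; apply/eqP => a0; apply: (not_zero_combine uL wL up wp) => q /inC0 qC'.
      by rewrite (Cp_eq xy qC') a0 scale0r mxE.
    exfalso; apply: (old_new (a := a^-1) yL y0 P) => q qC'.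
    by rewrite mxE (xy q qC') mxE mulKf.
  + by have [-> ->] := new_new (pass _ _ uwL up wp t) (pass _ _ uwL' up' wp' t') (Cp_eq xy).
Qed.

End OnePosition.

Let K_props x : x \in K ->
  [/\ E x, nonneg_on C0 x, ~ zero_on C0 x, extreme E C0 x & quad_adm x].
Proof. by have [H _ _] := repK; move=> /H[[]]. Qed.

(** Only [- l] is negative. It is combined with each canonical ray [x] that is
    positive at [p], which gives the lower ray below [x] for the single
    position [p]. *)
Lemma lower_hull_first p : p \in Tv ->
  lower_hull (process_position (rcons K (- l), C0) p).2
             (process_position (rcons K (- l), C0) p).1.
Proof.
move=> pT; have [_ Kc uniqK] := repK.
set Cp := (process_position (rcons K (- l), C0) p).2.
have CpE : Cp = (p |: C0)%SET by [].
have bCp : between Cp.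
  rewrite CpE; split; [exact: finset.subsetUr| |by exists p; rewrite ?setU11].
  by rewrite finset.subUset finset.sub1set finset.subsetUl andbT inE pT orbT.
have pC : p \in Cp by rewrite CpE setU11.
have lp : co (- l) p = -1 by rewrite mxE l1.
have lp1 : (0 < co (- l) p) = false by rewrite lp oppr_gt0 ltr10.
have lp2 : (0 <= co (- l) p) = false by rewrite lp oppr_ge0 ler10.
have lp3 : co (- l) p < 0 by rewrite lp oppr_lt0.
have mem z : z \in (process_position (rcons K (- l), C0) p).1 <->
    z \in K \/ exists x, [/\ x \in K, 0 < co x p & z = combine p x (- l)].
  rewrite process_positionP; split.
    case=> [[]|[u [w [[]]]]].
      rewrite mem_rcons inE => /orP[/eqP ->|zK]; last by left.
      by rewrite lp2.
    rewrite !mem_rcons !inE => /orP[/eqP ->|uK]; first by rewrite lp1.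
    move=> /orP[/eqP ->|wK]; first by move=> up _ _ ->; right; exists u.
    by rewrite [co w p < 0]ltNge (K0 wK pT).
  case=> [zK|[x [xK xp ->]]]; first by left; rewrite mem_rcons inE zK orbT (K0 zK pT).
  have [Ex x0 xnz xext xa] := K_props xK.
  have lz : zeros_sub C0 x (- l) by move=> q qC _; rewrite mxE l0 // oppr0.
  right; exists x, (- l); split; rewrite ?mem_rcons ?inE ?xK ?orbT ?eqxx //.
  rewrite (quad_adm_compatible qC0 xa _ lz) //=.
  apply/comb_adjacentP => y; rewrite mem_rcons inE => /orP[/eqP ->|yK xy]; first by right.
  have [Ey y0 ynz _ _] := K_props yK.
  have [|a a0 yE] := extreme_sub xext Ey y0 ynz; last by left; apply: uniqK yE.
  by move=> q qC xq; apply: xy => //; exact: lz.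
have ray x : x \in K -> 0 < co x p ->
    exists2 b, 0 < b & eq_on C0 (combine p x (- l)) (b *: x).
  move=> xK xp; have [a [b [a0 b0 cE]]] := @combine_pos p x (- l) xp lp3.
  by exists a => // q qC; rewrite cE !mxE l0 // oppr0 mulr0 addr0.
have EN : E (- l) by rewrite -scaleN1r; exact: EZ.
split.
- move=> z /mem[zK|[x [xK xp ->]]]; [by left|right].
  have [Ex x0 xnz xext xa] := K_props xK; have [b b0 bE] := ray x xK xp.
  have ext0 : extreme E C0 (combine p x (- l)).
    by apply: extreme_eq xext (combine_E p Ex EN) b0 bE.
  have [_ c0 cnz _] := ext0; split => //.
    apply: (extreme_of_base bCp ext0 _ pC pT (combine_at _ _ _)).
    by move=> q; rewrite CpE => /setU1P[->|/c0//]; rewrite combine_at.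
  apply: (quad_adm_sub qC0 xa) => q qC xq.
  by rewrite (bE q qC) mxE xq mulr0.
- by move=> x xK; apply/mem; left.
- move=> w wext wnz wa; have [q [qC qT wq]] := extreme_zero bCp wext wnz.
  have qp : q = p by move: qC; rewrite CpE => /setU1P[//|/C0_not_Tv/(_ qT)].
  rewrite {q qC qT}qp in wq; have [Ew w0 wnz' wx] := wext.
  have w0ext : extreme E C0 w.
    split => //; first by move=> q qC; apply: w0; rewrite CpE setU1r.
    move=> u Eu wu; have Eu' : E (u - co u p *: l) by apply: EB => //; exact: EZ.
    have [|a aE] := wx _ Eu'.
      move=> q; rewrite CpE => /setU1P[->|qC] wq'; first by rewrite !mxE l1 // mulr1 subrr.
      by rewrite !mxE l0 // mulr0 subr0 wu.
    exists a => q qC; have := aE q; rewrite CpE setU1r // => /(_ isT).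
    by rewrite !mxE l0 // mulr0 subr0.
  have [x xK [a a0 wE]] := Kc w w0ext wa.
  have [xp|xp] := ltP 0 (co x p).
    exists (combine p x (- l)); first by apply/mem; right; exists x.
    have [b b0 bE] := ray x xK xp; exists (a / b); first by rewrite divr_gt0.
    move=> q; rewrite CpE => /setU1P[->|qC]; first by rewrite wq mxE combine_at mulr0.
    by rewrite (wE q qC) mxE [RHS]mxE (bE q qC) mxE mulrA divfK // gt_eqF.
  exists x; first by apply/mem; left.
  exists a => // q; rewrite CpE => /setU1P[->|/wE//].
  by rewrite wq mxE (@le_anti _ _ (co x p) 0) ?mulr0 // xp (K0 xK pT).
- have sub u v : eq_on Cp u v -> eq_on C0 u v.
    by apply: eq_on_sub; rewrite CpE; exact: finset.subsetUr.
  move=> z z' a /mem Hz /mem Hz' zz'.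
  have zp := zz' p pC; rewrite mxE in zp; have {}zz' := sub _ _ zz'.
  case: Hz => [zK|[x [xK xp zE]]]; case: Hz' => [z'K|[y [yK yp z'E]]].
  + exact: uniqK zz'.
  + have [b b0 bE] := ray y yK yp.
    have zy : z = y.
      apply: (uniqK _ _ (a * b)) => // q qC.
      by rewrite (zz' q qC) z'E mxE (bE q qC) !mxE mulrA.
    by move: yp; rewrite -zy zp z'E combine_at mulr0 ltxx.
  + have [b b0 bE] := ray x xK xp; have b_neq : b != 0 by rewrite gt_eqF.
    have xz : x = z'.
      apply: (uniqK _ _ (b^-1 * a)) => // q qC.
      have := zz' q qC; rewrite zE (bE q qC) !mxE => H.
      by rewrite -mulrA -H mulKf.
    have := zp; rewrite zE combine_at -xz => /esym/eqP.
    rewrite mulf_eq0 (gt_eqF xp) orbF => /eqP a0.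
    have [_ _ xnz _ _] := K_props xK; case: xnz => q qC.
    have := zz' q qC; rewrite zE (bE q qC) a0 scale0r !mxE => /eqP.
    by rewrite mulf_eq0 (negbTE b_neq) => /eqP.
  + have [b b0 bE] := ray x xK xp; have [c c0 cE] := ray y yK yp.
    rewrite zE z'E; congr (combine p _ _); apply: (uniqK _ _ (b^-1 * (a * c))) => // q qC.
    have := zz' q qC; rewrite zE z'E (bE q qC) mxE [RHS]mxE (cE q qC) mxE => H.
    by rewrite mxE -!mulrA -H mulKf // gt_eqF.
Qed.

Lemma lower_hull_fold ps C L : between C -> lower_hull C L -> {subset ps <= Tv} ->
  let s := foldl (@process_position R n) (L, C) ps in
  [/\ between s.2, lower_hull s.2 s.1 & s.2 = ([set x in ps] :|: C)%SET].
Proof.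
elim: ps C L => [|p ps IH] C L bC LH sub.
  by split => //; apply/setP => q; rewrite !inE.
have pT : p \in Tv by apply: sub; rewrite mem_head.
have [s1 s2 [p0 p0C p0T]] := bC.
have bC' : between (p |: C)%SET.
  split; [exact: fintype.subset_trans s1 (finset.subsetUr _ _)| |by exists p0; rewrite ?setU1r].
  by rewrite finset.subUset finset.sub1set inE pT orbT.
have [|H1 H2 H3] := IH _ _ bC' (lower_hull_step bC LH pT).
  by move=> q qps; apply: sub; rewrite inE qps orbT.
rewrite [foldl _ _ _]/=; split => //; rewrite H3.
by apply/setP => q; rewrite !inE orbCA orbA.
Qed.

(** After the last position, the canonical rays have a zero among the processed
    positions, so they are extreme; only the link itself is missing. *)
Lemma represents_rcons C L : lower_hull C L -> C = (C0 :|: Tv)%SET -> (exists p, p \in Tv) ->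
  represents C (rcons L l).
Proof.
move=> [LHm KL LHc uniqL] CE [p0 p0T].
have p0C : p0 \in C by rewrite CE inE p0T orbT.
have sub q : q \in C0 -> q \in C by rewrite CE inE => ->.
have bC : between C.
  by rewrite CE; split; rewrite ?finset.subsetUl //; exists p0; rewrite // inE p0T orbT.
have lnz : ~ zero_on C l by move=> /(_ p0 p0C)/eqP; rewrite l1 // oner_eq0.
have Lnz x : x \in L -> ~ zero_on C0 x by case/LHm=> [/K_props[]|[]].
have lext : extreme E C l.
  split => //.
    by move=> q; rewrite CE => /setUP[/l0 ->|/l1 ->].
  move=> u Eu lu; exists (co u p0) => q qC; rewrite mxE; move: (qC).
  rewrite CE => /setUP[qC0'|qT]; first by rewrite l0 // lu ?l0 // mulr0.
  rewrite (l1 qT) mulr1; apply: (link_only Eu) => // r rC.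
  by apply: lu; rewrite ?l0 //; exact: sub.
split.
- move=> x; rewrite mem_rcons inE => /orP[/eqP ->|xL].
    split => // i k k'; rewrite !mxE.
    by rewrite (l0 (p := (i, rshift 4 k))) ?eqxx //; apply: (fintype.subsetP qC0); exact: quad_positionsP.
  have [xK|[]//] := LHm x xL; have [Ex x0 xnz xext xa] := K_props xK; split => //.
  have [p pT xp] := Kzero xK.
  apply: (extreme_of_base bC xext _ _ pT xp); last by rewrite CE inE pT orbT.
  by move=> q; rewrite CE => /setUP[/x0|/(K0 xK)].
- move=> w wext wa; have [wz|wnz] := pselect (zero_on C0 w); last first.
    have [x xL H] := LHc w wext wnz wa.
    by exists x => //; rewrite mem_rcons inE xL orbT.
  exists l; first by rewrite mem_rcons mem_head.
  have [Ew w0 wnz' _] := wext.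
  have wE : eq_on C w (co w p0 *: l).
    move=> q; rewrite CE mxE => /setUP[qC|qT]; first by rewrite l0 // mulr0 wz.
    by rewrite l1 // mulr1; apply: (link_only Ew).
  exists (co w p0) => //; apply: (eq_on_scale_gt0 w0 wnz' _ wE).
  by have [_ + _ _] := lext.
- move=> x y a; rewrite !mem_rcons !inE => /orP[/eqP ->|xL] /orP[/eqP ->|yL] // xy.
  + exfalso; have a0 : a != 0.
      by apply: contra_notN lnz => /eqP a0 q qC; rewrite (xy q qC) a0 scale0r mxE.
    apply: (Lnz y yL) => q qC; have := xy q (sub q qC); rewrite l0 // mxE => /esym/eqP.
    by rewrite mulf_eq0 (negbTE a0) => /eqP.
  + exfalso; apply: (Lnz x xL) => q qC; rewrite (xy q (sub q qC)) mxE l0 // mulr0 //.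
  + exact: uniqL xy.
Qed.

Lemma represents_vertex ps : perm_eq ps (enum Tv) -> (exists p, p \in Tv) ->
  let s := foldl (@process_position R n) (rcons K (- l), C0) ps in
  represents s.2 (rcons s.1 l) /\ s.2 = (C0 :|: Tv)%SET.
Proof.
move=> /perm_mem psE [p0 p0T]; have mem q : (q \in ps) = (q \in Tv) by rewrite psE mem_enum.
case: ps mem {psE} => [mem|p ps mem]; first by have := mem p0; rewrite p0T.
have pT : p \in Tv by rewrite -mem mem_head.
have bC' : between (p |: C0)%SET.
  split; [exact: finset.subsetUr| |by exists p; rewrite ?setU11].
  by rewrite finset.subUset finset.sub1set finset.subsetUl andbT inE pT orbT.
have [|H1 H2 H3] := @lower_hull_fold ps _ _ bC' (lower_hull_first pT).
  by move=> q qps; rewrite -mem inE qps orbT.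
rewrite [foldl _ _ _]/=.
have CE : (foldl (@process_position R n) (process_position (rcons K (- l), C0) p) ps).2
    = (C0 :|: Tv)%SET.
  rewrite H3; apply/setP => q; rewrite !inE -mem inE.
  by case: (q \in ps); case: (q == p); case: (q \in C0).
by split => //; apply: represents_rcons => //; exists p0.
Qed.

End Step.

(** * Correctness of the conversion procedure *)

Section Conversion.
Variables (R : realType) (n : nat) (T : triangulation n).
Notation vec := 'M[R]_(n, 4 + 3).
Notation pos := (position n).
Notation co w p := (w p.1 p.2).
Implicit Types (w : vec) (V : {set corner n}) (L : seq vec) (C : {set pos}).

Lemma quad_matchingD (q q' : 'M[R]_(n, 3)) :
  quad_matching T q -> quad_matching T q' -> quad_matching T (q + q').
Proof.
move=> H H' c tc; under eq_bigr do rewrite mxE; under [RHS]eq_bigr do rewrite mxE.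
by rewrite !big_split /= H // H'.
Qed.

Lemma quad_matchingZ (a : R) (q : 'M[R]_(n, 3)) :
  quad_matching T q -> quad_matching T (a *: q).
Proof.
move=> H c tc; under eq_bigr do rewrite mxE; under [RHS]eq_bigr do rewrite mxE.
by rewrite -!mulr_sumr H.
Qed.

Let ED := @std_matchingD R n T.
Let EZ := @std_matchingZ R n T.
Let QD := quad_matchingD.
Let QZ := quad_matchingZ.

Lemma link_positionsP V p : reflect (exists2 x : corner n, x \in V & p = (x.1, lshift 3 x.2))
  (p \in link_positions R V).
Proof.
case: p => i a; rewrite inE /entry /=; apply: (iffP idP) => [|[[j v] xV [-> ->]]].
  case: (split_ordP a) => b ->; last by rewrite row_mxEr mxE eqxx.
  rewrite row_mxEl mxE; case: ((i, b) \in V) / boolP => [H _|_]; last by rewrite eqxx.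
  by exists (i, b).
by rewrite /= row_mxEl mxE xV oner_neq0.
Qed.

Lemma link_at V p : p \in link_positions R V -> co (link R V) p = 1.
Proof. by case/link_positionsP=> x xV ->; rewrite row_mxEl mxE -surjective_pairing xV. Qed.

Lemma quad_positions_cases p : p \in quad_positions n \/ exists x : corner n, p = (x.1, lshift 3 x.2).
Proof.
case: p => i a; case: (split_ordP a) => b ->; [right|left]; first by exists (i, b).
exact: quad_positionsP.
Qed.

(** The set of which [kappa] takes the supremum is the half-line below the
    smallest triangular coordinate at [V]. *)
Lemma kappaP V w : (exists x, x \in V) -> exists c,
  [/\ kappa V w = w - c *: (link R V : vec), forall x, x \in V -> 0 <= tri (kappa V w) x.1 x.2 &
      exists2 x, x \in V & tri (kappa V w) x.1 x.2 = 0].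
Proof.
move=> Vne; have [x0 x0V Hmin] := finite_min (fun x => tri w x.1 x.2) Vne.
set c := tri w x0.1 x0.2 in Hmin.
have E b x : x \in V -> tri (w - b *: (link R V : vec)) x.1 x.2 = tri w x.1 x.2 - b.
  have lin (u v : vec) : tri (u - b *: v) x.1 x.2 = tri u x.1 x.2 - b * tri v x.1 x.2.
    by rewrite /tri !mxE.
  by move=> xV; rewrite lin tri_link -surjective_pairing xV mulr1.
have -> : kappa V w = w - c *: (link R V : vec).
  rewrite /kappa; congr (_ - _ *: _).
  have -> : [set l : R | forall x, x \in V -> 0 <= tri (w - l *: (link R V : vec)) x.1 x.2]%classic
    = [set l | l <= c]%classic.
    apply/seteqP; split=> l /= H; first by have := H x0 x0V; rewrite E // subr_ge0.
    by move=> x xV; rewrite E // subr_ge0 (le_trans H) // Hmin.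
  apply/le_anti/andP; split; first by apply: ge_sup => //; exists c => /=.
  by apply: ub_le_sup => /=; [exists c|].
exists c; split => //; first by move=> x xV; rewrite E // subr_ge0 Hmin.
by exists x0 => //; rewrite E // subrr.
Qed.

Notation std_represents := (represents (std_matching (R := R) T)).

Lemma process_vertexP (order : {set corner n} -> seq pos) V L C :
  V \in vertices T -> perm_eq (order V) (enum (link_positions R V)) ->
  (quad_positions n \subset C)%SET -> zero_on C (link R V) ->
  std_represents C L ->
  let s := process_vertex order (L, C) V in
  std_represents s.2 s.1 /\ s.2 = (C :|: link_positions R V)%SET.
Proof.
move=> VT ordV qC l0 rep.
have Vne := vertex_neq0 VT; have El := std_matching_link R VT.
have kC (x : vec) : eq_on C (kappa V x) x.
  have [c [-> _ _]] := kappaP x Vne.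
  move=> p pC; have lin (v : vec) : co (x - c *: v) p = co x p - c * co v p by rewrite !mxE.
  by rewrite lin l0 // mulr0 subr0.
have kE (x : vec) : std_matching T x -> std_matching T (kappa V x).
  by move=> Ex; have [c [-> _ _]] := kappaP x Vne; apply: std_matchingB => //; exact: EZ.
have repK : std_represents C [seq kappa V x | x <- L].
  have [H1 H2 H3] := rep; split.
  - move=> _ /mapP[x xL ->]; have [xext xa] := H1 x xL.
    have [Ex _ _ _] := xext; split.
      by apply: (extreme_eq xext (kE _ Ex) ltr01) => p pC; rewrite scale1r kC.
    by apply: quad_adm_sub qC xa _ => p pC; rewrite kC.
  - move=> w wext wa; have [x xL [a a0 aE]] := H2 w wext wa.
    exists (kappa V x); first exact: map_f.
    by exists a => // p pC; rewrite aE // mxE [RHS]mxE kC.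
  - move=> _ _ a /mapP[x xL ->] /mapP[y yL ->] xy; congr (kappa V _).
    by apply: (H3 _ _ a) => // p pC; have := xy p pC; rewrite kC // mxE kC // => ->; rewrite mxE.
have link_only (u : vec) : std_matching T u -> zero_on C u ->
    forall p q, p \in link_positions R V -> q \in link_positions R V -> co u p = co u q.
  move=> Eu uz _ _ /link_positionsP[x xV ->] /link_positionsP[y yV ->].
  apply: (tri_const Eu _ VT xV yV) => i a.
  by apply: (uz (i, rshift 4 a)); apply: (fintype.subsetP qC); exact: quad_positionsP.
have K0 (x : vec) : x \in [seq kappa V x | x <- L] -> nonneg_on (link_positions R V) x.
  move=> /mapP[y _ ->] _ /link_positionsP[z zV ->].
  by have [c [_ H _]] := kappaP y Vne; exact: H.
have Kzero (x : vec) : x \in [seq kappa V x | x <- L] ->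
    exists2 p, p \in link_positions R V & co x p = 0.
  move=> /mapP[y _ ->]; have [c [_ _ [z zV Hz]]] := kappaP y Vne.
  exists (z.1, lshift 3 z.2); last exact: Hz.
  by apply/link_positionsP; exists z.
have ne : exists p, p \in link_positions R V.
  have [x xV] := Vne; exists (x.1, lshift 3 x.2).
  by apply/link_positionsP; exists x.
have := represents_vertex ED EZ qC El l0 (@link_at V) link_only repK K0 Kzero ordV ne.
rewrite /process_vertex; by case: (foldl _ _ _).
Qed.

(** Different vertices have disjoint sets of positions, so that the links still
    to come keep vanishing on the positions processed so far. *)
Lemma process_verticesP (order : {set corner n} -> seq pos) Vs L C :
  uniq Vs -> {subset Vs <= vertices T} ->
  (forall V, V \in vertices T -> perm_eq (order V) (enum (link_positions R V))) ->
  (quad_positions n \subset C)%SET -> (forall V, V \in Vs -> zero_on C (link R V)) ->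
  std_represents C L ->
  let s := foldl (process_vertex order) (L, C) Vs in
  std_represents s.2 s.1 /\ forall p, (p \in s.2) = (p \in C) || has (fun V => p \in link_positions R V) Vs.
Proof.
move=> + + Hord; elim: Vs L C => [|V Vs IH] L C; first by move=> *; split => // p; rewrite orbF.
rewrite cons_uniq => /andP[VVs uVs] sub qC zC rep.
rewrite -[foldl _ _ (V :: Vs)]/(foldl (process_vertex order) (process_vertex order (L, C) V) Vs).
have VT : V \in vertices T by apply: sub; rewrite mem_head.
have [rep' CE] := process_vertexP VT (Hord V VT) qC (zC V (mem_head _ _)) rep.
case: (process_vertex order (L, C) V) rep' CE => L' C' /= rep' CE.
have [|||rep'' CE'] := IH L' C' uVs _ _ _ rep'.
- by move=> W WVs; apply: sub; rewrite inE WVs orbT.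
- by rewrite CE; apply: fintype.subset_trans qC (finset.subsetUl _ _).
- move=> W WVs p; rewrite CE => /setUP[pC|/link_positionsP[x xV ->]].
    by apply: zC => //; rewrite inE WVs orbT.
  rewrite row_mxEl mxE -surjective_pairing; case: (boolP (x \in W)) => // xW.
  have WT : W \in vertices T by apply: sub; rewrite inE WVs orbT.
  by move: VVs; rewrite (vertex_uniq VT WT xV xW) WVs.
by split => // p; rewrite CE' CE inE -orbA.
Qed.

(** On the quadrilateral positions, the solutions of the standard equations are
    exactly the solutions of the quadrilateral ones, by [quad_lift] and
    [std_matching_quad]. *)
Lemma canonical_represents (qs : seq 'M[R]_(n, 3)) :
  compact_3manifold R (realization R T) -> [set` qs]%classic = quad_solution_set T ->
  std_represents (quad_positions n) [seq canonical_ext T q | q <- qs].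
Proof.
move=> hT hqs.
have qsP q : q \in qs <-> coord_sum q = 1 /\ extreme (quad_matching T) [set: 'I_n * 'I_3]%SET q
    /\ quad_constraints q.
  have -> : q \in qs <-> (quad_solution_set T) q by rewrite -hqs.
  rewrite /quad_solution_set /=; split.
    by move=> [/(polytope_vertexP QD QZ)[H1 H2] H3].
  by move=> [H1 [H2 H3]]; split => //; apply/(polytope_vertexP QD QZ).
have qsE q : q \in qs -> [/\ std_admissible T (canonical_ext T q), Defs.canonical T (canonical_ext T q) &
      quad_proj (canonical_ext T q) = q].
  move=> /qsP[_ [[Eq q0 _ _] qc]]; apply: canonical_extP => //.
  by move=> i j; apply: (q0 (i, j)); rewrite inE.
have posP w w' a : eq_on (quad_positions n) w (a *: w') <->
    eq_on [set: 'I_n * 'I_3]%SET (quad_proj w) (a *: (quad_proj w' : 'M[R]_(n, 3))).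
  split=> [H [i k] _|H _ /imset2P[i k _ _ ->]] /=.
    by have := H _ (quad_positionsP i k); rewrite !mxE.
  by have := H (i, k); rewrite inE !mxE => /(_ isT).
have zP w : zero_on (quad_positions n) w <-> zero_on [set: 'I_n * 'I_3]%SET (quad_proj w).
  split=> [H [i k] _|H _ /imset2P[i k _ _ ->]] /=.
    by have := H _ (quad_positionsP i k); rewrite !mxE.
  by have := H (i, k); rewrite inE !mxE => /(_ isT).
have zsP w w' : zeros_sub (quad_positions n) w w' <->
    zeros_sub [set: 'I_n * 'I_3]%SET (quad_proj w) (quad_proj w').
  split=> [H [i k] _|H _ /imset2P[i k _ _ ->]] /=.
    by have := H _ (quad_positionsP i k); rewrite !mxE.
  by have := H (i, k); rewrite inE !mxE => /(_ isT).
have nP w : nonneg_on (quad_positions n) w <-> nonneg_on [set: 'I_n * 'I_3]%SET (quad_proj w).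
  split=> [H [i k] _|H _ /imset2P[i k _ _ ->]] /=.
    by have := H _ (quad_positionsP i k); rewrite !mxE.
  by have := H (i, k); rewrite inE !mxE => /(_ isT).
have extP w : std_matching T w -> extreme (std_matching T) (quad_positions n) w <->
    extreme (quad_matching T) [set: 'I_n * 'I_3]%SET (quad_proj w).
  move=> Ew; split=> -[_ w0 wnz wx]; split => //.
  - exact: std_matching_quad.
  - exact/nP.
  - by move=> /zP.
  - move=> u Eu wu; have [u' Eu' u'E] := quad_lift hT Eu.
    have [|a aE] := wx u' Eu'; first by apply/zsP; rewrite u'E.
    by exists a; rewrite -u'E; apply/posP.
  - exact/nP.
  - by move=> /zP.
  - move=> u Eu wu; have [|a aE] := wx (quad_proj u) (std_matching_quad Eu); first exact/zsP.
    by exists a; apply/posP.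
have sumZ a (q : 'M[R]_(n, 3)) : coord_sum (a *: q) = a * coord_sum q.
  rewrite /coord_sum mulr_sumr; apply: eq_bigr => i _; rewrite mulr_sumr.
  by apply: eq_bigr => j _; rewrite mxE.
have eqT (q q' : 'M[R]_(n, 3)) : eq_on [set: 'I_n * 'I_3]%SET q q' -> q = q'.
  by move=> H; apply/matrixP => i j; have := H (i, j); apply; rewrite inE.
split.
- move=> _ /mapP[q qqs ->]; have [[_ Ew wc] _ wq] := qsE q qqs; split => //.
  by apply/extP => //; rewrite wq; have /qsP[_ []] := qqs.
- move=> w wext wa; have [Ew _ _ _] := wext.
  have qext := (extP w Ew).1 wext; set q := quad_proj w in qext.
  have [Eq q0 qnz _] := qext.
  have s0 : 0 < coord_sum q.
    have [p _ pq] := not_zero_on qnz.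
    rewrite /coord_sum (bigD1 p.1) //= (bigD1 p.2) //=.
    have q0' i j : 0 <= q i j by apply: (q0 (i, j)); rewrite inE.
    rewrite -addrA ltr_pwDl //; first by rewrite lt_neqAle eq_sym pq q0'.
    by rewrite addr_ge0 ?sumr_ge0 // => i _; rewrite sumr_ge0.
  pose q' := (coord_sum q)^-1 *: q.
  have q'qs : q' \in qs.
    apply/qsP; split; first by rewrite sumZ mulVf // gt_eqF.
    split; first by apply: (extreme_eq (b := (coord_sum q)^-1) qext); rewrite ?invr_gt0 //; exact: QZ.
    move=> i k k'; rewrite !mxE !mulf_eq0 !negb_or => /andP[_ Hk] /andP[_ Hk'].
    by apply: (wa i k k'); rewrite mxE.
  exists (canonical_ext T q'); first exact: map_f.
  exists (coord_sum q) => //; apply/posP.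
  have [_ _ ->] := qsE q' q'qs; rewrite /q' scalerA divff ?scale1r // gt_eqF //.
- move=> _ _ a /mapP[q qqs ->] /mapP[q' q'qs ->] /posP.
  have [_ _ ->] := qsE q qqs; have [_ _ ->] := qsE q' q'qs => /eqT qE.
  have /qsP[s1 _] := qqs; have /qsP[s1' _] := q'qs.
  by move: s1; rewrite qE sumZ s1' mulr1 => ->; rewrite scale1r.
Qed.

(** With all positions in play, the members of the list are the extreme rays
    themselves, up to a factor that normalization removes. *)
Lemma represents_solution_set L : std_represents [set: pos]%SET L ->
  [set` [seq projective_image v | v <- L]]%classic = std_solution_set T.
Proof.
move=> [Lext Lc _].
have sumZ a x : coord_sum (a *: x) = a * coord_sum x.
  rewrite /coord_sum mulr_sumr; apply: eq_bigr => i _; rewrite mulr_sumr.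
  by apply: eq_bigr => j _; rewrite mxE.
have eqT x y : eq_on [set: pos]%SET x y -> x = y.
  by move=> H; apply/matrixP => i j; have := H (i, j); apply; rewrite inE.
apply/seteqP; split=> [_ /mapP[x xL ->]|w [/(polytope_vertexP ED EZ)[w1 wext] wa]] /=.
  have [xext xa] := Lext x xL; have [Ex x0 xnz _] := xext.
  have s0 : 0 < coord_sum x.
    have [p _ px] := not_zero_on xnz.
    rewrite /coord_sum (bigD1 p.1) //= (bigD1 p.2) //=.
    have x0' i j : 0 <= x i j by apply: (x0 (i, j)); rewrite inE.
    rewrite -addrA ltr_pwDl //; first by rewrite lt_neqAle eq_sym px x0'.
    by rewrite addr_ge0 ?sumr_ge0 // => i _; rewrite sumr_ge0.
  split.
    apply/(polytope_vertexP ED EZ); split; first by rewrite sumZ mulVf // gt_eqF.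
    by apply: (extreme_eq (b := (coord_sum x)^-1) xext); rewrite ?invr_gt0 //; exact: EZ.
  apply: (quad_adm_sub (C := [set: pos]%SET) _ xa) => //.
  by move=> p _ xp; rewrite mxE xp mulr0.
have [x xL [a a0 /eqT wE]] := Lc w wext wa.
apply/mapP; exists x => //; rewrite /projective_image wE; congr (_ *: _).
have : a * coord_sum x = 1 by rewrite -sumZ -wE.
move=> ax; apply: (mulIf (x := coord_sum x)); last rewrite ax mulVf //;
  by apply: contra_eq_neq ax => ->; rewrite mulr0 eq_sym oner_neq0.
Qed.

End Conversion.

Local Close Scope ring_scope.
Local Open Scope classical_set_scope.

Theorem mainTheorem3 (R : realType) (n : nat) (T : triangulation n)
    (hT : compact_3manifold R (realization R T))
    (* V_1, ..., V_m: the vertices of T, in any order *)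
    (Vs : seq {set corner n}) (hVs : perm_eq Vs (enum (vertices T)))
    (* any order on the positions belonging to each vertex *)
    (order : {set corner n} -> seq (position n))
    (horder : forall V, V \in vertices T ->
       perm_eq (order V) (enum (link_positions R V)))
    (* step 1: the output of direct enumeration *)
    (qs : seq 'M[R]_(n, 3)) (hqs : [set` qs] = quad_solution_set T) :
  (* step 2 *)
  [set` conversion T order Vs qs : seq 'M[R]_(n, 4 + 3)]
    = std_solution_set T.
Proof.
have VsP V : (V \in Vs) = (V \in vertices T) by rewrite (perm_mem hVs) mem_enum.
have [||||||rep CE] := @process_verticesP R n T order Vs
    [seq canonical_ext T q | q <- qs] (quad_positions n).
- by rewrite (perm_uniq hVs) enum_uniq.
- by move=> V; rewrite VsP.
- exact: horder.
- exact: fintype.subxx.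
- move=> V _ _ /imset2P[i k _ _ ->] /=; exact: quad_link.
- exact: canonical_represents.
rewrite /conversion; case: (foldl _ _ _) rep CE => L C /= rep CE.
apply: represents_solution_set; suff <- : C = [set: position n]%SET by [].
apply/setP => p; rewrite CE inE; apply/orP.
have [|[x ->]] := quad_positions_cases p; [by left|right].
have [V VT xV] := vertex_of T x.
by apply/hasP; exists V; rewrite ?VsP //; apply/link_positionsP; exists x.
Qed.
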